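(* Consider the interval model $Y_t={\bf Z}_t'{\boldsymbol\theta}^0+u_t$, $t=1,\dots,T$, described in the context, with fixed dimension $p$. Write ${\boldsymbol\theta}^0=({\boldsymbol\theta}_1^{0\prime},{\boldsymbol\theta}_2^{0\prime})'$, where (after relabeling the coordinates) ${\boldsymbol\theta}_1^0\in\mathbb{R}^{k_0}$ has all entries nonzero and ${\boldsymbol\theta}_2^0={\bf 0}\in\mathbb{R}^{p-k_0}$; write correspondingly $\hat{\boldsymbol\theta}_T=(\hat{\boldsymbol\theta}_{1T}',\hat{\boldsymbol\theta}_{2T}')'$ and let ${\bf Z}_{1t}$ be the vector of the first $k_0$ components of ${\bf Z}_t$. Suppose: (A1) $\{Y_t,X_{1,t},\dots,X_{J,t}\}$ are strictly stationary and ergodic interval stochastic processes with $\mathbb{E}\|Y_t\|_K^4<\infty$, $\mathbb{E}\|X_{j,t}\|_K^4<\infty$ for all $j$; $\mathbb{E}(u_t\mid\mathcal{I}_{t-1})=[0,0]$ a.s. and $\mathbb{E}(\|u_t\|_K^2\mid\mathcal{I}_{t-1})=\sigma^2$; (A2) the parameter space $\Theta$ is a compact subset of $\mathbb{R}^p$ and ${\boldsymbol\theta}^0$ is an interior point of $\Theta$; (A3) $\mathbb{E}[\langle s_{{\bf Z}_t},s'_{{\bf Z}_t}\rangle_K]$ and $\mathbb{E}[\langle s_{{\bf Z}_t},s_{u_t({\boldsymbol\theta})}\rangle_K\langle s_{u_t({\boldsymbol\theta})},s'_{{\bf Z}_t}\rangle_K]$, with $u_t({\boldsymbol\theta})=Y_t-{\bf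 Z}_t'{\boldsymbol\theta}$, are positive definite for all ${\boldsymbol\theta}$ in a small neighborhood of ${\boldsymbol\theta}^0$; (A4) $\lambda_T/\sqrt T\to0$ and $\lambda_T T^{(\gamma-1)/2}\to\infty$ as $T\to\infty$. Then: (i) $\lim_{T\to\infty}P(\hat{\boldsymbol\theta}_{2T}={\bf 0})=1$; (ii) as $T\to\infty$, $\sqrt{T}(\hat{\boldsymbol\theta}_{1T}-{\boldsymbol\theta}_1^0)\xrightarrow{d}N\big({\bf 0},\,C_{11}^{-1}\mathbb{E}[\langle s_{{\bf Z}_{1t}},s_{u_t}\rangle_K\langle s_{u_t},s'_{{\bf Z}_{1t}}\rangle_K]C_{11}^{-1}\big)$, where $C_{11}$ is the upper-left $k_0\times k_0$ block of $\mathbb{E}[\langle s_{{\bf Z}_t},s'_{{\bf Z}_t}\rangle_K]$.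
   Context: Intervals: an (extended) interval is an ordered pair $A=[A_L,A_R]$ of real numbers, where $A_R<A_L$ is allowed. Operations: $A+B=[A_L+B_L,A_R+B_R]$, $A-B=[A_L-B_L,A_R-B_R]$, $cA=[cA_L,cA_R]$ for $c\in\mathbb{R}$. The support function of $A$ on $\{-1,1\}$ is $s_A(1)=A_R$, $s_A(-1)=-A_L$. Fix a symmetric positive definite kernel $K:\{-1,1\}^2\to\mathbb{R}$: $K(1,-1)=K(-1,1)$, $K(1,1)>0$, $K(1,1)K(-1,-1)>K(1,-1)^2$. Define $\langle s_A,s_B\rangle_K=\sum_{u,v\in\{-1,1\}}K(u,v)s_A(u)s_B(v)$ and $\|A\|_K^2=\langle s_A,s_A\rangle_K$. For a column vector of intervals ${\bf A}=(A_1,\dots,A_p)'$ and an interval $C$: $\langle s_{\bf A},s'_{\bf A}\rangle_K$ is the $p\times p$ matrix with entries $\langle s_{A_i},s_{A_j}\rangle_K$, $\langle s_{\bf A},s_C\rangle_K$ is the $p$-vector with entries $\langle s_{A_i},s_C\rangle_K$, $\langle s_C,s'_{\bf A}\rangle_K$ its transpose; ${\bf A}'{\boldsymbol\theta}=\sum_j\theta_jA_j$ for ${\boldsymbol\theta}\in\mathbb R^p$. Model: $Y_t$, $X_{1,t},\dots,X_{J,t}$ interval-valued time series; $I_0=[-1/2,1/2]$; ${\bf X}_t=(X_{1,t},\dots,X_{J,t})'$; ${\bf Z}_t=([1,1],I_0,Y_{t-1},\dots,Y_{t-q},{\bf X}_t',\dots,{\bf X}_{t-s}')'$ (a vector of $p$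 intervals); $Y_t={\bf Z}_t'{\boldsymbol\theta}^0+u_t$ with true ${\boldsymbol\theta}^0\in\mathbb{R}^p$ and interval innovation $u_t$; $\mathcal{I}_{t-1}$ is the information set at time $t-1$. Estimators: $\tilde{\boldsymbol\theta}_T=(\tilde\theta_1,\dots,\tilde\theta_p)'=\arg\min_{\boldsymbol\theta}\sum_{t=1}^T\|Y_t-{\bf Z}_t'{\boldsymbol\theta}\|_K^2$ (minimum $D_K$-distance estimator) and $\hat{\boldsymbol\theta}_T=\arg\min_{\boldsymbol\theta}\sum_{t=1}^T\|Y_t-{\bf Z}_t'{\boldsymbol\theta}\|_K^2+\lambda_T\sum_{j=1}^p|\theta_j|/|\tilde\theta_j|^\gamma$ with tuning parameter $\lambda_T>0$ and constant $\gamma>0$. *)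

(* Defs.v *)
From HB Require Import structures.
From mathcomp Require Import all_boot all_order all_algebra.
From mathcomp Require Import all_classical all_reals all_analysis.
Unset Printing Implicit Defensive.
Import Order.TTheory GRing.Theory Num.Theory.
Import numFieldNormedType.Exports.
Local Open Scope classical_set_scope.
Local Open Scope ring_scope.

(* An extended interval A = [A_L, A_R] is the pair (A_L, A_R). *)
Definition itv (R : realType) := (R * R)%type.

Section IntervalDefs.
Context {R : realType}.
Local Notation itvR := (itv R).

Definition iL (A : itvR) : R := A.1.
Definition iR (A : itvR) : R := A.2.
Definition ipoint (a : R) : itvR := (a, a).
Definition I0 : itvR := (- (1/2), 1/2).
Definition iadd (A B : itvR) : itvR := (A.1 + B.1, A.2 + B.2).
Definition isub (A B : itvR) : itvR := (A.1 - B.1, A.2 - B.2).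
Definition iscale (c : R) (A : itvR) : itvR := (c * A.1, c * A.2).

(* The points of {-1,1} are encoded by bool: true = 1, false = -1. *)
Definition supp (A : itvR) (u : bool) : R := if u then A.2 else - A.1.

Definition spd_kernel (K : bool -> bool -> R) : Prop :=
  K true false = K false true /\ 0 < K true true /\
  K true false ^+ 2 < K true true * K false false.

Definition kip (K : bool -> bool -> R) (A B : itvR) : R :=
  \sum_(u : bool) \sum_(v : bool) K u v * supp A u * supp B v.
Definition knorm2 (K : bool -> bool -> R) (A : itvR) : R := kip K A A.

Definition ilincomb {p : nat} (Z : 'I_p -> itvR) (th : 'rV[R]_p) : itvR :=
  (\sum_(j < p) th 0 j * (Z j).1, \sum_(j < p) th 0 j * (Z j).2).

Definition pdim (q J s : nat) : nat := (2 + q + J * s.+1)%N.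

Definition Zseq {T : Type} (q J s : nat) (Y : int -> T -> itvR)
  (X : 'I_J -> int -> T -> itvR) (t : int) (w : T) : seq itvR :=
  [:: ipoint 1; I0] ++ [seq Y (t - i%:Z) w | i <- iota 1 q]
  ++ flatten [seq [seq X j (t - l%:Z) w | j <- enum 'I_J] | l <- iota 0 s.+1].

Definition Zvec {T : Type} (q J s : nat) (Y : int -> T -> itvR)
  (X : 'I_J -> int -> T -> itvR) (t : int) (w : T) : 'I_(pdim q J s) -> itvR :=
  fun j => nth (ipoint 0) (Zseq q J s Y X t w) j.

Definition resid {T : Type} (q J s : nat) (Y : int -> T -> itvR)
  (X : 'I_J -> int -> T -> itvR) (th : 'rV[R]_(pdim q J s)) (t : int) (w : T) : itvR :=
  isub (Y t w) (ilincomb (Zvec q J s Y X t w) th).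

Definition dk_obj {T : Type} (K : bool -> bool -> R) (q J s : nat)
  (Y : int -> T -> itvR) (X : 'I_J -> int -> T -> itvR) (n : nat) (w : T)
  (th : 'rV[R]_(pdim q J s)) : R :=
  \sum_(1 <= t < n.+1) knorm2 K (resid q J s Y X th (t%:Z) w).

Definition alasso_pen {p : nat} (lam gam : R) (thtil th : 'rV[R]_p) : R :=
  lam * \sum_(j < p) `|th 0 j| / (`|thtil 0 j| `^ gam).

Definition posdef {n : nat} (M : 'M[R]_n) : Prop :=
  M^T = M /\ forall v : 'rV[R]_n, v != 0 -> 0 < (v *m M *m v^T) 0 0.

Definition submx_on {n : nat} (S : {set 'I_n}) (M : 'M[R]_n) : 'M[R]_#|S| :=
  \matrix_(i, j) M (enum_val i) (enum_val j).

End IntervalDefs.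

Section ProbDefs.
Context {R : realType} {d : measure_display} {T : measurableType d}.
Variable P : probability T R.

(* Real coordinate process V : time -> coordinate -> Omega -> R.
   Strict stationarity: all finite-dimensional joint laws are shift
   invariant (laws of finite vectors are determined on products of Borel sets). *)
Definition strictly_stationary {I : Type} (V : int -> I -> T -> R) : Prop :=
  forall (n : nat) (ts : 'I_n -> int) (cs : 'I_n -> I) (Bs : 'I_n -> set R) (h : int),
    (forall k, measurable (Bs k)) ->
    P [set w | forall k, Bs k (V (ts k) (cs k) w)] =
    P [set w | forall k, Bs k (V (ts k + h) (cs k) w)].

Definition cylinder_sets {I : Type} : set (set (int -> I -> R)) :=
  [set A | exists t c (B : set R), measurable B /\ A = [set x | B (x t c)]].
Definition path_measurable {I : Type} (A : set (int -> I -> R)) : Prop :=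
  <<s @cylinder_sets I >> A.
Definition path_shift {I : Type} (x : int -> I -> R) : int -> I -> R :=
  fun t c => x (t + 1) c.

Definition ergodic {I : Type} (V : int -> I -> T -> R) : Prop :=
  forall A : set (int -> I -> R), path_measurable A ->
    A = (@path_shift I) @^-1` A ->
    P [set w | A (fun t c => V t c w)] = 0%E \/
    P [set w | A (fun t c => V t c w)] = 1%E.

(* E(f | G) = c a.s. for a constant c, via the defining property of
   conditional expectation (c is G-measurable). *)
Definition cond_exp_const (G : set (set T)) (f : T -> R) (c : R) : Prop :=
  f \in Lfun P 1 /\
  forall A, G A -> ('E_P[f \* \1_A] = c%:E * P A)%E.

(* A random vector G : Omega' -> R^k has law N(0, V), defined through its
   characteristic function E exp(i u'G) = exp(-u'Vu/2)
   (real and imaginary parts written separately). *)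
Definition gaussian_vec {d' : measure_display} {T' : measurableType d'}
  (Q : probability T' R) {k : nat} (G : T' -> 'rV[R]_k) (V : 'M[R]_k) : Prop :=
  (forall i, measurable_fun setT (fun w => G w ord0 i)) /\
  forall u : 'rV[R]_k,
    ('E_Q[fun w => cos ((G w *m u^T) ord0 ord0)])%E = (expR (- ((u *m V *m u^T) ord0 ord0) / 2))%:E /\
    ('E_Q[fun w => sin ((G w *m u^T) ord0 ord0)] = 0)%E.

Definition cvg_dist_normal {k : nat} (Xs : nat -> T -> 'rV[R]_k) (V : 'M[R]_k) : Prop :=
  exists (d' : measure_display) (T' : measurableType d') (Q : probability T' R)
         (G : T' -> 'rV[R]_k),
    gaussian_vec Q G V /\
    forall g : 'rV[R]_k -> R, continuous g -> (exists M : R, forall x, `|g x| <= M) ->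
      (fun n => 'E_P[g \o Xs n])%E @ \oo --> ('E_Q[g \o G])%E.

End ProbDefs.

(* Coordinates of the joint process (Y_t, X_{1,t}, ..., X_{J,t}):
   index (None, b) = Y, (Some j, b) = X_j; b = false: left end, true: right end. *)
Definition joint_coords {R : realType} {T : Type} {J : nat} (Y : int -> T -> itv R)
  (X : 'I_J -> int -> T -> itv R) (t : int) (c : option 'I_J * bool) (w : T) : R :=
  let A := match c.1 with None => Y t w | Some j => X j t w end in
  if c.2 then A.2 else A.1.

(* Information set I_{t-1} = sigma(Y_{t-1}, Y_{t-2}, ..., X_t, X_{t-1}, ...) *)
Definition info_set {R : realType} {d : measure_display} {T : measurableType d}
  {J : nat} (Y : int -> T -> itv R) (X : 'I_J -> int -> T -> itv R) (t : int)
  : set (set T) :=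
  <<s [set A | exists (r : int) (c : option 'I_J * bool) (B : set R),
        measurable B /\
        (if c.1 is None then r <= t - 1 else r <= t) /\
        A = (joint_coords Y X r c) @^-1` B] >>.

(* Main.v *)
Require Import Defs.
From HB Require Import structures.
From mathcomp Require Import all_boot all_order all_algebra.
From mathcomp Require Import all_classical all_reals all_analysis.
From mathcomp Require Import measurable_realfun ring lra.
Import Order.TTheory GRing.Theory Num.Theory.
Import numFieldNormedType.Exports.
Local Open Scope classical_set_scope.
Local Open Scope ring_scope.
Set Implicit Arguments.
Unset Strict Implicit.

(** Write [C] and [M] for the two matrices of (A3) at [th0], and [x_n = n^(-1/2) W_n],
    [a_n = A_n / n] with [W_n] the score and [A_n] the Gram matrix of the sample. In the variable
    [z = sqrt n (th - th0)] the criterion is [- 2 x_n.z + z a_n z'] up to a constant. By the mean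
    ergodic theorem on path space [a_n] tends to [C], and a martingale central limit theorem shows
    that [x_n] is asymptotically [N(0, M)]. Comparing values of the criterion (no first-order
    condition is needed) gives [sqrt n (thtil - th0) = x_n C^-1 + o_P(1)], so [thtil] is
    [sqrt n]-consistent with weights bounded on the support [S]; off [S] the weights are of order
    [n^(gam/2)] at least, so keeping a nonzero coordinate there costs more than the quadratic part
    can save. On the event that the support is found, the same comparison restricted to [S] gives
    the limit law.

    The weight of a coordinate with [thtil_j = 0] is [0] (division by zero) instead of infinite;
    this is harmless because the limit law of [sqrt n thtil_j] has no atom at [0]. *)

(** * Expectations *)

(** The score has no known conditional variance: only that of the kernel norm of [u_t] is
    prescribed, while the weights coming from [Z_t] vary. Time is therefore cut into blocks of a
    fixed length, over which stationarity and the ergodic theorem for squared increments do the work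
    of a conditional variance. All Fourier arguments stay real: cos(y + phi) with a free phase [phi]
    stands for exp(i y), the sine being the case phi = - pi / 2. Gaussian limits are defined by
    characteristic functions but convergence is tested on bounded continuous functions. The bridge
    is tightness together with trigonometric polynomials that approximate on cubes and keep the
    global bound. Every competitor in a comparison of criteria must lie in [Theta]. Since [th0] is
    interior, th0 + n^(-1/2) z is admissible for large n when z stays bounded; this is why
    boundedness in probability is established before any limit law. Both estimators follow one
    argument, minimization over the row space of a matrix [E]: the identity for [thtil], the
    selection of the support for [thhat]. *)

Section measurable_comparison.
Context {R : realType} {d : measure_display} {T : measurableType d}.
Variables f g : T -> R.
Hypotheses (mf : measurable_fun setT f) (mg : measurable_fun setT g).

Lemma measurable_set_le : measurable [set x | f x <= g x].
Proof.
have /(_ measurableT [set true] I) := measurable_fun_ler mf mg.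
by rewrite setTI.
Qed.

Lemma measurable_set_lt : measurable [set x | f x < g x].
Proof.
have /(_ measurableT [set true] I) := measurable_fun_ltr mf mg.
by rewrite setTI.
Qed.

End measurable_comparison.

Section expectation.
Context {R : realType} {d : measure_display} {T : measurableType d}.
Variable P : probability T R.
Implicit Types f g h : T -> R.

Definition itg f := P.-integrable setT (EFin \o f).
Definition Ex f : R := \int[P]_x f x.

Lemma itg_meas f : itg f -> measurable_fun setT f.
Proof. by move=> /measurable_int /measurable_EFinP. Qed.

Lemma itg_dom f g : measurable_fun setT f -> itg g ->
  (forall x, `|f x| <= g x) -> itg f.
Proof.
move=> mf ig fg; apply: (le_integrable _ _ _ ig) => //=.
  exact/measurable_EFinP.
move=> x _; rewrite lee_fin (le_trans (fg x))//; exact: ler_norm.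
Qed.

Lemma eq_itg f g : f =1 g -> itg f -> itg g.
Proof. by move=> /funext ->. Qed.

Lemma itg_cst c : itg (fun=> c).
Proof. exact: finite_measure_integrable_cst. Qed.

Lemma itgD f g : itg f -> itg g -> itg (fun x => f x + g x).
Proof. by move=> fi gi; exact: (integrableD measurableT fi gi). Qed.

Lemma itgN f : itg f -> itg (fun x => - f x).
Proof. by move=> fi; exact: (integrableN fi). Qed.

Lemma itgB f g : itg f -> itg g -> itg (fun x => f x - g x).
Proof. by move=> fi /itgN gi; exact: itgD. Qed.

Lemma itgZ c f : itg f -> itg (fun x => c * f x).
Proof.
by move=> fi; have := integrableZl measurableT c fi; apply: eq_integrable.
Qed.

Lemma itg_sum I (s : seq I) (Q : pred I) (h : I -> T -> R) :
  (forall i, Q i -> itg (h i)) -> itg (fun x => \sum_(i <- s | Q i) h i x).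
Proof.
move=> hi; elim: s => [|i s IH].
  by apply: (@eq_itg (fun=> 0)); [move=> x; rewrite big_nil|exact: itg_cst].
apply: (@eq_itg (fun x => (if Q i then h i x else 0) +
    \sum_(j <- s | Q j) h j x)) => [x|].
  by rewrite big_cons; case: ifP; rewrite ?add0r.
apply: itgD => //; case: (boolP (Q i)) => Qi; [exact: hi|exact: itg_cst].
Qed.

Lemma itg_abs f : itg f -> itg (fun x => `|f x|).
Proof. exact: integrable_norm. Qed.

Lemma itg_bounded f c : measurable_fun setT f -> (forall x, `|f x| <= c) ->
  itg f.
Proof. by move=> mf; exact: itg_dom (itg_cst c). Qed.

Lemma itgMb f h c : itg f -> measurable_fun setT h -> (forall x, `|h x| <= c) ->
  itg (fun x => f x * h x).
Proof.
move=> fi mh hc; apply: (@itg_dom _ (fun x => c * `|f x|)).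
- by apply: measurable_funM => //; exact: itg_meas.
- exact/itgZ/itg_abs.
- by move=> x; rewrite normrM mulrC ler_wpM2r.
Qed.

Lemma eq_Ex f g : f =1 g -> Ex f = Ex g.
Proof. by move=> /funext ->. Qed.

Lemma Ex_cst c : Ex (fun=> c) = c.
Proof.
by rewrite /Ex Rintegral_cst//= probability_setT mulr1.
Qed.

Lemma ExD f g : itg f -> itg g -> Ex (fun x => f x + g x) = Ex f + Ex g.
Proof. exact: RintegralD. Qed.

Lemma ExB f g : itg f -> itg g -> Ex (fun x => f x - g x) = Ex f - Ex g.
Proof. exact: RintegralB. Qed.

Lemma ExZ c f : itg f -> Ex (fun x => c * f x) = c * Ex f.
Proof. exact: RintegralZl. Qed.

Lemma Ex_sum I (s : seq I) (Q : pred I) (h : I -> T -> R) :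
  (forall i, Q i -> itg (h i)) ->
  Ex (fun x => \sum_(i <- s | Q i) h i x) = \sum_(i <- s | Q i) Ex (h i).
Proof.
move=> hi; elim: s => [|i s IH].
  rewrite big_nil -[RHS](Ex_cst 0); apply: eq_Ex => x; exact: big_nil.
rewrite big_cons -IH; case: ifPn => Qi.
  rewrite -ExD//; [|exact: hi|exact: itg_sum].
  by apply: eq_Ex => x; rewrite big_cons Qi.
by apply: eq_Ex => x; rewrite big_cons (negbTE Qi).
Qed.

Lemma Ex_le f g : itg f -> itg g -> (forall x, f x <= g x) -> Ex f <= Ex g.
Proof. by move=> fi gi fg; apply: le_Rintegral. Qed.

Lemma Ex_ge0 f : (forall x, 0 <= f x) -> 0 <= Ex f.
Proof. by move=> f0; apply: Rintegral_ge0. Qed.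

Lemma Ex_abs f : itg f -> `|Ex f| <= Ex (fun x => `|f x|).
Proof. exact: le_normr_Rintegral. Qed.

Lemma Ex_abs_le f g : itg f -> itg g -> (forall x, `|f x| <= g x) ->
  `|Ex f| <= Ex g.
Proof.
move=> fi gi fg; apply: le_trans (Ex_abs fi) _.
by apply: Ex_le => //; exact: itg_abs.
Qed.

Lemma expectationE f : itg f -> 'E_P[f]%E = (Ex f)%:E.
Proof. by move=> fi; rewrite unlock /Ex /Rintegral fineK// integrable_fin_num. Qed.

Lemma ge0_itg f : measurable_fun setT f -> (forall x, 0 <= f x) ->
  ('E_P[f] < +oo)%E -> itg f.
Proof.
move=> mf f0; rewrite unlock => fy; apply/integrableP; split.
  exact/measurable_EFinP.
by under eq_integral do rewrite /= ger0_norm//.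
Qed.

Lemma Ex_dct_ae (f_ : nat -> T -> R) f g :
  (forall n, measurable_fun setT (f_ n)) -> measurable_fun setT f -> itg g ->
  (forall n x, `|f_ n x| <= g x) ->
  {ae P, forall x, (fun n => f_ n x) @ \oo --> f x} ->
  (fun n => Ex (f_ n)) @ \oo --> Ex f.
Proof.
move=> mf mff gi fg ff.
have [] := @dominated_convergence _ _ _ P setT measurableT
  (fun n => EFin \o f_ n) (EFin \o f) (EFin \o g).
- by move=> n; exact/measurable_EFinP.
- exact/measurable_EFinP.
- apply: filterS ff => x ff _; by apply: cvg_EFin; [exact: nearW|exact: ff].
- exact: gi.
- by apply: aeW => x n _; rewrite lee_fin.
move=> fi _ H.
rewrite /Ex /Rintegral.
apply: fine_cvg; rewrite fineK; first exact: H.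
exact: integrable_fin_num.
Qed.

Lemma Ex_dct (f_ : nat -> T -> R) f g :
  (forall n, measurable_fun setT (f_ n)) -> itg g ->
  (forall n x, `|f_ n x| <= g x) ->
  (forall x, (fun n => f_ n x) @ \oo --> f x) ->
  (fun n => Ex (f_ n)) @ \oo --> Ex f.
Proof.
move=> mf gi fg ff; apply: Ex_dct_ae gi fg _ => //; last exact: aeW.
by apply: (measurable_fun_cvg mf) => x _; exact: ff.
Qed.

Definition Pr (A : set T) : R := fine (P A).

Lemma PrK A : measurable A -> (Pr A)%:E = P A.
Proof. by move=> mA; rewrite /Pr fineK// fin_num_measure. Qed.

Lemma Pr_ge0 A : 0 <= Pr A.
Proof. exact: fine_ge0. Qed.

Lemma itg_indic A : measurable A -> itg \1_A.
Proof. by move=> mA; apply: integrable_indic. Qed.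

Lemma Pr_Ex A : measurable A -> Pr A = Ex \1_A.
Proof.
by move=> mA; rewrite /Pr /Ex /Rintegral integral_indic// setIT.
Qed.

Lemma Pr_le A B : measurable A -> measurable B -> A `<=` B -> Pr A <= Pr B.
Proof.
move=> mA mB AB; rewrite -lee_fin !PrK//.
by apply: le_measure => //; rewrite inE.
Qed.

Lemma PrC A : measurable A -> Pr (~` A) = 1 - Pr A.
Proof.
move=> mA; apply: EFin_inj; rewrite PrK; last exact: measurableC.
by rewrite probability_setC// EFinB PrK.
Qed.

Lemma PrU A B : measurable A -> measurable B -> Pr (A `|` B) <= Pr A + Pr B.
Proof.
move=> mA mB; rewrite -lee_fin EFinD !PrK//; last exact: measurableU.
exact: measureU2.
Qed.

Lemma markov_Pr f c : itg f -> (forall x, 0 <= f x) -> 0 < c ->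
  Pr [set x | c <= f x] <= c^-1 * Ex f.
Proof.
move=> fi f0 c0.
have mA : measurable [set x | c <= f x].
  exact: measurable_set_le (measurable_cst c) (itg_meas fi).
rewrite Pr_Ex// -ExZ//; apply: Ex_le; [exact: itg_indic|exact: itgZ|].
move=> x; rewrite indicE; case: (boolP (x \in _)).
  by rewrite inE /= => cf; rewrite ler_pdivlMl// mulr1.
by move=> _; rewrite mulr_ge0// invr_ge0 ltW.
Qed.

End expectation.

(** * Mean ergodic theorem *)

Section measure_preserving.
Context {R : realType} {d d' : measure_display} {T : measurableType d}
  {T' : measurableType d'}.

(** Source and target may differ, so that the notion covers both the passage from the sample space
    to path space and the shift of path space. *)
Definition mpres (P : probability T R) (Q : probability T' R) (V : T -> T') :=
  measurable_fun setT V /\ forall A, measurable A -> P (V @^-1` A) = Q A.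

Variables (P : probability T R) (Q : probability T' R) (V : T -> T').
Hypothesis PQV : mpres P Q V.

Lemma mpres_ge0_integral (g : T' -> \bar R) : measurable_fun setT g ->
  (forall y, (0 <= g y)%E) -> (\int[P]_x g (V x) = \int[Q]_y g y)%E.
Proof.
move=> mg g0; have [mV VQ] := PQV.
transitivity (\int[pushforward P V]_y g y)%E.
  by rewrite ge0_integral_pushforward// => y _; exact: g0.
by apply: eq_measure_integral => A mA _; exact: VQ.
Qed.

Lemma mpres_itg (f : T' -> R) : itg Q f -> itg P (f \o V).
Proof.
move=> fi; have [mV VQ] := PQV; have mf := itg_meas fi.
apply/integrableP; split; first exact/measurable_EFinP/measurableT_comp.
have /integrableP[_] := fi.
rewrite -(mpres_ge0_integral (g := fun y => `|(f y)%:E|%E))//.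
by apply/measurable_EFinP; exact: measurableT_comp.
Qed.

Lemma mpres_Ex (f : T' -> R) : itg Q f -> Ex P (f \o V) = Ex Q f.
Proof.
move=> fi; have [mV VQ] := PQV; have mf := itg_meas fi.
rewrite /Ex /Rintegral; congr fine.
rewrite -(_ : \int[pushforward P V]_y (f y)%:E = \int[Q]_y (f y)%:E)%E; last first.
  by apply: eq_measure_integral => A mA _; exact: VQ.
rewrite integral_pushforward//; first exact/measurable_EFinP.
exact: mpres_itg.
Qed.

End measure_preserving.

Lemma mpres_id {R : realType} {d} {T : measurableType d} (P : probability T R) :
  mpres P P id.
Proof. by split. Qed.

Lemma mpres_comp {R : realType} {d1 d2 d3} {T1 : measurableType d1}
  {T2 : measurableType d2} {T3 : measurableType d3} (P1 : probability T1 R)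
  (P2 : probability T2 R) (P3 : probability T3 R) V W :
  mpres P1 P2 V -> mpres P2 P3 W -> mpres P1 P3 (W \o V).
Proof.
move=> [mV hV] [mW hW]; split; first exact: measurableT_comp.
move=> A mA; rewrite comp_preimage hV ?hW//.
by rewrite -[X in measurable X]setTI; exact: mW.
Qed.

Section ergodic_theorem.
Context {R : realType} {d : measure_display} {T : measurableType d}.
Variables (P : probability T R) (tau : T -> T).
Hypothesis tauP : mpres P P tau.

Lemma mpres_iter n : mpres P P (iter n tau).
Proof.
elim: n => [|n IH]; first exact: mpres_id.
exact: mpres_comp IH tauP.
Qed.

(** Birkhoff sums. *)
Definition bsum (f : T -> R) n x := \sum_(i < n) f (iter i tau x).

Lemma itg_bsum f n : itg P f -> itg P (bsum f n).
Proof.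
by move=> fi; apply: itg_sum => i _; exact: (mpres_itg (mpres_iter i) fi).
Qed.

Lemma bsum_tau f n x : bsum f n (tau x) = bsum f n.+1 x - f x.
Proof.
rewrite /bsum big_ord_recl /= addrC addKr; apply: eq_bigr => i _.
by rewrite -iterSr.
Qed.

(** The maximum of 0 and of the Birkhoff sums of lengths 1 to [n]. The recursion peels off the first
    term of the orbit, so that the inequality behind the maximal theorem is a mere unfolding. *)
Fixpoint maxsum (f : T -> R) n x : R :=
  if n is n'.+1 then Num.max 0 (f x + maxsum f n' (tau x)) else 0.

Lemma maxsum_ge0 f n x : 0 <= maxsum f n x.
Proof. by case: n => //= n; rewrite le_max lexx. Qed.

Lemma maxsum_leS f n x : maxsum f n x <= maxsum f n.+1 x.
Proof.
elim: n x => [|n IH] x; first exact: maxsum_ge0.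
change (Num.max 0 (f x + maxsum f n (tau x)) <=
        Num.max 0 (f x + maxsum f n.+1 (tau x))).
by rewrite ge_max le_max lexx /= le_max lerD2l IH orbT.
Qed.

Lemma maxsum_le f m n x : (m <= n)%N -> maxsum f m x <= maxsum f n x.
Proof. by move=> /(homo_leq (@lexx _ _) (@le_trans _ _) (maxsum_leS f ^~ x)). Qed.

Lemma bsum_maxsum f n x : bsum f n x <= maxsum f n x.
Proof.
elim: n x => [|n IH] x; first by rewrite /bsum big_ord0.
rewrite -[leLHS](subrK (f x)) -bsum_tau addrC /=.
by rewrite le_max lerD2l IH orbT.
Qed.

Lemma itg_maxsum f n : itg P f -> itg P (maxsum f n).
Proof.
move=> fi; elim: n => [|n IH]; first exact: itg_cst.
have ig : itg P (fun x => f x + maxsum f n (tau x)).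
  by apply: itgD => //; exact: (mpres_itg tauP IH).
apply: itg_dom (itg_abs ig) _ => [|x].
  by apply: measurable_maxr => //; exact: itg_meas ig.
rewrite ger0_norm ?maxsum_ge0//= ge_max normr_ge0 /=; exact: ler_norm.
Qed.

Lemma measurable_maxsum_gt0 f n : itg P f -> measurable [set x | 0 < maxsum f n x].
Proof.
move=> fi; apply: (measurable_set_lt (f := fun=> 0)) => //.
exact: (itg_meas (itg_maxsum n fi)).
Qed.

Lemma itg_indicM f A : measurable A -> itg P f -> itg P (fun x => f x * \1_A x).
Proof.
move=> mA fi; apply: (@itgMb _ _ _ _ _ _ 1) => //.
by move=> x; rewrite indicE; case: (_ \in _); rewrite ?normr1 ?normr0.
Qed.

(* Garsia's argument: [f >= M_n - M_n \o tau] where [M_n > 0], and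
   [M_n - M_n \o tau] has mean zero and is nonpositive elsewhere. *)
Lemma maximal_ergodic f n : itg P f ->
  0 <= Ex P (fun x => f x * \1_[set x | 0 < maxsum f n x] x).
Proof.
move=> fi; have mi := itg_maxsum n fi.
have mti := mpres_itg tauP mi.
apply: (@le_trans _ _ (Ex P (fun x => maxsum f n x - maxsum f n (tau x)))).
  by rewrite ExB// [X in _ - X](mpres_Ex tauP mi) subrr.
apply: Ex_le; [exact: itgB|exact: itg_indicM (measurable_maxsum_gt0 n fi) fi|].
move=> x; rewrite indicE; case: (boolP (x \in _)); rewrite ?inE ?notin_setE /=.
  rewrite mulr1; case: n {mi mti} => [|n]; first by rewrite /= ltxx.
  move=> Mx; rewrite lerBlDr.
  have -> : maxsum f n.+1 x = f x + maxsum f n (tau x).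
    move: Mx => /=; rewrite lt_max ltxx /= => Mx; exact/max_idPr/ltW.
  by rewrite lerD2l maxsum_leS.
move=> /negP; rewrite -leNgt => Mx; rewrite mulr0 subr_le0.
exact: le_trans Mx (maxsum_ge0 _ _ _).
Qed.

Hypothesis tau_erg : forall A, measurable A -> A = tau @^-1` A ->
  P A = 0%E \/ P A = 1%E.

(** The set where the Birkhoff sums are unbounded above is invariant, hence of probability 0 or 1.
    If it were 1, some maximal sum would be positive almost everywhere, and dominated convergence in
    [maximal_ergodic] would give [Ex P g] nonnegative. *)
Lemma bsum_bounded_ae g : itg P g -> Ex P g < 0 ->
  {ae P, forall x, exists m : nat, forall n, bsum g n x <= m%:R}.
Proof.
move=> gi g0.
pose A := \bigcap_(m in [set: nat]) \bigcup_(n in [set: nat])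
  [set x | m%:R < bsum g n x].
have mA : measurable A.
  apply: bigcap_measurableType => m _; apply: bigcup_measurable => n _.
  apply: (measurable_set_lt (f := fun=> m%:R)) => //.
  exact: (itg_meas (itg_bsum n gi)).
(* Sums along [x] and [tau x] differ by the term [g x]; asking for the bound [m + k] instead of [m]
   absorbs it. *)
have tA : A = tau @^-1` A.
  apply/seteqP; split => x Ax m _.
  - have [k kx] : exists k : nat, g x <= k%:R.
      exists (Num.truncn (`|g x|)).+1; rewrite (le_trans (ler_norm _))// ltW//.
      by rewrite truncnS_gt.
    have [[|n] _ /= nx] := Ax (m + k)%N I.
      by move: nx; rewrite /bsum big_ord0 ltNge ler0n.
    exists n => //=; rewrite bsum_tau ltrBrDr (le_lt_trans _ nx)//.
    by rewrite natrD lerD2l.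
  - have [k kx] : exists k : nat, - g x <= k%:R.
      exists (Num.truncn (`|g x|)).+1; rewrite -normrN (le_trans (ler_norm _))//.
      by rewrite ltW// truncnS_gt.
    have [n _ /= nx] := Ax (m + k)%N I.
    exists n.+1 => //=.
    move: nx; rewrite bsum_tau natrD; lra.
have PA : P A = 0%E.
  have [//|PA1] := tau_erg mA tA; exfalso.
  pose B := \bigcup_n [set x | 0 < maxsum g n x].
  have mB : measurable B.
    by apply: bigcup_measurable => n _; exact: measurable_maxsum_gt0.
  have AB : A `<=` B.
    move=> x /(_ 0%N I)[n _ /= nx]; exists n => //=.
    by rewrite (lt_le_trans nx)// bsum_maxsum.
  have PB : P (~` B) = 0%E.
    apply/eqP; rewrite eq_le measure_ge0 andbT.
    have -> : 0%E = P (~` A) by rewrite probability_setC// PA1 subee.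
    apply: le_measure; rewrite ?inE; try exact: measurableC.
    exact: subsetC.
  have h : (fun n => Ex P (fun x => g x * \1_[set x | 0 < maxsum g n x] x)) @ \oo
      --> Ex P g.
    apply: (@Ex_dct_ae _ _ _ _ _ _ (fun x => `|g x|)).
    - by move=> n; apply: itg_meas; apply: itg_indicM (measurable_maxsum_gt0 n gi) gi.
    - exact: itg_meas gi.
    - exact: itg_abs.
    - move=> n x; rewrite normrM ler_piMr// indicE.
      by case: (_ \in _); rewrite ?normr1 ?normr0.
    - exists (~` B); split => //; first exact: measurableC.
      apply: subsetC => x [n _ /= nx].
      apply: cvg_near_cst; near=> k.
      rewrite indicE mem_set ?mulr1//=.
      rewrite (lt_le_trans nx)//; apply: maxsum_le; near: k.
      exact: nbhs_infty_ge.
  suff : 0 <= Ex P g by rewrite leNgt g0.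
  apply: (ler_cvg_to (cvg_cst (0 : R)) h).
  by apply: nearW => n; exact: maximal_ergodic.
exists A; split => // x /= H m _; apply: contrapT => nA; apply: H; exists m => n.
by rewrite leNgt; apply/negP => nx; apply: nA; exists n.
Unshelve. all: by end_near. Qed.

(** Subtracting slightly more than the mean makes the mean negative, so the sums stay below some
    [m], and [m / n] is eventually at most [eps / 2]. *)
Lemma birkhoff_upper_ae f eps : itg P f -> 0 < eps ->
  {ae P, forall x, \forall n \near \oo, n%:R^-1 * bsum f n x <= Ex P f + eps}.
Proof.
move=> fi e0.
pose g x := f x - (Ex P f + eps / 2).
have gi : itg P g by apply: itgB => //; exact: itg_cst.
have g0 : Ex P g < 0.
  by rewrite ExB//; [rewrite Ex_cst; lra|exact: itg_cst].
apply: filterS (bsum_bounded_ae gi g0) => x [m mx].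
near=> n.
have n0 : (0 < n)%N by near: n; exact: nbhs_infty_gt.
have bE : bsum g n x = bsum f n x - n%:R * (Ex P f + eps / 2).
  by rewrite /bsum /g sumrB sumr_const card_ord mulr_natl.
have := mx n; rewrite bE => h.
rewrite ler_pdivrMl ?ltr0n//.
have : m%:R <= n%:R * (eps / 2).
  rewrite -ler_pdivrMr; last by rewrite divr_gt0.
  near: n; exact: nbhs_infty_ger.
move: h; lra.
Unshelve. all: by end_near. Qed.

Lemma birkhoff_ae f : itg P f ->
  {ae P, forall x, (fun n => n%:R^-1 * bsum f n x) @ \oo --> Ex P f}.
Proof.
move=> fi.
have nfi : itg P (fun x => - f x) by exact: itgN.
(* The tolerances 1 / (k + 1) are countably many, so one null set serves them all. *)
have h1 : {ae P, forall x, forall k : nat, \forall n \near \oo,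
    n%:R^-1 * bsum f n x <= Ex P f + k.+1%:R^-1}.
  apply/ae_foralln => k; exact: birkhoff_upper_ae.
have h2 : {ae P, forall x, forall k : nat, \forall n \near \oo,
    n%:R^-1 * bsum (fun y => - f y) n x <= Ex P (fun y => - f y) + k.+1%:R^-1}.
  apply/ae_foralln => k; exact: birkhoff_upper_ae.
apply: filterS2 h1 h2 => x h1 h2.
have EN : Ex P (fun y => - f y) = - Ex P f.
  by rewrite -mulN1r -ExZ//; apply: eq_Ex => y; rewrite mulN1r.
apply/cvgrPdist_le => /= e e0.
have [k ke] : exists k : nat, k.+1%:R^-1 <= e.
  exists (Num.truncn e^-1); rewrite invf_ple ?posrE//.
  by rewrite ltW// truncnS_gt.
have := h1 k; have := h2 k.
apply: filterS2 => n; rewrite EN.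
have -> : bsum (fun y => - f y) n x = - bsum f n x by rewrite /bsum sumrN.
rewrite mulrN; move: ke; set y := k.+1%:R^-1; set t := n%:R^-1 * _.
move=> ke a b; rewrite ler_norml; apply/andP; split; lra.
Qed.

Lemma mean_ergodic_bounded (f : T -> R) (c : R) : measurable_fun setT f ->
  (forall x, `|f x| <= c) ->
  (fun n => Ex P (fun x => `|n%:R^-1 * bsum f n x - Ex P f|)) @ \oo --> 0.
Proof.
move=> mf fc; have fi := itg_bounded P mf fc.
rewrite -[X in _ --> X](Ex_cst P 0).
have c0 : 0 <= c by exact: le_trans (fc point).
apply: (@Ex_dct_ae _ _ _ _ _ _ (fun=> c + c)).
- move=> n; apply: itg_meas; apply: itg_abs; apply: itgB; last exact: itg_cst.
  by apply: itgZ; exact: itg_bsum.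
- exact: measurable_cst.
- exact: itg_cst.
- move=> n x; rewrite normr_id (le_trans (ler_normB _ _))// lerD//.
    case: n => [|n]; first by rewrite invr0 mul0r normr0.
    rewrite normrM gtr0_norm ?invr_gt0// ler_pdivrMl//.
    rewrite (le_trans (ler_norm_sum _ _ _))//.
    rewrite (le_trans (ler_sum _ (fun i _ => fc _)))//.
    by rewrite sumr_const card_ord mulr_natl.
  rewrite -[leRHS](Ex_cst P); apply: Ex_abs_le => //; exact: itg_cst.
- apply: filterS (birkhoff_ae fi) => x h.
  by rewrite -(normr0 R) -(subrr (Ex P f)); apply: cvg_norm; apply: cvgB => //; exact: cvg_cst.
Qed.

(** Dominated convergence turns the almost sure limit into one in mean only for bounded functions.
    The general case follows by truncation at level [k], since averaging along the orbit does not
    increase the mean of |f - fk|. *)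
Lemma mean_ergodic f : itg P f ->
  (fun n => Ex P (fun x => `|n%:R^-1 * bsum f n x - Ex P f|)) @ \oo --> 0.
Proof.
move=> fi; have mf := itg_meas fi.
pose fk (k : nat) x := Num.max (- k%:R) (Num.min k%:R (f x)).
have mfk k : measurable_fun setT (fk k).
  by apply: measurable_maxr => //; apply: measurable_minr.
have fkk k x : `|fk k x| <= k%:R.
  rewrite ler_norml le_max lexx /= ge_max ge_min lexx /= andbT.
  by rewrite (le_trans _ (ler0n _ k))// oppr_le0.
have fki k : itg P (fk k) := itg_bounded P (mfk k) (@fkk k).
have fkf k x : `|f x - fk k x| <= `|f x|.
  have k0 : 0 <= k%:R :> R by exact: ler0n.
  rewrite /fk; have [h1|h1] := leP k%:R (f x).
    rewrite max_r; last by lra.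
    rewrite ger0_norm; last by rewrite subr_ge0.
    rewrite ger0_norm; lra.
  have [h2|h2] := leP (- k%:R) (f x); first by rewrite subrr normr0.
  rewrite ler0_norm; last by lra.
  rewrite ler0_norm; lra.
have fkc : (fun k => Ex P (fun x => `|f x - fk k x|)) @ \oo --> 0.
  rewrite -[X in _ --> X](Ex_cst P 0).
  apply: (@Ex_dct _ _ _ _ _ _ (fun x => `|f x|)).
  - by move=> n; apply: measurableT_comp => //; apply: measurable_funB.
  - exact: itg_abs.
  - by move=> n x; rewrite normr_id.
  - move=> x; apply: cvg_near_cst; near=> k.
    have : `|f x| <= k%:R by near: k; exact: nbhs_infty_ger.
    rewrite ler_norml => /andP[h1 h2].
    by rewrite /fk min_r// max_r// subrr normr0.
apply/cvgrPdist_le => /= e e0.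
(* Three errors of size [e / 4]: the averages of |f - fk|, the ergodic error of [fk], and the
   difference of the two means. *)
have e40 : 0 < e / 4 by rewrite divr_gt0.
have /cvgrPdist_le/(_ _ e40)[k _ /(_ k (leqnn k))] := fkc.
rewrite sub0r normrN ger0_norm; last by apply: Ex_ge0.
move=> ke.
have /cvgrPdist_le/(_ _ e40) := mean_ergodic_bounded (mfk k) (@fkk k).
apply: filterS => n; rewrite sub0r normrN ger0_norm; last by apply: Ex_ge0.
move=> ne.
rewrite sub0r normrN ger0_norm; last by apply: Ex_ge0.
have dki : itg P (fun x => `|f x - fk k x|) by apply: itg_abs; exact: itgB.
pose D x := n%:R^-1 * bsum (fun x => `|f x - fk k x|) n x.
have Di : itg P D by apply: itgZ; exact: itg_bsum.
have D1 : Ex P D <= e / 4.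
  apply: le_trans ke.
  rewrite ExZ; last exact: itg_bsum.
  rewrite Ex_sum; last by move=> i _; exact: (mpres_itg (mpres_iter i) dki).
  rewrite (eq_bigr (fun=> Ex P (fun x => `|f x - fk k x|))); last first.
    by move=> i _; exact: (mpres_Ex (mpres_iter i) dki).
  rewrite sumr_const card_ord -[Ex _ _ *+ _]mulr_natl mulrA.
  case: (n) => [|m]; last by rewrite mulVf ?mul1r// pnatr_eq0.
  by rewrite mulr0 mul0r Ex_ge0.
have ci c : itg P (fun x => `|n%:R^-1 * bsum (fk k) n x - c|).
  by apply: itg_abs; apply: itgB; [apply: itgZ; exact: itg_bsum|exact: itg_cst].
have efk : `|Ex P (fk k) - Ex P f| <= e / 4.
  apply: le_trans ke; rewrite distrC -ExB//; apply: Ex_abs_le => //.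
  exact: itgB.
apply: (@le_trans _ _ (Ex P (fun x => D x +
   (`|n%:R^-1 * bsum (fk k) n x - Ex P (fk k)| + e / 4)))).
  apply: Ex_le.
  - by apply: itg_abs; apply: itgB; [apply: itgZ; exact: itg_bsum|exact: itg_cst].
  - by apply: itgD => //; apply: itgD => //; exact: itg_cst.
  move=> x.
  have -> : n%:R^-1 * bsum f n x - Ex P f =
    n%:R^-1 * (bsum f n x - bsum (fk k) n x) +
    ((n%:R^-1 * bsum (fk k) n x - Ex P (fk k)) + (Ex P (fk k) - Ex P f)) by ring.
  rewrite (le_trans (ler_normD _ _))// lerD//.
    rewrite normrM ger0_norm ?invr_ge0// ler_wpM2l ?invr_ge0//.
    rewrite /bsum -sumrB; exact: ler_norm_sum.
  by rewrite (le_trans (ler_normD _ _))// lerD.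
rewrite ExD//; last by apply: itgD => //; exact: itg_cst.
rewrite ExD//; last exact: itg_cst.
rewrite Ex_cst; lra.
Unshelve. all: by end_near. Qed.

End ergodic_theorem.

(** * Laws on path space *)

Section path_space.
Context {R : realType} {I : Type}.

(** Its measurable sets are exactly those of [path_measurable], so the ergodicity hypothesis applies
    to them as it stands. *)
Definition pathT := g_sigma_algebraType (@cylinder_sets R I).

Lemma measurable_coord (t : int) (c : I) :
  measurable_fun setT (fun x : pathT => x t c).
Proof.
move=> _ B mB; rewrite setTI; apply: sub_sigma_algebra.
by exists t, c, B.
Qed.

Lemma measurable_to_path {d} {T : measurableType d} (F : T -> pathT) :
  (forall t c, measurable_fun setT (fun w => F w t c)) -> measurable_fun setT F.
Proof.
move=> mF; apply: (@measurability _ _ _ _ setT F (@cylinder_sets R I)) => //.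
move=> _ [A [t [c [B [mB ->]]]] <-].
exact: mF.
Qed.

Lemma measurable_path_shift : measurable_fun setT (@path_shift R I : pathT -> pathT).
Proof. by apply: measurable_to_path => t c; exact: measurable_coord. Qed.

Lemma iter_path_shift n (x : pathT) t c : iter n (@path_shift R I) x t c = x (t + n%:Z) c.
Proof.
elim: n t => [|n IH] t /=; first by rewrite addr0.
by rewrite /path_shift IH -addrA -[1 + n%:Z]/(1%:Z + n%:Z) -PoszD add1n.
Qed.

(** Times and labels may repeat, so that the intersection of two rectangles is just the
    concatenation of their constraints. *)
Definition rectangles : set (set pathT) :=
  [set A | exists (n : nat) (ts : 'I_n -> int) (cs : 'I_n -> I) (Bs : 'I_n -> set R),
    (forall k, measurable (Bs k)) /\ A = [set x | forall k, Bs k (x (ts k) (cs k))]].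

Definition ord_case U n1 n2 (f : 'I_n1 -> U) (g : 'I_n2 -> U) (k : 'I_(n1 + n2)) :=
  match fintype.split k with inl i => f i | inr j => g j end.

Lemma rectangles_setI : setI_closed rectangles.
Proof.
move=> _ _ [n1 [t1 [c1 [B1 [m1 ->]]]]] [n2 [t2 [c2 [B2 [m2 ->]]]]].
pose sp U := @ord_case U n1 n2.
exists (n1 + n2)%N, (sp _ t1 t2), (sp _ c1 c2), (sp _ B1 B2); split.
  by move=> k; rewrite /sp /ord_case; case: fintype.split.
apply/seteqP; split => x /=.
  by move=> [h1 h2] k; rewrite /sp /ord_case; case: fintype.split.
move=> h; split=> k.
  have := h (lshift n2 k); rewrite /sp /ord_case.
  by have -> : fintype.split (lshift n2 k) = inl k by rewrite -[lshift _ _]/(unsplit (inl k)) unsplitK.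
have := h (rshift n1 k); rewrite /sp /ord_case.
by have -> : fintype.split (rshift n1 k) = inr k by rewrite -[rshift _ _]/(unsplit (inr k)) unsplitK.
Qed.

Lemma rectangles_generate : @measurable _ pathT = <<s rectangles >>.
Proof.
apply/seteqP; split; apply: smallest_sub.
- exact: smallest_sigma_algebra.
- move=> _ [t [c [B [mB ->]]]]; apply: sub_sigma_algebra.
  exists 1%N, (fun=> t), (fun=> c), (fun=> B); split => //.
  by apply/seteqP; split => x /=; [move=> ? _|move=> h; exact: (h ord0)].
- exact: sigma_algebra_measurable.
- move=> _ [n [t [c [B [mB ->]]]]].
  have -> : [set x : pathT | forall k, B k (x (t k) (c k))] =
      \bigcap_(k in [set: 'I_n]) ((fun x : pathT => x (t k) (c k)) @^-1` B k).
    by apply/seteqP; split => x /= h k => [_|]; exact: h.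
  apply: fin_bigcap_measurable => // k _.
  by have := measurable_coord (t k) (c k) measurableT (mB k); rewrite setTI.
Qed.

Lemma measure_path_unique (m1 m2 : probability pathT R) :
  (forall A, rectangles A -> m1 A = m2 A) ->
  forall A, measurable A -> m1 A = m2 A.
Proof.
move=> m12 A; apply: (measure_unique rectangles (fun=> setT)) => //.
- exact: rectangles_generate.
- exact: rectangles_setI.
(* The whole space is the rectangle without constraints; since [I] may be empty, its labels are
   indexed by ['I_0]. *)
- move=> _; exists 0%N, (fun=> 0), (fun k : 'I_0 => False_rect I (notF (ltn_ord k))), (fun=> setT).
  by split => //; apply/seteqP; split => x //= _ [].
- by apply: bigcup_const; exists 0%N.
- by move=> _; rewrite /= probability_setT ltry.
Qed.

End path_space.

Section path_law.
Context {R : realType} {I : Type} {d : measure_display} {T : measurableType d}.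
Variables (P : probability T R) (V : int -> I -> T -> R).
Hypothesis mV : forall t c, measurable_fun setT (V t c).

Definition path_of (w : T) : @pathT R I := fun t c => V t c w.

Lemma measurable_path_of : measurable_fun setT path_of.
Proof. exact: measurable_to_path. Qed.

Lemma path_law_exists : exists Q : probability (@pathT R I) R, mpres P Q path_of.
Proof.
pose X : {mfun T >-> @pathT R I} :=
  HB.pack path_of (isMeasurableFun.Build _ _ _ _ path_of measurable_path_of).
by exists (distribution P X); split; first exact: measurable_path_of.
Qed.

Variable Q : probability (@pathT R I) R.
Hypothesis PQ : mpres P Q path_of.

(** Stationarity with step 1 says that the law and its image by the shift agree on rectangles, which
    determine a probability. *)
Lemma stationary_shift : strictly_stationary P V -> mpres Q Q (@path_shift R I).
Proof.
move=> sV; split; first exact: measurable_path_shift.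
pose X : {mfun @pathT R I >-> @pathT R I} := HB.pack (@path_shift R I : pathT -> pathT)
  (isMeasurableFun.Build _ _ _ _ (@path_shift R I : pathT -> pathT) (@measurable_path_shift R I)).
move=> A mA; rewrite -[LHS]/(distribution Q X A).
apply: measure_path_unique mA => _ [n [t [c [B [mB ->]]]]].
have mS (s : int) : measurable [set x : @pathT R I | forall k, B k (x (t k + s) (c k))].
  rewrite -[measurable _]/(@measurable _ (@pathT R I) _) rectangles_generate.
  by apply: sub_sigma_algebra; exists n, (fun k => t k + s), c, B.
have mS0 : measurable [set x : @pathT R I | forall k, B k (x (t k) (c k))].
  rewrite -[measurable _]/(@measurable _ (@pathT R I) _) rectangles_generate.
  by apply: sub_sigma_algebra; exists n, t, c, B.
transitivity (Q [set x : @pathT R I | forall k, B k (x (t k + 1) (c k))]); first by [].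
rewrite -!(proj2 PQ)//; apply/esym.
exact: (sV n t c B 1 mB).
Qed.

Lemma ergodic_shift : ergodic P V -> forall A : set (@pathT R I), measurable A ->
  A = @path_shift R I @^-1` A -> Q A = 0%E \/ Q A = 1%E.
Proof. by move=> eV A mA As; rewrite -(proj2 PQ)//; exact: eV. Qed.

End path_law.

(** * Orthogonality to functions measurable in the past *)

Section conditional_orthogonality.
Import HBNNSimple.
Context {R : realType} {d : measure_display} {T : measurableType d}.
Variables (P : probability T R) (G : set (set T)).
Hypothesis Gm : G `<=` measurable.

(** Measurability for the smaller sigma-algebra is expressed by retyping the source as
    [g_sigma_algebraType G]. *)
Lemma measurable_sub_sigma {d'} {T' : measurableType d'} (h : T -> T') :
  measurable_fun setT (h : g_sigma_algebraType G -> T') -> measurable_fun setT h.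
Proof.
move=> mh _ B mB; have := mh measurableT B mB.
by apply: smallest_sub => //; exact: sigma_algebra_measurable.
Qed.

(** [cond_exp_const] tests [f] against indicators only. Simple functions follow by linearity, and
    increasing simple approximations of [h] are dominated by |f h|. *)
Lemma cond_exp0_orth_ge0 f h : cond_exp_const P <<s G >> f 0 ->
  measurable_fun setT (h : g_sigma_algebraType G -> R) ->
  (forall x, 0 <= h x) -> itg P (fun x => f x * h x) ->
  Ex P (fun x => f x * h x) = 0.
Proof.
move=> [/Lfun1_integrable fi f0] mh h0 fhi.
have meh : measurable_fun setT (EFin \o h : g_sigma_algebraType G -> \bar R).
  exact/measurable_EFinP.
pose a := nnsfun_approx (@measurableT _ (g_sigma_algebraType G)) meh.
have ac x : (fun n => a n x) @ \oo --> h x.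
  have := @cvg_nnsfun_approx _ _ _ _ (@measurableT _ (g_sigma_algebraType G)) _ meh
    (fun x _ => h0 x) x I.
  by move=> /fine_cvgP[_].
have ah n x : a n x <= h x.
  have ndx : nondecreasing_seq (fun n => a n x).
    move=> m k mk; have /lefP := @nd_nnsfun_approx _ _ _ _
      (@measurableT _ (g_sigma_algebraType G)) _ meh m k mk.
    exact.
  rewrite -(cvg_lim _ (ac x))//; apply: nondecreasing_cvgn_le => //.
  by apply/cvg_ex; exists (h x).
have man n : measurable_fun setT (a n : T -> R).
  by apply: measurable_sub_sigma; exact: measurable_funPT.
have mf := itg_meas fi.
have fan n : Ex P (fun x => f x * a n x) = 0.
  transitivity (Ex P (fun x => \sum_(y <- finmap.enum_fset (fset_set (range (a n))))
     y * (f x * \1_(a n @^-1` [set y]) x))).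
    apply: eq_Ex => x; rewrite [in LHS](fimfunE (a n) x) fsbig_finite//= mulr_sumr.
    by apply: eq_bigr => y _; rewrite mulrCA.
  have mA y : @measurable _ T (a n @^-1` [set y]).
    by have := man n measurableT [set y] (measurable_set1 y); rewrite setTI.
  have H y := itgZ y (itg_indicM (mA y) fi).
  rewrite Ex_sum => [|y _]; last exact: H.
  rewrite big1// => y _; rewrite (ExZ y (itg_indicM (mA y) fi)).
  have gA : <<s G >> (a n @^-1` [set y]).
    have := @measurable_funPT _ _ (g_sigma_algebraType G) R (a n) measurableT
      [set y] (measurable_set1 y).
    by rewrite setTI.
  have := f0 _ gA; rewrite mul0e expectationE; last exact: (itg_indicM (mA y) fi).
  by move=> [->]; rewrite mulr0.
have h1 : (fun n => Ex P (fun x => f x * a n x)) @ \oo --> Ex P (fun x => f x * h x).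
  apply: (@Ex_dct _ _ _ _ _ _ (fun x => `|f x * h x|)).
  - by move=> n; apply: measurable_funM.
  - exact: itg_abs.
  - move=> n x; rewrite !normrM ler_wpM2l// !ger0_norm//.
  - by move=> x; apply: cvgM; [exact: cvg_cst|exact: ac].
rewrite -(cvg_lim _ h1)//; under eq_fun do rewrite fan.
by rewrite lim_cst.
Qed.

Lemma cond_exp0_orth f h : cond_exp_const P <<s G >> f 0 ->
  measurable_fun setT (h : g_sigma_algebraType G -> R) ->
  itg P (fun x => f x * h x) -> Ex P (fun x => f x * h x) = 0.
Proof.
move=> cf mh fhi.
have mf : measurable_fun setT f.
  by case: cf => /Lfun1_integrable fi _; exact: itg_meas fi.
pose hp x := Num.max (h x) 0.
pose hn x := Num.max (- h x) 0.
have mhp : measurable_fun setT (hp : g_sigma_algebraType G -> R).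
  exact: measurable_maxr.
have mhn : measurable_fun setT (hn : g_sigma_algebraType G -> R).
  by apply: measurable_maxr => //; exact: measurableT_comp.
have hp0 x : 0 <= hp x by rewrite le_max lexx orbT.
have hn0 x : 0 <= hn x by rewrite le_max lexx orbT.
have hE x : h x = hp x - hn x.
  rewrite /hp /hn; have [h0|h0] := leP 0 (h x).
    by rewrite max_r ?subr0// oppr_le0.
  by rewrite max_l ?sub0r ?opprK// oppr_ge0 ltW.
have hp_le x : hp x <= `|h x|.
  by rewrite ge_max normr_ge0 andbT ler_norm.
have hn_le x : hn x <= `|h x|.
  by rewrite ge_max normr_ge0 andbT -normrN ler_norm.
have fhpi : itg P (fun x => f x * hp x).
  apply: itg_dom (itg_abs fhi) _.
    by apply: measurable_funM => //; exact: measurable_sub_sigma.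
  by move=> x; rewrite !normrM ler_wpM2l// ger0_norm.
have fhni : itg P (fun x => f x * hn x).
  apply: itg_dom (itg_abs fhi) _.
    by apply: measurable_funM => //; exact: measurable_sub_sigma.
  by move=> x; rewrite !normrM ler_wpM2l// ger0_norm.
transitivity (Ex P (fun x => f x * hp x - f x * hn x)).
  by apply: eq_Ex => x; rewrite hE mulrBr.
by rewrite ExB// !cond_exp0_orth_ge0// subrr.
Qed.

End conditional_orthogonality.

(** * Martingale central limit theorem *)

Section trigonometric_bounds.
Context {R : realType}.
Implicit Types x y z : R.

(** Integration of an inequality; it yields the Taylor bounds of the sine from bounds of the
    cosine. *)
Lemma ge0_of_derive_ge0 (f df : R -> R) : (forall x, is_derive x (1:R) f (df x)) ->
  (forall x, 0 <= x -> 0 <= df x) -> f 0 = 0 -> forall x, 0 <= x -> 0 <= f x.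
Proof.
move=> fd df0 f0 x x0.
have [|c] := @MVT_segment R f df 0 x x0 (fun y _ => fd y).
  apply: continuous_subspaceT => y.
  by apply: differentiable_continuous; apply/derivable1_diffP; exact: ex_derive.
rewrite in_itv /= => /andP[c0 _]; rewrite f0 !subr0 => ->.
by rewrite mulr_ge0// df0.
Qed.

Lemma sin_le_id x : 0 <= x -> sin x <= x.
Proof.
move=> x0; rewrite -subr_ge0.
apply: (@ge0_of_derive_ge0 (fun x => x - sin x) (fun x => 1 - cos x)) x0 => //.
by rewrite sin0 subr0.
Qed.

Lemma abs_sin_le x : `|sin x| <= `|x|.
Proof.
wlog x0 : x / 0 <= x.
  move=> H; have [x0|x0] := leP 0 x; first exact: H.
  by rewrite -(normrN x) -(normrN (sin x)) -sinN; apply: H; rewrite oppr_ge0 ltW.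
rewrite (ger0_norm x0) ler_norml sin_le_id// andbT.
have [x1|x1] := leP 1 x.
  by apply: le_trans (sin_geN1 x); rewrite lerN2.
have [<-|xn0] := eqVneq 0 x; first by rewrite sin0 oppr0.
rewrite (@le_trans _ _ 0)//; first by rewrite oppr_le0.
apply/ltW/sin2_gt0; rewrite lt_neqAle xn0 x0 /=.
by rewrite (lt_trans x1)// ltr1n.
Qed.

Lemma cos_half x : cos x = 1 - 2 * sin (x / 2) ^+ 2.
Proof.
have -> : cos x = cos ((x / 2) *+ 2) by congr cos; rewrite mulr2n; field.
rewrite cos_mulr2n cos2sin2 mulr2n; ring.
Qed.

Lemma cos_ge_taylor x : 1 - x ^+ 2 / 2 <= cos x.
Proof.
rewrite cos_half.
have : sin (x / 2) ^+ 2 <= (x / 2) ^+ 2.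
  by rewrite -real_normK ?num_real// -[leRHS]real_normK ?num_real// lerXn2r ?nnegrE// abs_sin_le.
rewrite !expr2; lra.
Qed.

Lemma sin_ge_taylor x : 0 <= x -> x - x ^+ 3 / 6 <= sin x.
Proof.
move=> x0; rewrite -subr_ge0.
apply: (@ge0_of_derive_ge0 (fun x => sin x - (x - x ^+ 3 / 6))
  (fun x => cos x - (1 - x ^+ 2 / 2))) x0 => //.
- move=> y; apply: is_derive_eq.
  rewrite /GRing.scale /= !expr2 !mulr2n; by field.
- by move=> y _; rewrite subr_ge0 cos_ge_taylor.
- by rewrite sin0 expr0n /=; lra.
Qed.

Lemma abs_sin_sub_id x : `|sin x - x| <= `|x| ^+ 3 / 6.
Proof.
wlog x0 : x / 0 <= x.
  move=> H; have [x0|x0] := leP 0 x; first exact: H.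
  rewrite -(normrN x) -(normrN (sin x - x)) opprD -sinN; apply: H; by rewrite oppr_ge0 ltW.
rewrite (ger0_norm x0) ler_norml; have := sin_le_id x0; have := sin_ge_taylor x0.
have : 0 <= x ^+ 3 / 6 by rewrite divr_ge0// exprn_ge0.
by move=> a b c; apply/andP; split; lra.
Qed.

(** With y = x / 2 and s = sin y the left side is 2 (y - s) (y + s), where y - s is at most y^3 / 6
    and y + s at most 2 y = x. *)
Lemma cos_le_taylor4 x : cos x - 1 + x ^+ 2 / 2 <= `|x| ^+ 4 / 24.
Proof.
rewrite -(cos_norm x) -(real_normK (num_real x)); move: `|x| (normr_ge0 x) => {}x x0.
have y0 : 0 <= x / 2 by rewrite divr_ge0.
rewrite cos_half; set s := sin (x / 2).
have h1 := sin_le_id y0; have h2 := sin_ge_taylor y0.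
have h3 : - (x / 2) <= s.
  by have := abs_sin_le (x / 2); rewrite (ger0_norm y0) ler_norml => /andP[].
rewrite -/s in h1 h2.
have -> : 1 - 2 * s ^+ 2 - 1 + x ^+ 2 / 2 = 2 * ((x / 2 - s) * (x / 2 + s)) by field.
have -> : x ^+ 4 / 24 = 2 * ((x / 2) ^+ 3 / 6 * x) by field.
rewrite ler_wpM2l// ler_pM//; lra.
Qed.

(** The minimum makes the remainder integrable with second moments only, and still o(y^2) near 0:
    this is Lindeberg's bound. *)
Lemma cos_taylor2 x y :
  `|cos (x + y) - cos x + y * sin x + y ^+ 2 / 2 * cos x| <=
    3 * (y ^+ 2 * Num.min 1 `|y|).
Proof.
have -> : cos (x + y) - cos x + y * sin x + y ^+ 2 / 2 * cos x =
  cos x * (cos y - 1 + y ^+ 2 / 2) - sin x * (sin y - y) by rewrite cosD; ring.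
apply: (@le_trans _ _ (`|cos y - 1 + y ^+ 2 / 2| + `|sin y - y|)).
  rewrite (le_trans (ler_normB _ _))// !normrM lerD// ler_piMl//.
    exact: cos_max.
  exact: sin_max.
have c0 : 0 <= cos y - 1 + y ^+ 2 / 2.
  by have := cos_ge_taylor y; rewrite -subr_ge0; lra.
rewrite (ger0_norm c0).
rewrite -(real_normK (num_real y)).
have a0 := normr_ge0 y.
have [y1|y1] := leP 1 `|y|.
  rewrite mulr1.
  have h1 : `|sin y - y| <= 2 * `|y|.
    by rewrite (le_trans (ler_normB _ _))// mulr_natl mulr2n lerD2r abs_sin_le.
  have h2 := cos_le1 y.
  move: h1 h2; rewrite !expr2 => h1 h2.
  have h3 : `|y| <= `|y| * `|y| by rewrite ler_peMl.
  lra.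
have h1 := abs_sin_sub_id y.
have := cos_le_taylor4 y; rewrite -(real_normK (num_real y)).
set a := `|y| in a0 y1 h1 *.
have h2 : a ^+ 4 <= a ^+ 3 by rewrite exprS ler_piMl ?exprn_ge0// ltW.
have h3 : 0 <= a ^+ 3 by rewrite exprn_ge0.
rewrite -exprSr => h4.
lra.
Qed.

Lemma abs_cos_sub x y : `|cos (x + y) - cos x| <= `|y|.
Proof.
have [c _ h] : exists2 c, (c \in `[(Num.min x (x + y)), (Num.max x (x + y))]) &
    cos (Num.max x (x + y)) - cos (Num.min x (x + y)) =
    - sin c * (Num.max x (x + y) - Num.min x (x + y)).
  apply: MVT_segment => //.
    by rewrite ge_min le_max lexx.
  by apply: continuous_subspaceT => z; exact: continuous_cos.
have {h} : `|cos (Num.max x (x + y)) - cos (Num.min x (x + y))| <=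
    `|Num.max x (x + y) - Num.min x (x + y)|.
  by rewrite h normrM normrN ler_piMl// sin_max.
have [xy|xy] := leP x (x + y).
  by rewrite [in `|_ + _ - _|]addrAC subrr add0r.
by rewrite distrC opprD addNKr normrN.
Qed.

Lemma expRN_quadratic x : 0 <= x -> `|expR (- x) - (1 - x)| <= x ^+ 2.
Proof.
move=> x0; rewrite ger0_norm; last by rewrite subr_ge0 expR_ge1Dx.
have h : expR (- x) <= (1 + x)^-1.
  rewrite expRN lef_pV2 ?posrE ?expR_gt0 ?expR_ge1Dx//; lra.
have : (1 + x)^-1 <= 1 - x + x ^+ 2.
  rewrite -[leLHS]mul1r ler_pdivrMr; last by lra.
  have -> : (1 - x + x ^+ 2) * (1 + x) = 1 + x ^+ 3 by ring.
  by rewrite lerDl exprn_ge0.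
move: h; lra.
Qed.

Lemma expRN_lipschitz x y : 0 <= x -> x <= y -> `|expR (- x) - expR (- y)| <= y - x.
Proof.
move=> x0 xy; rewrite ger0_norm; last by rewrite subr_ge0 ler_expR lerN2.
have -> : - y = - x + - (y - x) by ring.
rewrite expRD -{1}[expR (- x)]mulr1 -mulrBr.
apply: (@le_trans _ _ (1 - expR (- (y - x)))).
  rewrite ler_piMl ?expR_le1 ?oppr_le0// subr_ge0 expR_le1; lra.
have := expR_ge1Dx (- (y - x)); lra.
Qed.

End trigonometric_bounds.

(** * Closure properties of square-integrable variables *)

Section square_integrable.
Context {R : realType} {d : measure_display} {T : measurableType d}.
Variable P : probability T R.
Implicit Types f g : T -> R.

Definition L2 f := measurable_fun setT f /\ itg P (fun x => f x ^+ 2).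

Lemma eq_L2 f g : f =1 g -> L2 f -> L2 g.
Proof. by move=> /funext ->. Qed.

Lemma L2M f g : L2 f -> L2 g -> itg P (fun x => f x * g x).
Proof.
move=> [mf fi] [mg gi]; apply: itg_dom (itgD fi gi) _.
  exact: measurable_funM.
move=> x; rewrite normrM -(real_normK (num_real (f x))) -(real_normK (num_real (g x))).
have := sqr_ge0 (`|f x| - `|g x|).
have := sqr_ge0 (`|f x| + `|g x|).
rewrite !expr2; nra.
Qed.

Lemma L2_cst c : L2 (fun=> c).
Proof. by split; [exact: measurable_cst|exact: itg_cst]. Qed.

Lemma L2_itg f : L2 f -> itg P f.
Proof.
move=> Lf; apply: eq_itg (L2M Lf (L2_cst 1)) => x; exact: mulr1.
Qed.

Lemma L2Z c f : L2 f -> L2 (fun x => c * f x).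
Proof.
move=> [mf fi]; split; first exact: measurable_funM.
by apply: eq_itg (itgZ (c ^+ 2) fi) => x; rewrite exprMn.
Qed.

Lemma L2D f g : L2 f -> L2 g -> L2 (fun x => f x + g x).
Proof.
move=> Lf Lg; have [mf fi] := Lf; have [mg gi] := Lg; split.
  exact: measurable_funD.
apply: eq_itg (itgD (itgD fi (itgZ 2 (L2M Lf Lg))) gi) => x.
by rewrite sqrrD mulr2n; ring.
Qed.

Lemma L2B f g : L2 f -> L2 g -> L2 (fun x => f x - g x).
Proof.
move=> Lf Lg; apply: eq_L2 (L2D Lf (L2Z (-1) Lg)) => x.
by rewrite mulN1r.
Qed.

Lemma L2_sum I (s : seq I) (Q : pred I) (h : I -> T -> R) :
  (forall i, Q i -> L2 (h i)) -> L2 (fun x => \sum_(i <- s | Q i) h i x).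
Proof.
move=> hi; elim: s => [|i s IH].
  by apply: eq_L2 (L2_cst 0) => x; rewrite big_nil.
apply: (@eq_L2 (fun x => (if Q i then h i x else 0) + \sum_(j <- s | Q j) h j x)) => [x|].
  by rewrite big_cons; case: ifP; rewrite ?add0r.
by apply: L2D => //; case: (boolP (Q i)) => Qi; [exact: hi|exact: L2_cst].
Qed.

Lemma L2_bounded f c : measurable_fun setT f -> (forall x, `|f x| <= c) -> L2 f.
Proof.
move=> mf fc; split => //; apply: (@itg_bounded _ _ _ _ _ (c ^+ 2)).
  exact: measurable_funX.
by move=> x; rewrite normrX lerXn2r ?nnegrE// (le_trans _ (fc x)).
Qed.

End square_integrable.

Lemma cvg_invr_sqrt {R : realType} : (fun n : nat => (Num.sqrt n%:R)^-1 : R) @ \oo --> (0:R).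
Proof.
apply/cvgrPdist_le => /= e e0; near=> n.
have n0 : (0 < n)%N by near: n; exact: nbhs_infty_gt.
rewrite sub0r normrN ger0_norm ?invr_ge0 ?sqrtr_ge0//.
rewrite invf_ple ?posrE ?sqrtr_gt0 ?ltr0n//.
rewrite -(ger0_norm (ltW e0)) -sqrtr_sqr -sqrtrV ?sqr_ge0// ler_sqrt ?ltr0n//.
near: n; exact: nbhs_infty_ger.
Unshelve. all: by end_near. Qed.

(** * Sequences tending to zero *)

Section null_sequences.
Context {R : realType}.
Implicit Types u v : nat -> R.

Lemma cvg0D u v : u @ \oo --> (0 : R) -> v @ \oo --> (0 : R) ->
  (fun n => u n + v n) @ \oo --> (0 : R).
Proof. by move=> u0 v0; rewrite -[X in _ --> X](addr0 (0 : R)); apply: cvgD. Qed.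

Lemma cvg0M u v : u @ \oo --> (0 : R) -> v @ \oo --> (0 : R) ->
  (fun n => u n * v n) @ \oo --> (0 : R).
Proof. by move=> u0 v0; rewrite -[X in _ --> X](mulr0 (0 : R)); apply: cvgM. Qed.

Lemma cvg0Mr (a : R) u : u @ \oo --> (0 : R) -> (fun n => u n * a) @ \oo --> (0 : R).
Proof.
by move=> u0; rewrite -[X in _ --> X](mul0r a); apply: cvgM => //; exact: cvg_cst.
Qed.

Lemma cvg0Ml (a : R) u : u @ \oo --> (0 : R) -> (fun n => a * u n) @ \oo --> (0 : R).
Proof.
by move=> u0; rewrite -[X in _ --> X](mulr0 a); apply: cvgM => //; exact: cvg_cst.
Qed.

Lemma cvg0_norm u : u @ \oo --> (0 : R) -> (fun n => `|u n|) @ \oo --> (0 : R).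
Proof. by move=> u0; rewrite -(normr0 R); apply: cvg_norm. Qed.

Lemma cvg0_sqr u : u @ \oo --> (0 : R) -> (fun n => u n ^+ 2) @ \oo --> (0 : R).
Proof.
move=> u0; rewrite (_ : (fun n => u n ^+ 2) = (fun n => u n * u n)).
  exact: cvg0M.
by apply/funext => n; rewrite expr2.
Qed.

Lemma cvg0_near u e : u @ \oo --> (0 : R) -> 0 < e -> \forall n \near \oo, `|u n| <= e.
Proof.
move=> u0 e0; move/cvgrPdist_le : u0 => /(_ e e0).
by apply: filterS => n; rewrite sub0r normrN.
Qed.

End null_sequences.

(** * Characteristic function of a normalized sum, block by block *)

Section martingale_clt.
Context {R : realType} {d : measure_display} {T : measurableType d}.
Variables (P : probability T R) (xi : nat -> T -> R) (s2 : R) (eta : nat -> R).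
Hypothesis xi2 : forall i, L2 P (xi i).

Definition psum n x := \sum_(i < n) xi i x.

Hypothesis stat : forall t m (g : R -> R), measurable_fun setT g ->
  itg P (fun x => g (psum m x)) ->
  Ex P (fun x => g (psum (t + m) x - psum t x)) = Ex P (fun x => g (psum m x)).
Hypothesis s2_ge0 : 0 <= s2.
Hypothesis eta0 : eta @ \oo --> 0.
Hypothesis erg : forall t m, (0 < m)%N ->
  Ex P (fun x => `|m%:R^-1 * \sum_(j < m) xi (t + j)%N x ^+ 2 - s2|) <= eta m.
(** The martingale property is recorded only on the test functions that the block argument meets:
    cosines of a past sum, possibly times an earlier increment. The free phase includes the
    sines. *)
Hypothesis orth1 : forall r t a phi, (r <= t)%N ->
  Ex P (fun x => xi t x * cos (a * psum r x + phi)) = 0.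
Hypothesis orth2 : forall r s t a phi, (r <= s < t)%N ->
  Ex P (fun x => xi t x * (xi s x * cos (a * psum r x + phi))) = 0.

Let mxi i : measurable_fun setT (xi i).
Proof. by case: (xi2 i). Qed.

Let psum2 n : L2 P (psum n).
Proof. by apply: L2_sum => i _; exact: xi2. Qed.

Let mpsum n : measurable_fun setT (psum n).
Proof. by case: (psum2 n). Qed.

Let D t m x := \sum_(j < m) xi (t + j)%N x.

Let DE t m x : psum (t + m) x = psum t x + D t m x.
Proof. by rewrite /psum big_split_ord. Qed.

Let D2 t m : L2 P (D t m).
Proof. by apply: L2_sum => i _; exact: xi2. Qed.

Section fixed_phase.
Variables (c phi : R).
Let X t x := c * psum t x + phi.

Let mX t : measurable_fun setT (X t).
Proof. by apply: measurable_funD => //; apply: measurable_funM. Qed.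

Let mcosX t : measurable_fun setT (fun x => cos (X t x)).
Proof.
by apply: measurableT_comp => //; apply: continuous_measurable_fun; exact: continuous_cos.
Qed.

Let msinX t : measurable_fun setT (fun x => sin (X t x)).
Proof.
by apply: measurableT_comp => //; apply: continuous_measurable_fun; exact: continuous_sin.
Qed.

Let f t := Ex P (fun x => cos (X t x)).

Let icos t : itg P (fun x => cos (X t x)).
Proof. by apply: (itg_bounded P (mcosX t)) => x; exact: cos_max. Qed.

Let iMcos g t : itg P g -> itg P (fun x => g x * cos (X t x)).
Proof. by move=> gi; apply: (itgMb gi (mcosX t)) => x; exact: cos_max. Qed.

Let iMsin g t : itg P g -> itg P (fun x => g x * sin (X t x)).
Proof. by move=> gi; apply: (itgMb gi (msinX t)) => x; exact: sin_max. Qed.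

Let Dsin0 t m : Ex P (fun x => D t m x * sin (X t x)) = 0.
Proof.
transitivity (Ex P (fun x => \sum_(j < m) xi (t + j)%N x * cos (c * psum t x + (phi - pi / 2)))).
  apply: eq_Ex => x; rewrite /D mulr_suml; apply: eq_bigr => j _.
  by rewrite addrA cosBpihalf.
rewrite Ex_sum => [|j _]; first by rewrite big1// => j _; rewrite orth1// leq_addr.
have := iMsin t (L2_itg (xi2 (t + j)%N)); apply: eq_itg => x.
by rewrite addrA cosBpihalf.
Qed.

(** The cross terms of the squared block sum vanish by [orth2]; what is left is the sum of squares,
    to which [erg] applies. *)
Let D2cos t m : Ex P (fun x => D t m x ^+ 2 * cos (X t x)) =
  Ex P (fun x => (\sum_(j < m) xi (t + j)%N x ^+ 2) * cos (X t x)).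
Proof.
elim: m => [|m IH].
  by apply: eq_Ex => x; rewrite /D !big_ord0 expr0n.
have iS : itg P (fun x => (\sum_(j < m) xi (t + j)%N x ^+ 2) * cos (X t x)).
  by apply/iMcos/itg_sum => j _; case: (xi2 (t + j)%N).
have ix : itg P (fun x => xi (t + m)%N x ^+ 2 * cos (X t x)).
  by apply: iMcos; case: (xi2 (t + m)%N).
have iD : itg P (fun x => D t m x ^+ 2 * cos (X t x)).
  by apply: iMcos; case: (D2 t m).
have ixx j : itg P (fun x => xi (t + m)%N x * (xi (t + j)%N x * cos (X t x))).
  by apply: eq_itg (iMcos t (L2M (xi2 (t + m)%N) (xi2 (t + j)%N))) => x; rewrite mulrA.
transitivity (Ex P (fun x => (D t m x ^+ 2 * cos (X t x) + xi (t + m)%N x ^+ 2 * cos (X t x))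
   + 2 * \sum_(j < m) (xi (t + m)%N x * (xi (t + j)%N x * cos (X t x))))).
  apply: eq_Ex => x; rewrite -mulr_sumr -mulr_suml -/(D t m x).
  by rewrite /D big_ord_recr /= -/(D t m x); ring.
rewrite ExD; [|exact: itgD|by apply: itgZ; exact: itg_sum].
rewrite ExD// ExZ; last exact: itg_sum.
rewrite Ex_sum// big1 => [|j _]; last first.
  by rewrite orth2// leq_addr ltn_add2l ltn_ord.
rewrite mulr0 addr0 IH -ExD//; apply: eq_Ex => x.
by rewrite big_ord_recr /= mulrDl.
Qed.

(** Lindeberg term of one block; for fixed [m] it vanishes with [c]. *)
Let rho m := Ex P (fun x => psum m x ^+ 2 * Num.min 1 `|c * psum m x|).

Let mg : measurable_fun setT (fun y : R => y ^+ 2 * Num.min 1 `|c * y|).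
Proof.
apply: measurable_funM; first exact: measurable_funX.
by apply: measurable_minr => //; apply: measurableT_comp.
Qed.

Let itg_trunc h : L2 P h -> itg P (fun x => h x ^+ 2 * Num.min 1 `|c * h x|).
Proof.
move=> [mh ih]; apply: itg_dom ih _; first exact: (measurableT_comp mg mh).
move=> x; rewrite normrM ger0_norm ?sqr_ge0// ler_piMr ?sqr_ge0//.
by rewrite ger0_norm ?ge_min ?lexx// le_min ler01 normr_ge0.
Qed.

(* Over a block of length [m] the conditional variance is replaced by [m s2] through the ergodic
   hypothesis [erg] and stationarity of the block sums, so only orthogonality of the increments to
   functions of the past is used, never their conditional variance. *)
Lemma charfun_block t m : (0 < m)%N ->
  `|f (t + m) - expR (- (c ^+ 2 * m%:R * s2 / 2)) * f t| <=
    (c ^+ 2 * m%:R * s2 / 2) ^+ 2 + c ^+ 2 * (m%:R * eta m + 3 * rho m).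
Proof.
move=> m0; set A := c ^+ 2 * m%:R * s2 / 2.
have mR : 0 < m%:R :> R by rewrite ltr0n.
have A0 : 0 <= A by rewrite divr_ge0// mulr_ge0// mulr_ge0// sqr_ge0.
have f1 : `|f t| <= 1.
  rewrite -[leRHS](Ex_cst P 1); apply: Ex_abs_le => //; first exact: itg_cst.
  by move=> x; exact: cos_max.
pose rem x := cos (X t x + c * D t m x) - cos (X t x) + (c * D t m x) * sin (X t x)
   + (c * D t m x) ^+ 2 / 2 * cos (X t x).
have XE x : X (t + m) x = X t x + c * D t m x by rewrite /X DE; ring.
have [mD iD] := D2 t m.
have iDs := iMsin t (L2_itg (D2 t m)).
have iDc := iMcos t iD.
have irem : itg P rem.
  have := itgD (itgD (itgB (icos (t + m)) (icos t)) (itgZ c iDs)) (itgZ (c ^+ 2 / 2) iDc).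
  by apply: eq_itg => x; rewrite /rem XE; ring.
have remb : `|Ex P rem| <= 3 * c ^+ 2 * rho m.
  pose g y : R := y ^+ 2 * Num.min 1 `|c * y|.
  have Dst : Ex P (fun x => g (D t m x)) = rho m.
    transitivity (Ex P (fun x => g (psum (t + m) x - psum t x))); last first.
      exact: (stat t mg (itg_trunc (psum2 m))).
    by apply: eq_Ex => x; congr g; rewrite DE addrC addKr.
  have ig := itg_trunc (D2 t m).
  rewrite -Dst -ExZ//; apply: Ex_abs_le => //; first exact: itgZ.
  move=> x; rewrite /rem (le_trans (cos_taylor2 _ _))// /g exprMn; lra.
have ergb : `|Ex P (fun x => D t m x ^+ 2 * cos (X t x)) - m%:R * s2 * f t| <= m%:R * eta m.
  pose e x := m%:R^-1 * \sum_(j < m) xi (t + j)%N x ^+ 2 - s2.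
  have ie : itg P e.
    apply: itgB; last exact: itg_cst.
    by apply/itgZ/itg_sum => j _; case: (xi2 (t + j)%N).
  have -> : Ex P (fun x => D t m x ^+ 2 * cos (X t x)) - m%:R * s2 * f t =
      m%:R * Ex P (fun x => e x * cos (X t x)).
    rewrite D2cos -[in RHS]ExZ; last exact: iMcos.
    rewrite -ExZ// -ExB.
    - apply: eq_Ex => x; rewrite /e; field; exact: lt0r_neq0.
    - by apply/iMcos/itg_sum => j _; case: (xi2 (t + j)%N).
    - exact: itgZ.
  rewrite normrM gtr0_norm// ler_wpM2l ?(ltW mR)//.
  apply: le_trans (erg t m0); apply: Ex_abs_le; first exact: iMcos.
    exact: itg_abs.
  by move=> x; rewrite normrM ler_piMr// cos_max.
have remE : Ex P rem = f (t + m) - f t + c ^+ 2 / 2 * Ex P (fun x => D t m x ^+ 2 * cos (X t x)).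
  transitivity (Ex P (fun x => (cos (X (t + m) x) - cos (X t x)) + c * (D t m x * sin (X t x))
    + c ^+ 2 / 2 * (D t m x ^+ 2 * cos (X t x)))).
    by apply: eq_Ex => x; rewrite /rem XE; ring.
  rewrite ExD; [|by apply: itgD; [exact: itgB|exact: itgZ]|exact: itgZ].
  rewrite ExD; [|exact: itgB|exact: itgZ].
  by rewrite ExB// !ExZ// Dsin0 mulr0 addr0.
(* Three errors: the Taylor remainder, the replacement of the squared block by m s2, and the
   linearization of exp(- A). *)
have -> : f (t + m) - expR (- A) * f t = Ex P rem
  - c ^+ 2 / 2 * (Ex P (fun x => D t m x ^+ 2 * cos (X t x)) - m%:R * s2 * f t)
  - (expR (- A) - (1 - A)) * f t by rewrite remE /A; field.
apply: (le_trans (ler_normB _ _)); rewrite addrC lerD//.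
  rewrite normrM -[leRHS]mulr1 ler_pM//; exact: expRN_quadratic.
have c20 := sqr_ge0 c.
apply: (le_trans (ler_normB _ _)).
rewrite [leRHS]mulrDr [leRHS]addrC lerD//.
  by rewrite (le_trans remb)//; lra.
rewrite normrM ger0_norm ?divr_ge0// ler_pM//; first by rewrite divr_ge0.
lra.
Qed.

(** Since exp(- A) is at most 1, an error made in one block is not amplified by the next ones, so
    the errors of the blocks add up. *)
Lemma charfun_blocks m N : (0 < m)%N ->
  `|f (N * m) - expR (- (N%:R * (c ^+ 2 * m%:R * s2 / 2))) * cos phi| <=
   N%:R * ((c ^+ 2 * m%:R * s2 / 2) ^+ 2 + c ^+ 2 * (m%:R * eta m + 3 * rho m)).
Proof.
move=> m0; set A := c ^+ 2 * m%:R * s2 / 2; set B := (A ^+ 2 + _).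
have A0 : 0 <= A by rewrite divr_ge0// mulr_ge0// mulr_ge0// sqr_ge0.
elim: N => [|N IH].
  rewrite !mul0r oppr0 expR0 mul1r /f (_ : (fun x => _) = fun=> cos phi).
    by rewrite Ex_cst subrr normr0.
  by apply/funext => x; rewrite /X /psum mul0n big_ord0 mulr0 add0r.
have := charfun_block (N * m) m0; rewrite -/A -/B -mulSnr => h.
have -> : f (N.+1 * m) - expR (- (N.+1%:R * A)) * cos phi =
  (f (N.+1 * m) - expR (- A) * f (N * m)) +
  expR (- A) * (f (N * m) - expR (- (N%:R * A)) * cos phi).
  have -> : - (N.+1%:R * A) = - A + - (N%:R * A) by rewrite -natr1; ring.
  by rewrite expRD; ring.
rewrite (le_trans (ler_normD _ _))// -natr1 mulrDl mul1r addrC lerD//.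
rewrite normrM (le_trans _ IH)// ler_piMl// ger0_norm ?expR_ge0//.
by rewrite expR_le1 oppr_le0.
Qed.

(** Crude bound for the incomplete last block, whose length stays below the block length. *)
Lemma charfun_remainder t m : `|f (t + m) - f t| <=
  `|c| * Ex P (fun x => `|psum m x|).
Proof.
rewrite -ExB// -ExZ; last by apply/itg_abs/L2_itg/psum2.
have iD : itg P (fun x => `|c| * `|D t m x|).
  by apply/itgZ/itg_abs/L2_itg/D2.
apply: (@le_trans _ _ (Ex P (fun x => `|c| * `|D t m x|))).
  apply: Ex_abs_le => //; first exact: itgB.
  move=> x; rewrite /X DE mulrDr addrAC (le_trans (abs_cos_sub _ _))//.
  by rewrite normrM.
rewrite !ExZ; [|exact: (itg_abs (L2_itg (D2 t m)))|exact: (itg_abs (L2_itg (psum2 m)))].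
have <- : Ex P (fun x => `|psum (t + m) x - psum t x|) = Ex P (fun x => `|psum m x|).
  apply: (stat t (g := fun y => `|y|)); first exact: measurableT_comp.
  exact: (itg_abs (L2_itg (psum2 m))).
rewrite ler_wpM2l//; rewrite (@eq_Ex _ _ _ P _ (fun x => `|psum (t + m) x - psum t x|))//.
by move=> x; rewrite DE addrC addKr.
Qed.

End fixed_phase.

Theorem martingale_clt phi :
  (fun n => Ex P (fun x => cos ((Num.sqrt n%:R)^-1 * psum n x + phi))) @ \oo -->
    expR (- (s2 / 2)) * cos phi.
Proof.
pose c n : R := (Num.sqrt n%:R)^-1.
have c0 : c @ \oo --> 0 by exact: cvg_invr_sqrt.
pose rho m n := Ex P (fun x => psum m x ^+ 2 * Num.min 1 `|c n * psum m x|).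
have rho0 m : rho m @ \oo --> 0.
  rewrite -[X in _ --> X](Ex_cst P 0).
  apply: (@Ex_dct _ _ _ _ _ _ (fun x => psum m x ^+ 2)).
  - move=> n; apply: measurable_funM; first exact: measurable_funX.
    apply: measurable_minr => //; apply: measurableT_comp => //.
    exact: measurable_funM.
  - by case: (psum2 m).
  - move=> n x; rewrite normrM ger0_norm ?sqr_ge0// ler_piMr ?sqr_ge0//.
    by rewrite ger0_norm ?ge_min ?lexx// le_min ler01 normr_ge0.
  - move=> x; rewrite -[X in _ --> X](mulr0 (psum m x ^+ 2)).
    apply: cvgM; first exact: cvg_cst.
    apply: (squeeze_cvgr (f := fun=> 0) (h := fun n => `|c n * psum m x|)).
    + by apply: nearW => n; rewrite le_min ler01 normr_ge0 ge_min lexx orbT.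
    + exact: cvg_cst.
    + rewrite -(normr0 R) -(mul0r (psum m x)); apply: cvg_norm.
      by apply: cvgM => //; exact: cvg_cst.
apply/cvgrPdist_le => /= e e0.
have e20 : 0 < e / 2 by rewrite divr_gt0.
(* The block length is fixed first, from the ergodic error alone; all remaining errors, gathered in
   [bnd], vanish as [n] grows with [m] fixed. *)
have [m [m0 me]] : exists m, (0 < m)%N /\ eta m <= e / 2.
  near \oo => m; exists m; split; first by near: m; exact: nbhs_infty_gt.
  apply: le_trans (ler_norm _) _; rewrite -normrN -sub0r.
  near: m; move/cvgrPdist_le : eta0; exact.
pose K := Ex P (fun x => \sum_(j < m) `|xi j x|).
pose bnd n := (c n ^+ 2 * m%:R * (s2 / 2) ^+ 2 + 3 * rho m n)
   + (`|c n| * K + c n ^+ 2 * m%:R * (s2 / 2)).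
have bnd0 : bnd @ \oo --> 0.
  apply: cvg0D; apply: cvg0D.
  - by apply: cvg0Mr; apply: cvg0Mr; exact: cvg0_sqr.
  - exact: cvg0Ml.
  - by apply: cvg0Mr; exact: cvg0_norm.
  - by apply: cvg0Mr; apply: cvg0Mr; exact: cvg0_sqr.
near=> n.
have n0 : (0 < n)%N by near: n; exact: nbhs_infty_gt.
have nR : 0 < n%:R :> R by rewrite ltr0n.
have cn : c n ^+ 2 * n%:R = 1.
  by rewrite /c exprVn sqr_sqrtr ?ler0n// mulVf// lt0r_neq0.
have bn : bnd n <= e / 2.
  apply: le_trans (ler_norm _) _; rewrite -normrN -sub0r.
  near: n; move/cvgrPdist_le : bnd0; exact.
pose N := (n %/ m)%N; pose r := (n %% m)%N.
have nE : n = (N * m + r)%N by exact: divn_eq.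
have cNm : c n ^+ 2 * (N%:R * m%:R) + c n ^+ 2 * r%:R = 1.
  transitivity (c n ^+ 2 * (N * m + r)%:R); last by rewrite -nE.
  by rewrite natrD natrM mulrDr.
have rm : r%:R <= m%:R :> R by rewrite ler_nat ltnW// ltn_pmod.
have N0 : 0 <= N%:R :> R by [].
have r0 : 0 <= r%:R :> R by [].
have mR : 1 <= m%:R :> R by rewrite ler1n.
have csq0 : 0 <= c n ^+ 2 by exact: sqr_ge0.
have rho_ge0 : 0 <= rho m n.
  by apply: Ex_ge0 => x; rewrite mulr_ge0 ?sqr_ge0// le_min ler01 normr_ge0.
have eta_ge0 : 0 <= eta m.
  by apply: le_trans (erg 0 m0); apply: Ex_ge0.
have u0 : 0 <= c n ^+ 2 * r%:R by rewrite mulr_ge0.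
have crm : c n ^+ 2 * r%:R <= c n ^+ 2 * m%:R by rewrite ler_wpM2l.
have cNm1 : c n ^+ 2 * (N%:R * m%:R) <= 1 by lra.
have cNm0 : 0 <= c n ^+ 2 * (N%:R * m%:R) by apply: mulr_ge0 => //; exact: mulr_ge0.
have h1 := charfun_blocks (c n) phi N m0.
have h2 := charfun_remainder (c n) phi (N * m) r.
rewrite -nE in h2.
have h3 : Ex P (fun x => `|psum r x|) <= K.
  apply: Ex_le.
  - exact: (itg_abs (L2_itg (psum2 r))).
  - by apply: itg_sum => j _; exact: (itg_abs (L2_itg (xi2 j))).
  move=> x; rewrite (le_trans (ler_norm_sum _ _ _))//.
  rewrite (big_ord_widen m (fun i => `|xi i x|)); last by rewrite ltnW// ltn_pmod.
  by rewrite [leLHS]big_mkcond ler_sum// => i _; case: ifP.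
have h4 : `|expR (- (N%:R * (c n ^+ 2 * m%:R * s2 / 2))) - expR (- (s2 / 2))| <=
    c n ^+ 2 * m%:R * (s2 / 2).
  have E1 : N%:R * (c n ^+ 2 * m%:R * s2 / 2) = (c n ^+ 2 * (N%:R * m%:R)) * (s2 / 2) by field.
  have s20 : 0 <= s2 / 2 by rewrite divr_ge0.
  rewrite E1; apply: (le_trans (expRN_lipschitz _ _)).
  - exact: mulr_ge0.
  - exact: ler_piMl.
  rewrite -{1}[s2 / 2]mul1r -mulrBl; apply: ler_wpM2r => //; lra.
rewrite distrC.
set F1 := Ex P _ in h2 *; set F2 := Ex P (fun x => cos _) in h1 h2.
rewrite -/(rho m n) in h1.
pose E1 := expR (- (N%:R * (c n ^+ 2 * m%:R * s2 / 2))); pose E2 := expR (- (s2 / 2)).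
rewrite -/E1 in h1 h4; rewrite -/E2 in h4 *.
have -> : F1 - E2 * cos phi = (F1 - F2) + ((F2 - E1 * cos phi) + (E1 - E2) * cos phi) by ring.
have h5 : `|(E1 - E2) * cos phi| <= c n ^+ 2 * m%:R * (s2 / 2).
  by rewrite normrM (le_trans _ h4)// ler_piMr// cos_max.
have h6 : `|F1 - F2| <= `|c n| * K by rewrite (le_trans h2)// ler_wpM2l.
(* The number [N] of blocks is compensated by c^2 N m, which is at most 1 because c^2 n = 1 and N m
   is at most n. *)
have h7 : N%:R * ((c n ^+ 2 * m%:R * s2 / 2) ^+ 2 + c n ^+ 2 * (m%:R * eta m + 3 * rho m n)) <=
   c n ^+ 2 * m%:R * (s2 / 2) ^+ 2 + 3 * rho m n + eta m.
  have -> : N%:R * ((c n ^+ 2 * m%:R * s2 / 2) ^+ 2 + c n ^+ 2 * (m%:R * eta m + 3 * rho m n)) =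
    (c n ^+ 2 * (N%:R * m%:R)) * (c n ^+ 2 * m%:R * (s2 / 2) ^+ 2 + eta m) +
    c n ^+ 2 * N%:R * (3 * rho m n) by field.
  have a1 : c n ^+ 2 * N%:R <= 1.
    rewrite (le_trans _ cNm1)// ler_wpM2l// ler_peMr//.
  have a2 : c n ^+ 2 * N%:R * (3 * rho m n) <= 3 * rho m n.
    by rewrite ler_piMl// mulr_ge0.
  have a3 : (c n ^+ 2 * (N%:R * m%:R)) * (c n ^+ 2 * m%:R * (s2 / 2) ^+ 2 + eta m) <=
     c n ^+ 2 * m%:R * (s2 / 2) ^+ 2 + eta m.
    apply: ler_piMl => //; apply: addr_ge0 => //.
    by apply: mulr_ge0; [exact: mulr_ge0|exact: sqr_ge0].
  lra.
have h8 := ler_normD (F2 - E1 * cos phi) ((E1 - E2) * cos phi).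
have h9 := le_trans h1 h7.
move: bn; rewrite /bnd => bn; apply: (le_trans (ler_normD _ _)).
apply: (le_trans (lerD h6 (le_trans h8 (lerD h9 h5)))); lra.
Unshelve. all: by end_near. Qed.

End martingale_clt.

(** * Gaussian vectors *)

(* [H] and [L] have the common derivative [K], in [t] and in [x] respectively; hence the integral
   of [H t] over [[-N, N]] has the derivative [L t N - L t (- N)] in [t], which vanishes as [N]
   grows, and the integral of [H t] does not depend on [t]. *)
Section gauss_char.
Context {R : realType}.
Variable phi : R.
Let H (t x : R) : R := cos (t * x + phi) * expR ((t ^+ 2 - x ^+ 2) / 2).
Let L (t x : R) : R := sin (t * x + phi) * expR ((t ^+ 2 - x ^+ 2) / 2).
Let K (t x : R) : R := (t * cos (t * x + phi) - x * sin (t * x + phi)) *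
  expR ((t ^+ 2 - x ^+ 2) / 2).

Let is_derive_phase (a t : R) : is_derive t (1:R) (fun t => t * a + phi) a.
Proof. by apply: is_derive_eq; rewrite /GRing.scale /=; ring. Qed.

Let is_derive_quad (b t : R) : is_derive t (1:R) (fun t => (t ^+ 2 - b) / 2) t.
Proof. by apply: is_derive_eq; rewrite /GRing.scale /=; field. Qed.

Let is_derive_quadN (b t : R) : is_derive t (1:R) (fun t => (b - t ^+ 2) / 2) (- t).
Proof. by apply: is_derive_eq; rewrite /GRing.scale /=; field. Qed.

Let dcos a t : is_derive t (1:R) (fun t => cos (t * a + phi)) (a * - sin (t * a + phi)).
Proof. by apply: (is_derive_eq (is_derive1_comp (is_derive_cos _) (is_derive_phase a t))); rewrite mulrC. Qed.

Let dsin a t : is_derive t (1:R) (fun t => sin (a * t + phi)) (a * cos (a * t + phi)).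
Proof.
have -> : (fun t => sin (a * t + phi)) = (fun t => sin (t * a + phi)).
  by apply/funext => u; rewrite mulrC.
rewrite (mulrC a t).
apply: (is_derive_eq (is_derive1_comp (is_derive_sin _) (is_derive_phase a t))).
exact: mulrC.
Qed.

Let dexp b t : is_derive t (1:R) (fun t => expR ((t ^+ 2 - b) / 2)) (t * expR ((t ^+ 2 - b) / 2)).
Proof. by apply: (is_derive_eq (is_derive1_comp (is_derive_expR _) (is_derive_quad b t))); rewrite mulrC. Qed.

Let dexpN b t : is_derive t (1:R) (fun t => expR ((b - t ^+ 2) / 2)) (- t * expR ((b - t ^+ 2) / 2)).
Proof. by apply: (is_derive_eq (is_derive1_comp (is_derive_expR _) (is_derive_quadN b t))); rewrite mulrC. Qed.

Let dH t x : is_derive t (1:R) (H^~ x) (K t x).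
Proof.
have h := is_deriveM (dcos x t) (dexp (x ^+ 2) t).
by apply: (is_derive_eq h); rewrite /GRing.scale /= /K; ring.
Qed.

Let dL t x : is_derive x (1:R) (L t) (K t x).
Proof.
have h := is_deriveM (dsin t x) (dexpN (t ^+ 2) x).
by apply: (is_derive_eq h); rewrite /GRing.scale /= /K; ring.
Qed.

Let cont_of_derive (f df : R -> R) : (forall x, is_derive x (1:R) f (df x)) -> continuous f.
Proof.
by move=> fd y; apply: differentiable_continuous; apply/derivable1_diffP; exact: ex_derive.
Qed.

Let contexp (b : R) : continuous (fun x : R => expR ((b - x ^+ 2) / 2)).
Proof. by apply: cont_of_derive => x; exact: dexpN. Qed.

Let contsin (a : R) : continuous (fun x : R => sin (a * x + phi)).
Proof. by apply: cont_of_derive => x; exact: dsin. Qed.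

Let contcos (a : R) : continuous (fun x : R => cos (a * x + phi)).
Proof.
move=> x; apply: (@continuous_comp _ _ _ (fun x => a * x + phi) cos).
  apply: cvgD; last exact: cvg_cst.
  by apply: cvgM; [exact: cvg_cst|exact: cvg_id].
exact: continuous_cos.
Qed.

Let contH t : continuous (H t).
Proof. by move=> x; apply: cvgM; [exact: contcos|exact: contexp]. Qed.

Let contK t : continuous (K t).
Proof.
move=> x; apply: cvgM; last exact: contexp.
apply: cvgB; apply: cvgM.
- exact: cvg_cst.
- exact: contcos.
- exact: cvg_id.
- exact: contsin.
Qed.

Local Notation mu := (@lebesgue_measure R).

Let cont_itg (f : R -> R) (a b : R) : continuous f -> mu.-integrable `[a, b] (EFin \o f).
Proof.
move=> cf; apply: continuous_compact_integrable; first exact: segment_compact.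
exact: continuous_subspaceT.
Qed.

Let F N t := \int[mu]_(x in `[- N, N]) H t x.

(** A bound uniform for [t] in a neighborhood, as differentiation under the integral sign
    requires. *)
Let K_bound N t x u : `|t| <= u -> `|x| <= N ->
  `|K t x| <= (u + N) * expR (u ^+ 2 / 2).
Proof.
move=> tu xN; rewrite /K normrM ler_pM//.
  rewrite (le_trans (ler_normB _ _))// !normrM lerD//.
    by apply: le_trans tu; rewrite ler_piMr// cos_max.
  by apply: le_trans xN; rewrite ler_piMr// sin_max.
rewrite ger0_norm ?expR_ge0// ler_expR ler_pM2r ?invr_gt0//.
have : t ^+ 2 <= u ^+ 2.
  by rewrite -(real_normK (num_real t)) lerXn2r ?nnegrE// (le_trans _ tu).
have := sqr_ge0 x; lra.
Qed.

Let dF N t : 0 < N -> is_derive t (1:R) (F N) (L t N - L t (- N)).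
Proof.
move=> N0.
have NN : - N < N by rewrite gtrN.
pose u := `|t| + 1.
have Ia : `]- u, u[%classic t.
  rewrite /= in_itv /= -ltr_norml /u ltrDl; exact: ltr01.
have h1 y : `]- u, u[%classic y -> mu.-integrable `[- N, N] (EFin \o H y).
  by move=> _; apply: cont_itg; exact: contH.
have h2 y x : `]- u, u[%classic y -> `[- N, N]%classic x -> derivable (H ^~ x) y 1.
  by move=> _ _; apply: ex_derive; exact: dH.
pose G (x : R) : R := (u + N) * expR (u ^+ 2 / 2).
have u0 : 0 <= u by rewrite addr_ge0.
have G0 x : 0 <= G x by rewrite mulr_ge0 ?expR_ge0// addr_ge0// ltW.
have iG : mu.-integrable `[- N, N] (EFin \o G) by apply: cont_itg => x; exact: cvg_cst.
have d1E y x : partial1of2 H y x = K y x by rewrite partial1of2E; exact: (@derive_val _ _ _ _ _ _ _ (dH y x)).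
have Gub y x : `]- u, u[%classic y -> `[- N, N]%classic x -> `|partial1of2 H y x| <= G x.
  rewrite /= !in_itv /= -ltr_norml -ler_norml d1E => yu xN.
  by apply: K_bound => //; exact: ltW.
have mB : measurable (`[- N, N]%classic : set R) by exact: measurable_itv.
have hd := @derivable_under_integral R _ _ mu H `[- N, N]%classic mB t (- u) u Ia h1 h2 G G0 iG Gub.
apply: (DeriveDef hd).
rewrite -derive1E (@differentiation_under_integral R _ _ mu H `[- N, N]%classic mB t (- u) u Ia h1 h2 G G0 iG Gub).
under eq_Rintegral do rewrite d1E.
rewrite /Rintegral (@continuous_FTC2 _ (K t) (L t) (- N) N NN).
- by [].
- by apply: continuous_subspaceT; exact: contK.
- have cL : continuous (L t) by apply: cont_of_derive => x; exact: dL.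
  split.
  + by move=> x _; apply: ex_derive; exact: dL.
  + exact/cvg_at_right_filter/cL.
  + exact/cvg_at_left_filter/cL.
- by move=> x _; rewrite derive1E; exact: (@derive_val _ _ _ _ _ _ _ (dL t x)).
Qed.

Let F_bound N t : 0 < N -> `|F N t - F N 0| <= `|t| * (2 * expR ((t ^+ 2 - N ^+ 2) / 2)).
Proof.
move=> N0.
have cF : continuous (F N) by apply: cont_of_derive => x; exact: dF.
have Lb c : `|c| <= `|t| -> `|L c N - L c (- N)| <= 2 * expR ((t ^+ 2 - N ^+ 2) / 2).
  move=> ct; rewrite (le_trans (ler_normB _ _))// mulr_natl mulr2n.
  have c2 : c ^+ 2 <= t ^+ 2.
    by rewrite -(real_normK (num_real c)) -(real_normK (num_real t)) lerXn2r ?nnegrE.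
  have e1 : expR ((c ^+ 2 - N ^+ 2) / 2) <= expR ((t ^+ 2 - N ^+ 2) / 2).
    by rewrite ler_expR ler_pM2r ?invr_gt0// lerD2r.
  by apply: lerD; rewrite /L ?sqrrN normrM (ger0_norm (expR_ge0 _)) (le_trans _ e1)//
    ler_piMl ?expR_ge0// sin_max.
have [t0|t0] := leP 0 t.
  have [c] := MVT_segment t0 (fun y _ => dF y N0) (continuous_subspaceT cF).
  rewrite in_itv /= => /andP[c0 ct] ->; rewrite subr0 normrM mulrC ler_wpM2l//.
  by apply: Lb; rewrite !ger0_norm.
have [c] := MVT_segment (ltW t0) (fun y _ => dF y N0) (continuous_subspaceT cF).
rewrite in_itv /= => /andP[c0 ct]; rewrite distrC => ->; rewrite sub0r normrM normrN mulrC ler_wpM2l//.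
by apply: Lb; rewrite !ler0_norm ?lerN2// ltW.
Qed.

Let g (x : R) : R := expR (- x ^+ 2 / 2).

Hypothesis ig : mu.-integrable [set: R] (EFin \o g).

Let cg : continuous g.
Proof.
have -> : g = (fun x => expR ((0 - x ^+ 2) / 2)) by apply/funext => x; rewrite sub0r.
exact: contexp.
Qed.

Let HE t x : H t x = expR (t ^+ 2 / 2) * (cos (t * x + phi) * g x).
Proof. by rewrite /H mulrDl expRD mulNr /g mulNr; ring. Qed.

Let mcg t : measurable_fun setT (fun x : R => cos (t * x + phi) * g x).
Proof.
by apply: continuous_measurable_fun => x; apply: cvgM; [exact: contcos|exact: cg].
Qed.

Let icg t : mu.-integrable [set: R] (EFin \o (fun x : R => cos (t * x + phi) * g x)).
Proof.
have m1 : measurable_fun setT (EFin \o (fun x : R => cos (t * x + phi) * g x)).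
  by apply/measurable_EFinP; exact: mcg.
apply: (@le_integrable _ _ R mu [set: R] measurableT _ (EFin \o g)) => //= x _.
by rewrite /= lee_fin normrM ler_piMl// cos_max.
Qed.

Let F_cvg t : (fun n => F n.+1%:R t) @ \oo -->
  expR (t ^+ 2 / 2) * \int[mu]_x (cos (t * x + phi) * g x).
Proof.
have -> : (fun n => F n.+1%:R t) = (fun n => expR (t ^+ 2 / 2) *
    \int[mu]_(x in `[- n.+1%:R, n.+1%:R]) (cos (t * x + phi) * g x)).
  apply/funext => n; rewrite -RintegralZl//; last first.
    by apply: cont_itg => x; apply: cvgM; [exact: contcos|exact: cg].
  by apply: eq_Rintegral => x _; rewrite HE.
apply: cvgM; first exact: cvg_cst.
under eq_fun do rewrite Rintegral_mkcond.
apply: fine_cvg; rewrite fineK; last by apply: integrable_fin_num => //; exact: icg.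
have mi n : measurable (`[- n.+1%:R, n.+1%:R]%classic : set R) by exact: measurable_itv.
apply: (@dominated_cvg _ _ R mu [set: R] measurableT _ _ (fun x => (g x)%:E)).
- move=> n; apply/measurable_EFinP.
  by apply/(measurable_restrictT _ (mi n)); exact: measurable_funTS.
- move=> x _; apply: cvg_near_cst; near=> n.
  congr EFin; rewrite patchE mem_set//= in_itv /= -ler_norml.
  apply: (@le_trans _ _ n%:R); last by rewrite ler_nat.
  by near: n; exact: nbhs_infty_ger.
- by [].
- exact: ig.
- move=> n x _; rewrite lee_fin patchE; case: ifP => _.
    by rewrite normrM (ger0_norm (expR_ge0 _)) ler_piMl ?expR_ge0// cos_max.
  by rewrite normr0 expR_ge0.
Unshelve. all: by end_near. Qed.

(** H t x is exp(t^2 / 2) cos(t x + phi) g x, so the identity says that the integral of [H t] equals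
    its value at t = 0. *)
Lemma gauss_cos t : \int[mu]_x (cos (t * x + phi) * g x) =
  expR (- (t ^+ 2 / 2)) * (cos phi * \int[mu]_x g x).
Proof.
have h0 := @F_cvg 0.
have ht := @F_cvg t.
have hd : (fun n => F n.+1%:R t - F n.+1%:R 0) @ \oo --> (0 : R).
  apply/cvgrPdist_le => /= e e0; near=> n.
  rewrite sub0r normrN (le_trans (F_bound _ _))//.
  have n1 : 1 <= n.+1%:R :> R by rewrite ler1n.
  set c := `|t| * (2 * expR (t ^+ 2 / 2)).
  have c0 : 0 <= c by rewrite mulr_ge0// mulr_ge0// expR_ge0.
  have -> : `|t| * (2 * expR ((t ^+ 2 - n.+1%:R ^+ 2) / 2)) = c * (expR (n.+1%:R ^+ 2 / 2))^-1.
    by rewrite mulrBl expRB /c; ring.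
  rewrite ler_pdivrMr ?expR_gt0//.
  have h2 : n.+1%:R / 2 <= expR (n.+1%:R ^+ 2 / 2) :> R.
    rewrite (le_trans _ (expR_ge1Dx _))// (@le_trans _ _ (n.+1%:R ^+ 2 / 2))//.
      by rewrite ler_pM2r ?invr_gt0// expr2 ler_peMl.
    by rewrite lerDr.
  apply: le_trans (ler_wpM2l (ltW e0) h2).
  rewrite mulrA ler_pdivlMr// mulrC -ler_pdivrMl// mulrC.
  apply: (@le_trans _ _ n%:R); last by rewrite ler_nat.
  by near: n; exact: nbhs_infty_ger.
have /eqP : expR (t ^+ 2 / 2) * \int[mu]_x (cos (t * x + phi) * g x) -
    expR (0 ^+ 2 / 2) * \int[mu]_x (cos (0 * x + phi) * g x) = 0.
  by apply: (cvg_unique (@norm_hausdorff _ R) (cvgB ht h0)); exact: hd.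
have -> : \int[mu]_x (cos (0 * x + phi) * g x) = cos phi * \int[mu]_x g x.
  by rewrite -RintegralZl//; apply: eq_Rintegral => x _; rewrite mul0r add0r.
rewrite expr0n /= mul0r expR0 mul1r subr_eq0 => /eqP <-.
by rewrite mulrA -expRD addNr expR0 mul1r.
Unshelve. all: by end_near. Qed.

End gauss_char.

Section gaussian_existence.
Context {R : realType}.
Local Notation mu := (@lebesgue_measure R).

(** The Radon-Nikodym derivative agrees almost everywhere with the explicit density, as both have
    the same integral over every measurable set. *)
Lemma normal_density_integral (f : R -> \bar R) : measurable_fun [set: R] f ->
  (forall x, (0 <= f x)%E) ->
  (\int[normal_prob 0 1]_x f x = \int[mu]_x (f x * (normal_pdf 0 1 x)%:E))%E.
Proof.
move=> mf f0.
have dom := @normal_prob_dominates R 0 1.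
rewrite -(Radon_Nikodym_SigmaFinite.change_of_variables dom)//.
have mg : measurable_fun [set: R] (fun x : R => (normal_pdf 0 1 x)%:E).
  by apply/measurable_EFinP; exact: measurable_normal_pdf.
have mRN := measurable_int _ (Radon_Nikodym_SigmaFinite.f_integrable dom).
apply: ae_eq_integral => //.
- exact: emeasurable_funM.
- exact: emeasurable_funM.
- have : ae_eq mu [set: R] (Radon_Nikodym_SigmaFinite.f (normal_prob 0 1) mu)
      (fun x : R => (normal_pdf 0 1 x)%:E).
    apply: integral_ae_eq => //; first exact: Radon_Nikodym_SigmaFinite.f_integrable.
    by move=> E _ mE; rewrite -Radon_Nikodym_SigmaFinite.f_integral.
  by apply: filterS => x /(_ I) hx _; rewrite hx.
Qed.

Lemma normal_cos (t phi : R) :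
  Ex (normal_prob 0 1) (fun x => cos (t * x + phi)) = expR (- (t ^+ 2 / 2)) * cos phi.
Proof.
pose g (x : R) : R := expR (- x ^+ 2 / 2).
have pdfE x : normal_pdf 0 1 x = normal_peak 1 * g x.
  by rewrite normal_pdfE ?oner_eq0// /normal_fun subr0 expr1n /g mulr2n.
have pk0 : 0 < normal_peak (1 : R) by rewrite normal_peak_gt0 ?oner_eq0.
have ipdf := @integrable_normal_pdf R 0 1.
have gE : EFin \o g = (fun x => (normal_peak 1)^-1%:E * (normal_pdf 0 1 x)%:E)%E.
  by apply/funext => y /=; rewrite -EFinM pdfE mulKf// lt0r_neq0.
have ig : mu.-integrable [set: R] (EFin \o g).
  by rewrite gE; exact: integrableZl.
have mc : measurable_fun [set: R] (fun x : R => cos (t * x + phi)).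
  apply: measurableT_comp; first by apply: continuous_measurable_fun; exact: continuous_cos.
  by apply: measurable_funD => //; exact: measurable_funM.
have ic : itg (normal_prob 0 1) (fun x : R => cos (t * x + phi)).
  by apply: (@itg_bounded _ _ _ _ _ 1) => // x; exact: cos_max.
(* Adding 1 makes the integrand nonnegative, as [normal_density_integral] requires; both sides lose
   the 1 again at the end. *)
have h : (\int[normal_prob 0 1]_x (cos (t * x + phi) + 1)%:E =
   \int[mu]_x ((cos (t * x + phi) + 1) * normal_pdf 0 1 x)%:E)%E.
  rewrite normal_density_integral//.
  by apply/measurable_EFinP; exact: measurable_funD.
have icg : mu.-integrable [set: R] (EFin \o (fun x : R => cos (t * x + phi) * g x)).
  apply: (@le_integrable _ _ R mu [set: R] measurableT _ (EFin \o g)) => //=.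
    apply/measurable_EFinP; apply: measurable_funM => //.
    by apply: measurableT_comp => //; apply: measurable_funM => //; apply: measurableT_comp => //; exact: measurable_funX.
  by move=> x _; rewrite /= lee_fin normrM ler_piMl// cos_max.
have int1 : (normal_peak 1 * \int[mu]_x g x)%R = 1.
  rewrite -RintegralZl//; rewrite /Rintegral.
  under eq_integral do rewrite -pdfE.
  by rewrite integral_normal_pdf.
have e1 : Ex (normal_prob 0 1) (fun x => cos (t * x + phi) + 1) =
   (\int[mu]_x (normal_peak 1 * (cos (t * x + phi) * g x) + normal_peak 1 * g x))%R.
  rewrite /Ex /Rintegral h; congr fine; apply: eq_integral => x _.
  by rewrite pdfE; congr EFin; ring.
have := e1; rewrite ExD//; last exact: itg_cst.
rewrite Ex_cst RintegralD//; last 2 first.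
- have := integrableZl measurableT (normal_peak 1) icg; apply: eq_integrable => //.
- have := integrableZl measurableT (normal_peak 1) ig; apply: eq_integrable => //.
rewrite !RintegralZl// int1 => /addIr ->.
rewrite gauss_cos// mulrCA; congr (_ * _).
by rewrite mulrCA int1 mulr1.
Qed.

End gaussian_existence.

Section gaussian_vectors.
Context {R : realType}.

Lemma measurable_cosD {d} {T : measurableType d} (f : T -> R) (phi : R) :
  measurable_fun setT f -> measurable_fun setT (fun x => cos (f x + phi)).
Proof.
move=> mf; apply: measurableT_comp.
  by apply: continuous_measurable_fun; exact: continuous_cos.
exact: measurable_funD.
Qed.

Lemma itg_cosD {d} {T : measurableType d} (P : probability T R) (f : T -> R) (phi : R) :
  measurable_fun setT f -> itg P (fun x => cos (f x + phi)).
Proof.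
by move=> mf; apply: (@itg_bounded _ _ _ _ _ 1) => [|x]; [exact: measurable_cosD|exact: cos_max].
Qed.

(** Each step multiplies the space by a real line carrying the normal law. By Fubini the new
    coordinate is integrated first, with the combination of the old ones as part of the phase. *)
Lemma standard_gaussian_exists (k : nat) :
  exists (d : measure_display) (T : measurableType d) (Q : probability T R)
    (N : 'I_k -> T -> R),
    (forall i, measurable_fun setT (N i)) /\
    forall (u : 'I_k -> R) (phi : R),
      Ex Q (fun w => cos (\sum_(i < k) u i * N i w + phi)) =
      expR (- ((\sum_(i < k) u i ^+ 2) / 2)) * cos phi.
Proof.
elim: k => [|k [d [T [Q [N [mN EN]]]]]].
  (* For k = 0 any probability space serves. *)
  exists _, _, (normal_prob 0 1 : probability _ R), (fun _ _ => 0); split => // u phi.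
  have -> : expR (- ((\sum_(i < 0) u i ^+ 2) / 2)) * cos phi = cos phi.
    by rewrite big_ord0 mul0r oppr0 expR0 mul1r.
  rewrite -[RHS](Ex_cst (normal_prob 0 1)).
  by apply: eq_Ex => w; rewrite big_ord0 add0r.
pose Q' : probability _ R := (Q \x (normal_prob 0 1 : probability _ R))%E.
pose N' (i : 'I_k.+1) (w : T * measurableTypeR R) : R :=
  if unlift ord_max i is Some j then N j w.1 else w.2.
exists _, _, Q', N'; split.
  move=> i; rewrite /N'; case: unlift => [j|].
    exact: measurableT_comp.
  exact: measurable_snd.
move=> u phi.
pose A (x : T) : R := \sum_(i < k) u (widen_ord (leqnSn k) i) * N i x.
have mA : measurable_fun setT A.
  by apply: measurable_sum => i; apply: measurable_funM.
pose c := u ord_max.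
have NE (w : T * measurableTypeR R) : \sum_(i < k.+1) u i * N' i w = A w.1 + c * w.2.
  rewrite big_ord_recr /= /N' unlift_none; congr (_ + _).
  apply: eq_bigr => i _; have -> : widen_ord (leqnSn k) i = lift ord_max i.
    by apply: val_inj => /=; rewrite /bump leqNgt ltn_ord add0n.
  by rewrite liftK.
pose f (w : T * measurableTypeR R) : R := cos (A w.1 + c * w.2 + phi).
have mf : measurable_fun setT f.
  apply: measurable_cosD; apply: measurable_funD.
    exact: measurableT_comp.
  by apply: measurable_funM => //; exact: measurable_snd.
have ifi : itg Q' f by apply: (@itg_bounded _ _ _ _ _ 1) => // w; exact: cos_max.
transitivity (Ex Q' f); first by apply: eq_Ex => w; rewrite NE.
have -> : Ex Q' f = Ex Q (fun x => expR (- (c ^+ 2 / 2)) * cos (A x + phi)).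
  rewrite /Ex /Rintegral; congr fine.
  rewrite -(integral12_prod_meas1 ifi); apply: eq_integral => x _.
  rewrite /fubini_F -normal_cos /Ex /Rintegral fineK; last first.
    apply: integrable_fin_num => //; apply: itg_cosD; exact: measurable_funM.
  by apply: eq_integral => y _; rewrite /f /= addrAC addrC addrA.
rewrite ExZ; last exact: itg_cosD.
rewrite (EN (fun i => u (widen_ord (leqnSn k) i)) phi) mulrA -expRD; congr (expR _ * _).
by rewrite big_ord_recr /= -opprD -mulrDl addrC.
Qed.

(** Induction on the dimension through the Schur complement [S] of the first diagonal entry; the
    factor is block triangular, with first row (sqrt a, b / sqrt a). *)
Lemma posdef_cholesky (n : nat) (V : 'M[R]_n) : posdef V ->
  exists A : 'M[R]_n, A^T *m A = V.
Proof.
elim: n V => [|n IH] V; first by exists 0; apply/matrixP => -[].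
move=> [Vs Vp].
pose V' : 'M[R]_(1 + n) := V.
pose a : R := V' 0 0; pose b := ursubmx V'; pose D := drsubmx V'.
have aE : ulsubmx V' = a%:M.
  apply/matrixP => i j; rewrite !ord1 !mxE eqxx mulr1n /a.
  by congr (V' _ _); apply: val_inj.
have bE : dlsubmx V' = b^T.
  by rewrite /b -[in RHS](_ : V'^T = V')// trmx_ursub trmxK.
have VE : V' = block_mx a%:M b b^T D by rewrite -aE -bE submxK.
have Ds : D^T = D by rewrite /D -[in RHS](_ : V'^T = V')// trmx_drsub.
have quad (x : R) (v : 'rV[R]_n) :
    (row_mx x%:M v *m V' *m (row_mx x%:M v)^T) 0 0 =
    x ^+ 2 * a + 2 * x * (b *m v^T) 0 0 + (v *m D *m v^T) 0 0.
  have yE : (v *m b^T) 0 0 = (b *m v^T) 0 0.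
    by rewrite -[b *m v^T]trmxK trmx_mul trmxK [RHS]mxE.
  rewrite VE mul_row_block tr_row_mx mul_row_col tr_scalar_mx !mul_scalar_mx.
  rewrite !mulmxDl !mul_mx_scalar -!scalemxAl.
  move: (v *m b^T) (b *m v^T) (v *m D *m v^T) yE => P1 P2 P3 yE.
  by rewrite !mxE yE eqxx mulr1n; ring.
have a0 : 0 < a.
  have := Vp (row_mx 1%:M 0 : 'rV[R]_(1 + n)); rewrite quad trmx0 !mulmx0 mxE mulr0 !addr0.
  rewrite expr1n mul1r; apply.
  apply/eqP => /(congr1 (@lsubmx _ 1 1 n)); rewrite row_mxKl => /matrixP/(_ 0 0).
  by rewrite !mxE eqxx => /eqP; rewrite oner_eq0.
pose S := D - a^-1 *: (b^T *m b).
have Spd : posdef S.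
  split; first by rewrite /S linearB /= linearZ /= trmx_mul trmxK Ds.
  move=> v v0.
  (* This first coordinate minimizes the form of [V] for given [v], and the minimum is the form of
     [S] at [v]. *)
  have rv0 : row_mx (- (a^-1 * (b *m v^T) 0 0))%:M v != 0 :> 'rV[R]_(1 + n).
    apply: contra_neq v0 => /matrixP rv0; apply/matrixP => i j.
    by have := rv0 i (rshift 1 j); rewrite row_mxEr !mxE.
  have := Vp _ rv0; rewrite quad.
  have -> : (v *m S *m v^T) 0 0 = (v *m D *m v^T) 0 0 - a^-1 * (b *m v^T) 0 0 ^+ 2.
    have -> : v *m S *m v^T = v *m D *m v^T - a^-1 *: ((b *m v^T)^T *m (b *m v^T)).
      by rewrite /S mulmxBr mulmxBl -scalemxAr -scalemxAl trmx_mul trmxK !mulmxA.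
    move: (v *m D *m v^T) (b *m v^T) => P3 P2.
    by rewrite !mxE big_ord1 !mxE expr2.
  set y := (b *m v^T) 0 0; set z := (v *m D *m v^T) 0 0.
  have -> : (- (a^-1 * y)) ^+ 2 * a + 2 * - (a^-1 * y) * y + z = z - a^-1 * y ^+ 2.
    by field; rewrite lt0r_neq0.
  by [].
have [B BE] := IH S Spd.
pose r := Num.sqrt a.
have rr : r * r = a by rewrite -expr2 sqr_sqrtr// ltW.
have r0 : r != 0 by rewrite sqrtr_eq0 -ltNge.
suff h : (block_mx r%:M (r^-1 *: b) 0 B : 'M[R]_(1 + n))^T *m
    (block_mx r%:M (r^-1 *: b) 0 B : 'M[R]_(1 + n)) = V' by exists (block_mx r%:M (r^-1 *: b) 0 B).
rewrite VE tr_block_mx mulmx_block tr_scalar_mx trmx0 !mul0mx !mulmx0 !addr0.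
rewrite -scalar_mxM rr mul_scalar_mx BE.
rewrite scalerA mulfV// scale1r linearZ /= mul_mx_scalar scalerA mulfV// scale1r.
by rewrite -scalemxAl -scalemxAr scalerA -invfM rr /S addrC subrK.
Qed.

(** The standard Gaussian row times a factor [A] with A^T A = V; phases 0 and - pi / 2 give the
    cosine and the sine. *)
Lemma gaussian_vec_exists (k : nat) (V : 'M[R]_k) : posdef V ->
  exists (d : measure_display) (T : measurableType d) (Q : probability T R)
    (G : T -> 'rV[R]_k), gaussian_vec Q G V.
Proof.
move=> /posdef_cholesky[A AV].
have [d [T [Q [N [mN EN]]]]] := standard_gaussian_exists k.
pose G w := (\row_i N i w) *m A.
exists d, T, Q, G.
have mG i : measurable_fun setT (fun w => G w ord0 i).
  rewrite (_ : (fun w => _) = (fun w => \sum_j N j w * A j i)).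
    by apply: measurable_sum => j; apply: measurable_funM.
  by apply/funext => w; rewrite mxE; apply: eq_bigr => j _; rewrite mxE.
split => // u.
pose v i := (A *m u^T) i ord0.
have GE w : (G w *m u^T) ord0 ord0 = \sum_i v i * N i w.
  by rewrite /G -mulmxA mxE; apply: eq_bigr => i _; rewrite mxE mulrC.
have vE : \sum_i v i ^+ 2 = (u *m V *m u^T) ord0 ord0.
  rewrite -AV !mulmxA -mulmxA -[u *m A^T]trmxK trmx_mul trmxK mxE.
  by apply: eq_bigr => i _; rewrite [in RHS]mxE expr2.
have mv : measurable_fun setT (fun w => \sum_i v i * N i w).
  by apply: measurable_sum => j; apply: measurable_funM.
have key phi : ('E_Q[fun w => cos ((G w *m u^T) ord0 ord0 + phi)])%E =
    (expR (- ((u *m V *m u^T) ord0 ord0) / 2) * cos phi)%:E.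
  rewrite (_ : (fun w => _) = (fun w => cos (\sum_i v i * N i w + phi))); last first.
    by apply/funext => w; rewrite GE.
  rewrite expectationE; last exact: itg_cosD.
  by rewrite EN vE mulNr.
split.
  have := key 0; rewrite cos0 mulr1 => <-; congr expectation.
  by apply/funext => w; rewrite addr0.
have h := key (- (pi / 2)); rewrite cosN cos_pihalf mulr0 in h; rewrite -[RHS]h; congr expectation.
by apply/funext => w; rewrite cosBpihalf.
Qed.

End gaussian_vectors.

(** * Characteristic functions and weak convergence *)

Section bernstein.
Context {R : realType}.

Definition bernstein (N j : nat) (z : R) : R := 'C(N, j)%:R * (z ^+ j * (1 - z) ^+ (N - j)).

Lemma bernstein_ge0 N j z : 0 <= z <= 1 -> 0 <= bernstein N j z.
Proof.
by move=> /andP[z0 z1]; rewrite /bernstein !mulr_ge0// exprn_ge0// subr_ge0.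
Qed.

Lemma bernstein_sum N z : \sum_(j < N.+1) bernstein N j z = 1.
Proof.
have := exprDn (1 - z) z N; rewrite subrK expr1n => ->.
by apply: eq_bigr => j _; rewrite /bernstein mulr_natl; congr (_ *+ _); exact: mulrC.
Qed.

Lemma bernsteinS N j z : j.+1%:R * bernstein N.+1 j.+1 z = N.+1%:R * z * bernstein N j z.
Proof.
rewrite /bernstein subSS exprS.
have h : j.+1%:R * 'C(N.+1, j.+1)%:R = N.+1%:R * 'C(N, j)%:R :> R.
  by rewrite -!natrM -mul_bin_diag.
by rewrite mulrA h; ring.
Qed.

Lemma bernstein_mean N z : \sum_(j < N.+1) j%:R * bernstein N j z = N%:R * z.
Proof.
case: N => [|N]; first by rewrite big_ord1 !mul0r.
rewrite big_ord_recl mul0r add0r.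
under eq_bigr do rewrite lift0 bernsteinS.
by rewrite -mulr_sumr bernstein_sum mulr1.
Qed.

Lemma bernstein_fact2 N z :
  \sum_(j < N.+2) j%:R * (j%:R - 1) * bernstein N.+1 j z = N.+1%:R * N%:R * z ^+ 2.
Proof.
rewrite big_ord_recl !mul0r add0r.
transitivity (\sum_(i < N.+1) N.+1%:R * z * (i%:R * bernstein N i z)).
  apply: eq_bigr => i _; rewrite lift0 mulrAC -[_ * bernstein _ _ _]mulrC.
  rewrite [bernstein _ _ _ * _]mulrC bernsteinS -natr1; ring.
rewrite -mulr_sumr bernstein_mean; ring.
Qed.

(** Variance of a binomial frequency, from the first two factorial moments; a degree written as a
    successor can be divided by. *)
Lemma bernstein_variance N z :
  \sum_(j < N.+2) (j%:R / N.+1%:R - z) ^+ 2 * bernstein N.+1 j z = z * (1 - z) / N.+1%:R.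
Proof.
have n0 : N.+1%:R != 0 :> R by rewrite pnatr_eq0.
transitivity (\sum_(j < N.+2) (N.+1%:R ^- 2 * (j%:R * (j%:R - 1) * bernstein N.+1 j z)
  + (N.+1%:R ^- 2 - 2 * z / N.+1%:R) * (j%:R * bernstein N.+1 j z)
  + z ^+ 2 * bernstein N.+1 j z)).
  by apply: eq_bigr => j _; field.
rewrite !big_split /= -!mulr_sumr bernstein_fact2 bernstein_mean bernstein_sum.
rewrite -natr1 in n0 *; field; exact: n0.
Qed.

End bernstein.

(** * Bernstein approximation in several variables *)

Section bernstein_multi.
Context {R : realType} {k : nat}.
Implicit Types (z : 'I_k -> R).

(** The joint law of [k] independent binomials with parameters [N] and [z i]. *)
Definition bweight N z (m : {ffun 'I_k -> 'I_N.+1}) : R :=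
  \prod_(i < k) bernstein N (m i) (z i).

Lemma bweight_ge0 N z (m : {ffun 'I_k -> 'I_N.+1}) : (forall i, 0 <= z i <= 1) -> 0 <= bweight z m :> R.
Proof. by move=> z01; apply: prodr_ge0 => i _; exact: (@bernstein_ge0 _ N). Qed.

Lemma bweight_sum N z : \sum_(m : {ffun 'I_k -> 'I_N.+1}) bweight z m = 1.
Proof.
rewrite /bweight -(bigA_distr_bigA (fun i (j : 'I_N.+1) => bernstein N j (z i))).
by rewrite big1// => i _; exact: bernstein_sum.
Qed.

Lemma bweight_variance N z i0 :
  \sum_(m : {ffun 'I_k -> 'I_N.+2}) ((m i0)%:R / N.+1%:R - z i0) ^+ 2 * bweight z m =
  z i0 * (1 - z i0) / N.+1%:R.
Proof.
pose F i (j : 'I_N.+2) : R := (if i == i0 then (j%:R / N.+1%:R - z i0) ^+ 2 else 1) *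
  bernstein N.+1 j (z i).
transitivity (\sum_(m : {ffun 'I_k -> 'I_N.+2}) \prod_i F i (m i)).
  apply: eq_bigr => m _; rewrite /F big_split /=; congr (_ * _).
  by rewrite -big_mkcond /= big_pred1_eq.
rewrite -bigA_distr_bigA (bigD1 i0)//= [X in _ * X]big1 => [|i ii0].
  by rewrite mulr1 -bernstein_variance; apply: eq_bigr => j _; rewrite /F eqxx.
rewrite -(bernstein_sum N.+1 (z i)); apply: eq_bigr => j _.
by rewrite /F (negbTE ii0) mul1r.
Qed.

(** Chebyshev's argument: a grid point with all coordinates within [del] of [z] costs [eps];
    otherwise the sum [V] of squared deviations is at least del^2 and 2 M V / del^2 dominates 2 M.
    Each coordinate contributes a variance of at most 1 / (N + 1). *)
Lemma bernstein_approx (F : ('I_k -> R) -> R) (M del eps : R) (N : nat) z :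
  (forall y, `|F y| <= M) -> 0 < del -> 0 <= eps ->
  (forall i, 0 <= z i <= 1) ->
  (forall y, (forall i, 0 <= y i <= 1) -> (forall i, `|y i - z i| < del) -> `|F y - F z| <= eps) ->
  `|\sum_(m : {ffun 'I_k -> 'I_N.+2}) F (fun i => (m i)%:R / N.+1%:R) * bweight z m - F z| <=
   eps + 2 * M / del ^+ 2 * (k%:R / N.+1%:R).
Proof.
move=> FM d0 e0 z01 Fd.
have M0 : 0 <= M by exact: le_trans (FM z).
have c0 : 0 <= 2 * M / del ^+ 2 by apply: divr_ge0; [exact: mulr_ge0|exact: sqr_ge0].
pose V (m : {ffun 'I_k -> 'I_N.+2}) : R := \sum_i ((m i)%:R / N.+1%:R - z i) ^+ 2.
have pt (m : {ffun 'I_k -> 'I_N.+2}) : `|F (fun i => (m i)%:R / N.+1%:R) - F z| <=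
    eps + 2 * M / del ^+ 2 * V m.
  have V0 : 0 <= V m by apply: sumr_ge0 => i _; exact: sqr_ge0.
  have [h|/forallPn/=[i ih]] := boolP [forall i, `|(m i)%:R / N.+1%:R - z i| < del].
    apply: (@le_trans _ _ eps).
      apply: Fd => [i|i]; last by have /forallP := h.
      by rewrite divr_ge0//= ler_pdivrMr ?ltr0n// mul1r ler_nat -ltnS.
    by rewrite lerDl; exact: mulr_ge0.
  rewrite -leNgt in ih.
  apply: (@le_trans _ _ (2 * M)).
    by rewrite (le_trans (ler_normB _ _))// mulr_natl mulr2n lerD.
  rewrite (@le_trans _ _ (2 * M / del ^+ 2 * V m))//; last by rewrite lerDr.
  rewrite -mulrA; apply: ler_peMr; first exact: mulr_ge0.
  rewrite ler_pdivlMl ?exprn_gt0// mulr1.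
  apply: (@le_trans _ _ (((m i)%:R / N.+1%:R - z i) ^+ 2)).
    by rewrite -[leRHS]real_normK ?num_real// lerXn2r ?nnegrE// ltW.
  by rewrite /V (bigD1 i)//= lerDl sumr_ge0// => j _; exact: sqr_ge0.
have -> : \sum_(m : {ffun 'I_k -> 'I_N.+2}) F (fun i => (m i)%:R / N.+1%:R) * bweight z m - F z =
   \sum_(m : {ffun 'I_k -> 'I_N.+2}) (F (fun i => (m i)%:R / N.+1%:R) - F z) * bweight z m.
  under [RHS]eq_bigr do rewrite mulrBl.
  by rewrite sumrB -mulr_sumr bweight_sum mulr1.
apply: le_trans (ler_norm_sum _ _ _) _.
apply: (@le_trans _ _ (\sum_(m : {ffun 'I_k -> 'I_N.+2}) (eps * bweight z m
   + 2 * M / del ^+ 2 * (V m * bweight z m)))).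
  apply: ler_sum => m _; rewrite normrM (ger0_norm (bweight_ge0 _ z01)).
  by rewrite (le_trans (ler_wpM2r (bweight_ge0 m z01) (pt m)))// mulrDl mulrA.
rewrite big_split /= -!mulr_sumr bweight_sum mulr1 lerD2l.
rewrite ler_wpM2l//.
under eq_bigr do rewrite mulr_suml.
rewrite exchange_big /=; under eq_bigr do rewrite bweight_variance.
rewrite -mulr_suml ler_wpM2r ?invr_ge0//.
rewrite (le_trans (ler_sum _ (G := fun=> 1) _))//.
  move=> i _; have /andP[a b] := z01 i.
  by rewrite mulr_ile1// ?subr_ge0// lerBlDr lerDl.
by rewrite sumr_const card_ord.
Qed.

End bernstein_multi.

(** * The algebra of real trigonometric polynomials *)

Section trigonometric_polynomials.
Context {R : realType} {k : nat}.
Implicit Types (x u : 'rV[R]_k) (h : 'rV[R]_k -> R).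

Definition dotp x u : R := (x *m u^T) ord0 ord0.

Lemma dotpE x u : dotp x u = \sum_i x ord0 i * u ord0 i.
Proof. by rewrite /dotp mxE; apply: eq_bigr => i _; rewrite mxE. Qed.

Lemma dotpDr x u v : dotp x (u + v) = dotp x u + dotp x v.
Proof. by rewrite /dotp linearD /= mulmxDr mxE. Qed.

Lemma dotpBr x u v : dotp x (u - v) = dotp x u - dotp x v.
Proof. by rewrite /dotp linearB /= mulmxBr !mxE. Qed.

(** Triples of coefficient, frequency and phase; with phases, cosines alone are closed under
    products and include the sines. *)
Definition trigpoly h := exists s : seq (R * 'rV[R]_k * R),
  forall x, h x = \sum_(t <- s) t.1.1 * cos (dotp x t.1.2 + t.2).

Lemma eq_trigpoly h1 h2 : h1 =1 h2 -> trigpoly h1 -> trigpoly h2.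
Proof. by move=> /funext ->. Qed.

Lemma trigpoly_cos u phi : trigpoly (fun x => cos (dotp x u + phi)).
Proof. by exists [:: (1, u, phi)] => x; rewrite big_seq1 /= mul1r. Qed.

Lemma trigpolyZ c h : trigpoly h -> trigpoly (fun x => c * h x).
Proof.
move=> [s hs]; exists [seq (c * t.1.1, t.1.2, t.2) | t <- s] => x.
by rewrite hs mulr_sumr big_map; apply: eq_bigr => t _; rewrite /= mulrA.
Qed.

Lemma trigpolyD h1 h2 : trigpoly h1 -> trigpoly h2 -> trigpoly (fun x => h1 x + h2 x).
Proof. by move=> [s1 e1] [s2 e2]; exists (s1 ++ s2) => x; rewrite big_cat /= e1 e2. Qed.

Lemma trigpoly_cst c : trigpoly (fun=> c).
Proof.
apply: eq_trigpoly (trigpolyZ c (trigpoly_cos 0 0)) => x.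
by rewrite /dotp trmx0 mulmx0 mxE addr0 cos0 mulr1.
Qed.

Lemma trigpoly_sum I (s : seq I) (Q : pred I) (h : I -> 'rV[R]_k -> R) :
  (forall i, Q i -> trigpoly (h i)) -> trigpoly (fun x => \sum_(i <- s | Q i) h i x).
Proof.
move=> hi; elim: s => [|i s IH].
  by apply: eq_trigpoly (trigpoly_cst 0) => x; rewrite big_nil.
apply: (@eq_trigpoly (fun x => (if Q i then h i x else 0) + \sum_(j <- s | Q j) h j x)) => [x|].
  by rewrite big_cons; case: ifP; rewrite ?add0r.
by apply: trigpolyD => //; case: (boolP (Q i)) => Qi; [exact: hi|exact: trigpoly_cst].
Qed.

Lemma trigpolyM h1 h2 : trigpoly h1 -> trigpoly h2 -> trigpoly (fun x => h1 x * h2 x).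
Proof.
move=> [s1 e1] [s2 e2].
apply: (@eq_trigpoly (fun x => \sum_(t1 <- s1) \sum_(t2 <- s2)
   (t1.1.1 * t2.1.1 / 2) * (cos (dotp x (t1.1.2 + t2.1.2) + (t1.2 + t2.2)) +
     cos (dotp x (t1.1.2 - t2.1.2) + (t1.2 - t2.2))))) => [x|].
  rewrite e1 e2 mulr_suml; apply: eq_bigr => t1 _; rewrite mulr_sumr.
  apply: eq_bigr => t2 _; rewrite dotpDr dotpBr.
  set a := dotp x t1.1.2; set b := dotp x t2.1.2.
  have -> : a + b + (t1.2 + t2.2) = (a + t1.2) + (b + t2.2) by ring.
  have -> : a - b + (t1.2 - t2.2) = (a + t1.2) - (b + t2.2) by ring.
  by rewrite cosD cosB; field.
apply: trigpoly_sum => t1 _; apply: trigpoly_sum => t2 _; apply: trigpolyZ.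
by apply: trigpolyD; exact: trigpoly_cos.
Qed.

Lemma trigpolyX n h : trigpoly h -> trigpoly (fun x => h x ^+ n).
Proof.
move=> hh; elim: n => [|n IH]; first exact: trigpoly_cst.
by apply: eq_trigpoly (trigpolyM hh IH) => x; rewrite exprS.
Qed.

Lemma trigpoly_prod I (s : seq I) (h : I -> 'rV[R]_k -> R) :
  (forall i, trigpoly (h i)) -> trigpoly (fun x => \prod_(i <- s) h i x).
Proof.
move=> hi; elim: s => [|i s IH].
  by apply: eq_trigpoly (trigpoly_cst 1) => x; rewrite big_nil.
by apply: eq_trigpoly (trigpolyM (hi i) IH) => x; rewrite big_cons.
Qed.

Lemma trigpoly_sin_coord (c : R) i : trigpoly (fun x => sin (c * x ord0 i)).
Proof.
apply: eq_trigpoly (trigpoly_cos (c *: delta_mx ord0 i) (- (pi / 2))) => x.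
rewrite cosBpihalf dotpE (bigD1 i)//= big1 => [|j ji].
  by rewrite !mxE !eqxx addr0 mulr1 mulrC.
by rewrite !mxE (negbTE ji) andbF !mulr0.
Qed.

End trigonometric_polynomials.

Section row_topology.
Context {R : realType} {k : nat}.

Lemma nbhs_rowP (x : 'rV[R]_k) (A : set 'rV[R]_k) :
  nbhs x A <-> exists2 e : R, 0 < e &
    forall y : 'rV[R]_k, (forall i, `|x ord0 i - y ord0 i| < e) -> A y.
Proof.
rewrite -nbhs_ballE; split.
  move=> [e /= e0 h]; exists e => // y xy; apply: h.
  by split => // i j; rewrite ord1; exact: xy.
move=> [e e0 h]; exists e => //= y xy; apply: h => i.
by case: xy => _ /(_ ord0 i).
Qed.

Lemma row_comp_continuous (psi : R -> R) : continuous psi ->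
  continuous (fun v : 'rV[R]_k => \row_i psi (v ord0 i)).
Proof.
move=> cpsi v A /nbhs_rowP[e e0 hA].
have : nbhs v [set w : 'rV[R]_k | forall i, `|psi (v ord0 i) - psi (w ord0 i)| < e].
  apply: (@filter_forall _ _ (fun i => [set w : 'rV[R]_k | `|psi (v ord0 i) - psi (w ord0 i)| < e]) (nbhs v)) => i.
  have c : continuous (fun w : 'rV[R]_k => psi (w ord0 i)).
    move=> w; apply: (@continuous_comp _ _ _ (fun w : 'rV[R]_k => w ord0 i) psi).
      exact: coord_continuous.
    exact: cpsi.
  by have /cvgrPdist_lt/(_ e e0) := c v.
by apply: filterS => w hw; apply: hA => i; rewrite !mxE.
Qed.

(** Only [x] is confined to the compact cube while [y] may leave it, hence the covering argument
    with neighborhoods in the whole space. *)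
Lemma row_unif_continuous (F : 'rV[R]_k -> R) (a b eps : R) : continuous F -> 0 < eps ->
  exists2 del : R, 0 < del & forall x y : 'rV[R]_k, (forall i, a <= x ord0 i <= b) ->
    (forall i, `|x ord0 i - y ord0 i| < del) -> `|F x - F y| <= eps.
Proof.
move=> cF e0.
pose B := [set v : 'rV[R]_k | forall i, `[a, b]%classic (v ord0 i)].
have cB : compact B.
  by apply: (@rV_compact R k (fun=> `[a, b]%classic)) => i; exact: segment_compact.
pose Q (del : R) (x : 'rV[R]_k) := forall y : 'rV[R]_k,
  (forall i, `|x ord0 i - y ord0 i| < del) -> `|F x - F y| <= eps.
have hQ : \forall del \near (0 : R)^'+, B `<=` Q del.
  apply: (iffLR (compact_near_coveringP B)) => // x Bx.
  have e20 : 0 < eps / 2 by rewrite divr_gt0.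
  have /cvgrPdist_le/(_ _ e20)/nbhs_rowP[r r0 hr] := cF x.
  have r20 : 0 < r / 2 by rewrite divr_gt0.
  near=> x' del => y hy.
  have hx' : forall i, `|x ord0 i - x' ord0 i| < r / 2.
    by near: x'; apply/nbhs_rowP; exists (r / 2).
  have hd : del < r / 2 by near: del; exact: nbhs_right_lt.
  have h1 : `|F x - F x'| <= eps / 2.
    by apply: hr => i; rewrite (lt_trans (hx' i))// ltr_pdivrMr// ltr_pMr// ltr1n.
  have h2 : `|F x - F y| <= eps / 2.
    apply: hr => i; rewrite (le_lt_trans (ler_distD (x' ord0 i) _ _))//.
    rewrite [ltRHS](splitr r); apply: ltrD; first exact: hx'.
    exact: lt_trans (hy i) hd.
  rewrite (le_trans (ler_distD (F x) _ _))// distrC; lra.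
have [del [d0 hd]] := filter_ex (filterI (nbhs_right_gt (0 : R)) hQ).
by exists del => // x y xab xy; apply: hd.
Unshelve. all: by end_near. Qed.

End row_topology.

Section trigonometric_approximation.
Context {R : realType} {k : nat}.

Lemma sin_le_sin1 (t : R) : `|t| <= 1 -> `|sin t| <= sin 1.
Proof.
move=> t1; have p2 : 1 <= pi / 2 :> R by exact: pihalf_ge1.
wlog t0 : t t1 / 0 <= t.
  move=> H; have [t0|t0] := leP 0 t; first exact: H.
  by rewrite -normrN -sinN; apply: H; [rewrite normrN|rewrite oppr_ge0 ltW].
rewrite (ger0_norm t0) in t1.
have tpi : t <= pi / 2 by exact: le_trans t1 p2.
rewrite ger0_norm; last first.
  apply: sin_ge0_pi; rewrite t0 (le_trans tpi)//.
  by have := @pi_ge0 R; lra.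
have pih : - (pi / 2) <= 0 :> R by rewrite oppr_le0 divr_ge0// pi_ge0.
move: t1; rewrite le_eqVlt => /predU1P[-> //|t1].
apply/ltW; rewrite ltr_sin// in_itv /=.
  by rewrite (le_trans pih).
by rewrite (le_trans pih)//= .
Qed.

Lemma sin1_lt1 : sin (1 : R) < 1.
Proof.
have p2 : (1 : R) < pi / 2.
  rewrite lt_neqAle pihalf_ge1 andbT; apply/eqP => h.
  by have := @cos1_gt0 R; rewrite h cos_pihalf ltxx.
have pih : - (pi / 2) <= 0 :> R by rewrite oppr_le0 divr_ge0// pi_ge0.
rewrite -[ltRHS](@sin_pihalf R) ltr_sin// in_itv /=.
  by rewrite (le_trans pih)//= ltW.
by rewrite lexx andbT (le_trans pih)// divr_ge0// pi_ge0.
Qed.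

Lemma clamp_lipschitz (c y z : R) : 0 <= c ->
  `|Num.max (- c) (Num.min c y) - Num.max (- c) (Num.min c z)| <= `|y - z|.
Proof.
move=> c0.
have hc w : [\/ Num.max (- c) (Num.min c w) = c /\ c <= w,
    Num.max (- c) (Num.min c w) = - c /\ w <= - c |
    Num.max (- c) (Num.min c w) = w /\ - c <= w <= c].
  have [h|h] := leP c w.
    by constructor 1; split => //; rewrite max_r; lra.
  have [h2|h2] := leP w (- c).
    by constructor 2.
  by constructor 3; split => //; rewrite !ltW.
have h := ler_norm (y - z); have h' := ler_norm (- (y - z)); rewrite normrN in h'.
case: (hc y) => -[-> ?]; case: (hc z) => -[-> ?]; rewrite ler_norml; apply/andP; split; lra.
Qed.

Lemma clamp_continuous (c : R) : 0 <= c -> continuous (fun y : R => Num.max (- c) (Num.min c y)).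
Proof.
move=> c0 y; apply/cvgrPdist_le => /= e e0.
have /cvgrPdist_le/(_ e e0) : (fun w : R => w) @ y --> y by exact: cvg_id.
by apply: filterS => w; apply: le_trans; exact: clamp_lipschitz.
Qed.

(* On [|x_i| <= L] the point [x] is a continuous function of the [sin (x_i / L)], so that [g] is
   approximated by multivariate Bernstein polynomials in [(1 + sin (x_i / L)) / 2]; these also
   keep the global bound [M]. *)
Lemma trigpoly_approx (g : 'rV[R]_k -> R) (M L eps : R) : continuous g ->
  (forall x, `|g x| <= M) -> 0 < L -> 0 < eps ->
  exists h, [/\ trigpoly h, (forall x, `|h x| <= M) &
    forall x : 'rV[R]_k, (forall i, `|x ord0 i| <= L) -> `|h x - g x| <= eps].
Proof.
move=> cg gM L0 e0.
have M0 : 0 <= M by exact: le_trans (gM 0).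
pose c : R := sin 1.
have c1 : c < 1 by exact: sin1_lt1.
have c0 : 0 <= c by rewrite (le_trans _ (@sin_le_sin1 1 _)) ?normr1.
(* Clamping at sin 1 < 1 keeps the argument of [asin] inside the open interval where it is
   continuous, and changes nothing when all |x_i| are at most [L], since then |sin (x_i / L)| is at
   most sin 1. Thus [psi] inverts the map [z] there. *)
pose clamp (y : R) := Num.max (- c) (Num.min c y).
have clampc : continuous clamp.
  exact: clamp_continuous.
have clamp1 y : -1 < clamp y < 1.
  rewrite lt_max ltrN2 c1 /= gt_max gt_min c1 /= andbT.
  by rewrite (le_lt_trans _ (ltr01))// oppr_le0.
pose psi (z : R) := L * asin (clamp (2 * z - 1)).
have psic : continuous psi.
  move=> z; apply: cvgM; first exact: cvg_cst.
  apply: (@continuous_comp R R R (fun z => clamp (2 * z - 1)) (@asin R)); last exact: continuous_asin.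
  apply: (@continuous_comp R R R (fun z : R => 2 * z - 1) clamp); last exact: clampc.
  by apply: cvgB; [apply: cvgM; [exact: cvg_cst|exact: cvg_id]|exact: cvg_cst].
pose F (v : 'rV[R]_k) := g (\row_i psi (v ord0 i)).
have Fc : continuous F.
  move=> v; apply: (@continuous_comp _ _ _ (fun v : 'rV[R]_k => \row_i psi (v ord0 i)) g).
    exact: (row_comp_continuous psic).
  exact: cg.
have e20 : 0 < eps / 2 by rewrite divr_gt0.
have [del d0 hd] := row_unif_continuous 0 1 Fc e20.
pose F' (z : 'I_k -> R) := F (\row_i z i).
have F'M z : `|F' z| <= M by exact: gM.
pose C := 2 * M / del ^+ 2 * k%:R.
have C0 : 0 <= C.
  by apply: mulr_ge0 => //; apply: divr_ge0; [exact: mulr_ge0|exact: sqr_ge0].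
have [N hN] : exists N : nat, C / N.+1%:R <= eps / 2.
  exists (Num.truncn (C / (eps / 2))).
  rewrite ler_pdivrMr// mulrC -ler_pdivrMr// ltW// truncnS_gt//.
pose z (x : 'rV[R]_k) i : R := 2^-1 * (1 + sin (L^-1 * x ord0 i)).
have z01 x i : 0 <= z x i <= 1.
  have := sin_geN1 (L^-1 * x ord0 i); have := sin_le1 (L^-1 * x ord0 i).
  by rewrite /z => a b; apply/andP; split; lra.
exists (fun x => \sum_(m : {ffun 'I_k -> 'I_N.+2}) F' (fun i => (m i)%:R / N.+1%:R) * bweight (z x) m).
split.
- apply: trigpoly_sum => m _; apply: trigpolyZ; apply: trigpoly_prod => i.
  have tz : trigpoly (fun x => z x i).
    by apply: trigpolyZ; apply: trigpolyD; [exact: trigpoly_cst|exact: trigpoly_sin_coord].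
  apply: trigpolyZ; apply: trigpolyM; apply: trigpolyX => //.
  apply: (@eq_trigpoly _ _ (fun x => 1 + (-1) * z x i)); first by move=> x; rewrite mulN1r.
  by apply: trigpolyD; [exact: trigpoly_cst|exact: trigpolyZ].
- move=> x; rewrite (le_trans (ler_norm_sum _ _ _))//.
  rewrite -[leRHS]mulr1 -(bweight_sum N.+1 (z x)) mulr_sumr ler_sum// => m _.
  by rewrite normrM (ger0_norm (bweight_ge0 _ (z01 x))) ler_wpM2r// bweight_ge0.
move=> x xL.
have <- : F' (z x) = g x.
  rewrite /F' /F; congr g; apply/rowP => i; rewrite !mxE /psi.
  have -> : 2 * z x i - 1 = sin (L^-1 * x ord0 i) by rewrite /z; field.
  set t := L^-1 * x ord0 i.
  have t1 : `|t| <= 1.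
    by rewrite /t normrM gtr0_norm ?invr_gt0// ler_pdivrMl// mulr1.
  have := sin_le_sin1 t1; rewrite ler_norml => /andP[s1 s2].
  rewrite /clamp min_r// max_r//.
  rewrite sinK ?mulVKf// ?lt0r_neq0//.
  have p2 : 1 <= pi / 2 :> R by exact: pihalf_ge1.
  move: t1; rewrite ler_norml in_itv /= => /andP[t1 t2].
  by rewrite (le_trans _ t1) ?lerN2//= (le_trans t2).
have := @bernstein_approx _ _ F' M del (eps / 2) N (z x) F'M d0 (ltW e20) (z01 x).
move=> /(_ _)/le_trans; apply.
  move=> y y01 yz; rewrite distrC; apply: hd => i; rewrite !mxE//.
  by rewrite distrC.
rewrite [leRHS](splitr eps) lerD2l mulrA; exact: hN.
Qed.

End trigonometric_approximation.

(** * From characteristic functions to weak convergence *)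

Section weak_convergence.
Context {R : realType} {k : nat}.

Lemma cvg_seq_sum I (s : seq I) (f : I -> nat -> R) (l : I -> R) :
  (forall i, f i @ \oo --> l i) ->
  (fun n => \sum_(i <- s) f i n) @ \oo --> \sum_(i <- s) l i.
Proof.
move=> fl; elim: s => [|i s IH].
  rewrite big_nil (_ : (fun n => _) = fun=> 0); first exact: cvg_cst.
  by apply/funext => n; rewrite big_nil.
rewrite big_cons (_ : (fun n => _) = (fun n => f i n + \sum_(j <- s) f j n)).
  by apply: cvgD.
by apply/funext => n; rewrite big_cons.
Qed.

Lemma measurable_dotp {d} {T : measurableType d} (X : T -> 'rV[R]_k) (u : 'rV[R]_k) :
  (forall i, measurable_fun setT (fun w => X w ord0 i)) ->
  measurable_fun setT (fun w => dotp (X w) u).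
Proof.
move=> mX; rewrite (_ : (fun w => _) = (fun w => \sum_i X w ord0 i * u ord0 i)).
  by apply: measurable_sum => i; apply: measurable_funM.
by apply/funext => w; rewrite dotpE.
Qed.

Lemma measurable_trigpoly {d} {T : measurableType d} (X : T -> 'rV[R]_k) h :
  (forall i, measurable_fun setT (fun w => X w ord0 i)) -> trigpoly h ->
  measurable_fun setT (fun w => h (X w)).
Proof.
move=> mX [s hs]; rewrite (_ : (fun w => _) =
  (fun w => \sum_(t <- s) t.1.1 * cos (dotp (X w) t.1.2 + t.2))).
  apply: measurable_sum => t; apply: measurable_funM => //.
  by apply: measurable_cosD; exact: measurable_dotp.
by apply/funext => w; rewrite hs.
Qed.

(** Random rows are measurable coordinate by coordinate; [g (X w)] is the pointwise limit of
    trigonometric polynomials that are 1 / (n + 1)-close to [g] on the cube of half-side n + 1. *)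
Lemma measurable_continuous_row {d} {T : measurableType d} (X : T -> 'rV[R]_k)
    (g : 'rV[R]_k -> R) (M : R) :
  (forall i, measurable_fun setT (fun w => X w ord0 i)) -> continuous g ->
  (forall x, `|g x| <= M) -> measurable_fun setT (fun w => g (X w)).
Proof.
move=> mX cg gM.
have /choice[h hh] : forall n : nat, exists h, [/\ trigpoly h, (forall x, `|h x| <= M) &
    forall x : 'rV[R]_k, (forall i, `|x ord0 i| <= n.+1%:R) -> `|h x - g x| <= n.+1%:R^-1].
  by move=> n; apply: trigpoly_approx.
apply: (measurable_fun_cvg (h := fun n w => h n (X w))) => [n|w _].
  by apply: measurable_trigpoly => //; case: (hh n).
apply/cvgrPdist_le => /= e e0; near=> n.
have [_ _ hn] := hh n; rewrite distrC (le_trans (hn _ _))//.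
  move=> i; apply: (@le_trans _ _ n%:R); last by rewrite ler_nat.
  apply: (@le_trans _ _ (\sum_j `|X w ord0 j|)).
    by rewrite (bigD1 i)//= lerDl sumr_ge0.
  by near: n; exact: nbhs_infty_ger.
rewrite invf_ple ?posrE//; apply: (@le_trans _ _ n%:R); last by rewrite ler_nat.
by near: n; exact: nbhs_infty_ger.
Unshelve. all: by end_near. Qed.

Lemma Ex_trigpoly_cvg {d} {T : measurableType d} (P : probability T R) (X : nat -> T -> 'rV[R]_k)
    {d'} {T' : measurableType d'} (Q : probability T' R) (G : T' -> 'rV[R]_k) h :
  (forall n i, measurable_fun setT (fun w => X n w ord0 i)) ->
  (forall i, measurable_fun setT (fun w => G w ord0 i)) ->
  (forall u phi, (fun n => Ex P (fun w => cos (dotp (X n w) u + phi))) @ \oo -->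
     Ex Q (fun w => cos (dotp (G w) u + phi))) ->
  trigpoly h -> (fun n => Ex P (fun w => h (X n w))) @ \oo --> Ex Q (fun w => h (G w)).
Proof.
move=> mX mG cv [s hs].
have E (d0 : measure_display) (T0 : measurableType d0) (P0 : probability T0 R) (Y : T0 -> 'rV[R]_k) :
    (forall i, measurable_fun setT (fun w => Y w ord0 i)) ->
    Ex P0 (fun w => h (Y w)) = \sum_(t <- s) t.1.1 * Ex P0 (fun w => cos (dotp (Y w) t.1.2 + t.2)).
  move=> mY; have ic t : itg P0 (fun w => cos (dotp (Y w) t.1.2 + t.2)).
    by apply: itg_cosD; exact: measurable_dotp.
  transitivity (Ex P0 (fun w => \sum_(t <- s) t.1.1 * cos (dotp (Y w) t.1.2 + t.2))).
    by apply: eq_Ex => w; exact: hs.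
  rewrite Ex_sum => [|t _]; last exact: itgZ.
  by apply: eq_bigr => t _; rewrite ExZ.
rewrite E// (_ : (fun n => _) =
  (fun n => \sum_(t <- s) t.1.1 * Ex P (fun w => cos (dotp (X n w) t.1.2 + t.2)))).
  by apply: cvg_seq_sum => t; apply: cvgM; [exact: cvg_cst|exact: cv].
by apply/funext => n; rewrite E.
Qed.

Lemma tight_rv {d} {T : measurableType d} (Q : probability T R) (f : T -> R) (e : R) :
  measurable_fun setT f -> 0 < e -> exists2 L : R, 0 < L & Pr Q [set w | L < `|f w|] <= e.
Proof.
move=> mf e0.
have mA n : measurable [set w | n.+1%:R < `|f w|].
  apply: (measurable_set_lt (f := fun=> n.+1%:R)) => //; exact: measurableT_comp.
have h : (fun n => Ex Q (\1_[set w | n.+1%:R < `|f w|] : T -> R)) @ \oo --> Ex Q (fun=> 0).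
  apply: (@Ex_dct _ _ _ _ _ _ (fun=> 1)).
  - by move=> n; exact: measurable_indic.
  - exact: itg_cst.
  - by move=> n x; rewrite indicE; case: (_ \in _); rewrite ?normr1 ?normr0.
  - move=> w; apply: cvg_near_cst; near=> n; rewrite indicE memNset//=; apply/negP.
    rewrite -leNgt (@le_trans _ _ n%:R)//; last by rewrite ler_nat.
    by near: n; exact: nbhs_infty_ger.
rewrite Ex_cst in h.
have [n _ /(_ n (leqnn n))hn] := cvg0_near h e0.
by exists n.+1%:R => //; rewrite Pr_Ex//; exact: le_trans (ler_norm _) hn.
Unshelve. all: by end_near. Qed.

(** Levy's continuity theorem for a Gaussian limit, with tightness as a hypothesis. On a large cube
    [g] is close to a trigonometric polynomial, whose expectations converge; outside it both are
    bounded by [M] and the probability is small. *)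
Lemma cvg_dist_normal_charfun {d} {T : measurableType d} (P : probability T R)
    (X : nat -> T -> 'rV[R]_k) (V : 'M[R]_k) :
  posdef V ->
  (forall n i, measurable_fun setT (fun w => X n w ord0 i)) ->
  (forall u phi, (fun n => Ex P (fun w => cos (dotp (X n w) u + phi))) @ \oo -->
     expR (- ((u *m V *m u^T) ord0 ord0) / 2) * cos phi) ->
  (forall i (e : R), 0 < e -> exists2 L : R, 0 < L &
     \forall n \near \oo, Pr P [set w | L < `|X n w ord0 i|] <= e) ->
  cvg_dist_normal P X V.
Proof.
move=> Vp mX cX tX.
have [d' [T' [Q [G gG]]]] := gaussian_vec_exists Vp.
exists d', T', Q, G; split => // g cg [M0 gM0].
have [mG charG] := gG.
pose M := Num.max M0 1.
have gM x : `|g x| <= M by rewrite le_max gM0.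
have M1 : 1 <= M by rewrite le_max lexx orbT.
have mgX n : measurable_fun setT (fun w => g (X n w)) by exact: measurable_continuous_row (mX n) cg gM.
have mgG : measurable_fun setT (fun w => g (G w)) by exact: measurable_continuous_row mG cg gM.
have igX n : itg P (fun w => g (X n w)) by apply: itg_bounded (mgX n) (fun w => gM (X n w)).
have igG : itg Q (fun w => g (G w)) by apply: itg_bounded mgG (fun w => gM (G w)).
suff h : (fun n => Ex P (fun w => g (X n w))) @ \oo --> Ex Q (fun w => g (G w)).
  have -> : (fun n => 'E_P[g \o X n])%E = (fun n => (Ex P (fun w => g (X n w)))%:E).
    by apply/funext => n; rewrite -expectationE.
  by rewrite expectationE//; apply: cvg_EFin; [exact: nearW|exact: h].
have charG' u phi : Ex Q (fun w => cos (dotp (G w) u + phi)) =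
    expR (- ((u *m V *m u^T) ord0 ord0) / 2) * cos phi.
  have [c s] := charG u.
  have ic : itg Q (fun w => cos (dotp (G w) u)).
    by have := @itg_cosD _ _ _ Q _ 0 (measurable_dotp u mG); apply: eq_itg => w; rewrite addr0.
  have is_ : itg Q (fun w => sin (dotp (G w) u)).
    by have := @itg_cosD _ _ _ Q _ (- (pi / 2)) (measurable_dotp u mG); apply: eq_itg => w; rewrite cosBpihalf.
  have c' : Ex Q (fun w => cos (dotp (G w) u)) = expR (- ((u *m V *m u^T) ord0 ord0) / 2).
    by apply: EFin_inj; rewrite -expectationE.
  have s' : Ex Q (fun w => sin (dotp (G w) u)) = 0.
    by apply: EFin_inj; rewrite -expectationE.
  transitivity (Ex Q (fun w => cos phi * cos (dotp (G w) u) - sin phi * sin (dotp (G w) u))).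
    by apply: eq_Ex => w; rewrite cosD; ring.
  rewrite ExB; [|exact: itgZ|exact: itgZ].
  by rewrite !ExZ// c' s' mulr0 subr0 mulrC.
apply/cvgrPdist_le => /= e e0.
have e8 : 0 < e / 8 by rewrite divr_gt0.
(* Replacing [g] by [h] costs e / 8 on the cube and at most 2 M k e', hence 2 e / 8, outside. This
   happens for [X n] and for [G], and the convergence for [h] adds e / 8: in all 7 e / 8. *)
pose e' := e / 8 / M / k.+1%:R.
have M0' : 0 < M by exact: lt_le_trans M1.
have e'0 : 0 < e' by rewrite !divr_gt0.
have ke' : M * (k%:R * e') <= e / 8.
  have kk : k%:R <= k.+1%:R :> R by rewrite ler_nat.
  have k0 : 0 < k.+1%:R :> R by [].
  rewrite /e'; move: kk k0; set a : R := k%:R; set b : R := k.+1%:R => kk k0.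
  rewrite (_ : M * (a * _) = (a / b) * (e / 8)); last by field; rewrite !gt_eqF.
  by rewrite ler_piMl ?(ltW e8)// ler_pdivrMr// mul1r.
have /choice[LX hLX] : forall i, exists L : R, 0 < L /\
    \forall n \near \oo, Pr P [set w | L < `|X n w ord0 i|] <= e'.
  by move=> i; have [L L0 hL] := tX i e' e'0; exists L.
have /choice[LG hLG] : forall i, exists L : R, 0 < L /\ Pr Q [set w | L < `|G w ord0 i|] <= e'.
  by move=> i; have [L L0 hL] := tight_rv Q (mG i) e'0; exists L.
pose L := 1 + \sum_i (LX i + LG i).
have LX0 i : 0 < LX i by case: (hLX i).
have LG0 i : 0 < LG i by case: (hLG i).
have L0 : 0 < L by rewrite ltr_pwDl// sumr_ge0// => i _; rewrite addr_ge0// ltW.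
have Lle i : LX i + LG i <= L.
  rewrite /L (bigD1 i)//= addrCA lerDl addr_ge0//.
  by rewrite sumr_ge0// => j _; rewrite addr_ge0// ltW.
have [h [th hM ha]] := trigpoly_approx cg gM L0 e8.
have ch := Ex_trigpoly_cvg mX mG (fun u phi => eq_ind_r (fun z => _ --> z) (cX u phi) (charG' u phi)) th.
have key (d0 : measure_display) (T0 : measurableType d0) (P0 : probability T0 R) (Y : T0 -> 'rV[R]_k) :
    (forall i, measurable_fun setT (fun w => Y w ord0 i)) ->
    (forall i, Pr P0 [set w | L < `|Y w ord0 i|] <= e') ->
    `|Ex P0 (fun w => g (Y w)) - Ex P0 (fun w => h (Y w))| <= 3 * (e / 8).
  move=> mY hY.
  have mhY : measurable_fun setT (fun w => h (Y w)) by exact: measurable_trigpoly.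
  have ihY : itg P0 (fun w => h (Y w)) by apply: itg_bounded mhY (fun w => hM (Y w)).
  have igY : itg P0 (fun w => g (Y w)).
    exact: itg_bounded (measurable_continuous_row mY cg gM) (fun w => gM (Y w)).
  have mA i : measurable [set w | L < `|Y w ord0 i|].
    by apply: (measurable_set_lt (f := fun=> L)) => //; exact: measurableT_comp.
  rewrite -ExB//.
  apply: (@le_trans _ _ (Ex P0 (fun w => e / 8 + 2 * M * \sum_i \1_[set w | L < `|Y w ord0 i|] w))).
    apply: Ex_abs_le; first exact: itgB.
      apply: itgD; first exact: itg_cst.
      by apply: itgZ; apply: itg_sum => i _; exact: itg_indic.
    move=> w.
    have S0 : 0 <= \sum_i \1_[set w | L < `|Y w ord0 i|] w :> R.
      by apply: sumr_ge0 => i _; rewrite indicE.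
    have [/forallP hw|/forallPn/=[i hi]] := boolP [forall i, `|Y w ord0 i| <= L].
      by rewrite distrC (le_trans (ha _ hw))// lerDl mulr_ge0// mulr_ge0// ltW.
    rewrite -ltNge in hi.
    apply: (@le_trans _ _ (2 * M)).
      by rewrite (le_trans (ler_normB _ _))// mulr_natl mulr2n lerD.
    apply: (@le_trans _ _ (2 * M * \sum_i \1_[set w | L < `|Y w ord0 i|] w)); last first.
      by rewrite lerDr ltW.
    rewrite ler_peMr ?mulr_ge0 ?(ltW M0')//.
    rewrite (bigD1 i)//= indicE mem_set//= lerDl sumr_ge0// => j _; by rewrite indicE.
  have iS : itg P0 (fun w => \sum_i \1_[set w | L < `|Y w ord0 i|] w : R).
    by apply: itg_sum => i _; exact: itg_indic.
  rewrite ExD; [|exact: itg_cst|exact: itgZ].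
  rewrite (ExZ _ iS) Ex_cst Ex_sum => [|i _]; last exact: itg_indic.
  have : \sum_i Ex P0 \1_[set w | L < `|Y w ord0 i|] <= k%:R * e'.
    rewrite mulr_natl -[X in _ *+ X]card_ord -sumr_const ler_sum// => i _.
    by rewrite -Pr_Ex.
  move=> hs; have : M * \sum_i Ex P0 \1_[set w | L < `|Y w ord0 i|] <= e / 8.
    by apply: le_trans ke'; rewrite ler_wpM2l// ltW.
  lra.
have mlt (d0 : measure_display) (T0 : measurableType d0) (f : T0 -> R) c : measurable_fun setT f ->
    measurable [set w | c < `|f w|].
  by move=> mf; apply: (measurable_set_lt (f := fun=> c)) => //; exact: measurableT_comp.
have hG : `|Ex Q (fun w => g (G w)) - Ex Q (fun w => h (G w))| <= 3 * (e / 8).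
  apply: key => // i; apply: le_trans (proj2 (hLG i)); apply: Pr_le; [exact: mlt|exact: mlt|].
  by move=> w /=; apply: le_lt_trans; rewrite (le_trans _ (Lle i))// lerDr ltW.
have hall : \forall n \near \oo, forall i, Pr P [set w | LX i < `|X n w ord0 i|] <= e'.
  by apply: filter_forall => i; case: (hLX i).
have /cvgrPdist_le/(_ (e / 8) e8) := ch.
apply: filterS2 hall => n hn1 hn2.
have hX : `|Ex P (fun w => g (X n w)) - Ex P (fun w => h (X n w))| <= 3 * (e / 8).
  apply: key => // i; apply: le_trans (hn1 i); apply: Pr_le; [exact: mlt|exact: mlt|].
  by move=> w /=; apply: le_lt_trans; rewrite (le_trans _ (Lle i))// lerDl ltW.
move: hG hX hn2; rewrite !ler_norml => /andP[? ?] /andP[? ?] /andP[? ?].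
apply/andP; split; lra.
Qed.

End weak_convergence.

(** * The interval model *)

Section kernel_product.
Context {R : realType}.
Variable K : bool -> bool -> R.
Hypothesis Kspd : spd_kernel K.
Implicit Types A B : itv R.

Lemma kipE A B : kip K A B = K true true * (A.2 * B.2) - K true false * (A.2 * B.1) -
  K false true * (A.1 * B.2) + K false false * (A.1 * B.1).
Proof. by rewrite /kip !big_bool /supp /=; ring. Qed.

Lemma kipC A B : kip K A B = kip K B A.
Proof. by have [e _] := Kspd; rewrite !kipE e; ring. Qed.

Lemma kip_ilincombl p (Z : 'I_p -> itv R) th B :
  kip K (ilincomb Z th) B = \sum_j th ord0 j * kip K (Z j) B.
Proof.
transitivity (\sum_j th ord0 j * (K true true * ((Z j).2 * B.2) - K true false * ((Z j).2 * B.1) -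
  K false true * ((Z j).1 * B.2) + K false false * ((Z j).1 * B.1))); last first.
  by apply: eq_bigr => j _; rewrite kipE.
rewrite kipE /ilincomb /= !mulr_suml !mulr_sumr -!sumrB -big_split/=.
by apply: eq_bigr => j _; ring.
Qed.

Lemma knorm2_isub A B : knorm2 K (isub A B) = knorm2 K A - 2 * kip K B A + knorm2 K B.
Proof. by have [e _] := Kspd; rewrite /knorm2 !kipE /isub /= e; ring. Qed.

Lemma knorm2_coercive : exists2 c : R, 0 <= c &
  forall A, A.1 ^+ 2 <= c * knorm2 K A /\ A.2 ^+ 2 <= c * knorm2 K A.
Proof.
have [e [p11 dt]] := Kspd.
set a := K true true in p11 dt; set c := K false false in dt; set b := K true false in dt.
have D0 : 0 < a * c - b ^+ 2 by rewrite subr_gt0.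
have c0 : 0 <= c.
  have : 0 < a * c by apply: le_lt_trans dt; exact: sqr_ge0.
  by rewrite pmulr_rgt0// => /ltW.
exists ((a + c) / (a * c - b ^+ 2)) => [|A].
  by rewrite divr_ge0 ?(ltW D0)// addr_ge0// ltW.
have qE : knorm2 K A = a * (A.2 * A.2) - 2 * (b * (A.1 * A.2)) + c * (A.1 * A.1).
  by rewrite /knorm2 kipE -e -/a -/b -/c; ring.
have h1 : 0 <= a * knorm2 K A - (a * c - b ^+ 2) * A.1 ^+ 2.
  rewrite (_ : _ - _ = (a * A.2 - b * A.1) ^+ 2) ?sqr_ge0//; rewrite qE; ring.
have h2 : 0 <= c * knorm2 K A - (a * c - b ^+ 2) * A.2 ^+ 2.
  rewrite (_ : _ - _ = (c * A.1 - b * A.2) ^+ 2) ?sqr_ge0//; rewrite qE; ring.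
have D1 : 0 <= (a * c - b ^+ 2) * A.1 ^+ 2 by rewrite mulr_ge0 ?sqr_ge0// ltW.
have D2 : 0 <= (a * c - b ^+ 2) * A.2 ^+ 2 by rewrite mulr_ge0 ?sqr_ge0// ltW.
by rewrite -!(mulrAC _ (knorm2 K A)) !ler_pdivlMr// mulrDl; split; lra.
Qed.

End kernel_product.

(** * Fourth moments of the interval endpoints *)

Section fourth_moments.
Context {R : realType} {d : measure_display} {T : measurableType d} (P : probability T R).
Implicit Types f g : T -> R.

(** The class whose products are square integrable, as the score, a product of regressor and
    residual, has to be. *)
Definition L4 f := measurable_fun setT f /\ L2 P (fun x => f x ^+ 2).

Lemma eq_L4 f g : f =1 g -> L4 f -> L4 g.
Proof. by move=> /funext ->. Qed.

Lemma L4_cst c : L4 (fun=> c).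
Proof. by split; [exact: measurable_cst|exact: L2_cst]. Qed.

Lemma L4Z c f : L4 f -> L4 (fun x => c * f x).
Proof.
move=> [mf f2]; split; first exact: measurable_funM.
by apply: eq_L2 (L2Z (c ^+ 2) f2) => x; rewrite exprMn.
Qed.

Lemma L4D f g : L4 f -> L4 g -> L4 (fun x => f x + g x).
Proof.
move=> [mf f2] [mg g2]; split; first exact: measurable_funD.
have [_ ig] := L2D (L2Z 2 f2) (L2Z 2 g2).
split; first by apply: measurable_funX; exact: measurable_funD.
apply: itg_dom ig _ => [|x].
  by apply: measurable_funX; apply: measurable_funX; exact: measurable_funD.
have h : 0 <= 2 * f x ^+ 2 + 2 * g x ^+ 2.
  by apply: addr_ge0; apply: mulr_ge0 => //; exact: sqr_ge0.
rewrite ger0_norm ?sqr_ge0// lerXn2r ?nnegrE ?sqr_ge0//.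
have := sqr_ge0 (f x - g x); rewrite !expr2; nra.
Qed.

Lemma L4B f g : L4 f -> L4 g -> L4 (fun x => f x - g x).
Proof. by move=> f4 g4; apply: eq_L4 (L4D f4 (L4Z (-1) g4)) => x; rewrite mulN1r. Qed.

Lemma L4_sum I (s : seq I) (Q : pred I) (h : I -> T -> R) :
  (forall i, Q i -> L4 (h i)) -> L4 (fun x => \sum_(i <- s | Q i) h i x).
Proof.
move=> hi; elim: s => [|i s IH].
  by apply: eq_L4 (L4_cst 0) => x; rewrite big_nil.
apply: (@eq_L4 (fun x => (if Q i then h i x else 0) + \sum_(j <- s | Q j) h j x)) => [x|].
  by rewrite big_cons; case: ifP; rewrite ?add0r.
by apply: L4D => //; case: (boolP (Q i)) => Qi; [exact: hi|exact: L4_cst].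
Qed.

Lemma L4M f g : L4 f -> L4 g -> L2 P (fun x => f x * g x).
Proof.
move=> [mf f2] [mg g2]; split; first exact: measurable_funM.
by apply: eq_itg (L2M f2 g2) => x; rewrite exprMn.
Qed.

Definition iL4 (A : T -> itv R) := L4 (fun x => (A x).1) /\ L4 (fun x => (A x).2).

Lemma kip_L2 K A B : iL4 A -> iL4 B -> L2 P (fun x => kip K (A x) (B x)).
Proof.
move=> [A1 A2] [B1 B2].
have h := L2D (L2B (L2B (L2Z (K true true) (L4M A2 B2)) (L2Z (K true false) (L4M A2 B1)))
  (L2Z (K false true) (L4M A1 B2))) (L2Z (K false false) (L4M A1 B1)).
by apply: eq_L2 h => x; rewrite kipE.
Qed.

Lemma measurable_kip K (A B : T -> itv R) :
  measurable_fun setT (fun x => (A x).1) -> measurable_fun setT (fun x => (A x).2) ->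
  measurable_fun setT (fun x => (B x).1) -> measurable_fun setT (fun x => (B x).2) ->
  measurable_fun setT (fun x => kip K (A x) (B x)).
Proof.
move=> mA1 mA2 mB1 mB2; rewrite (_ : (fun x => _) =
  (fun x => K true true * ((A x).2 * (B x).2) - K true false * ((A x).2 * (B x).1) -
  K false true * ((A x).1 * (B x).2) + K false false * ((A x).1 * (B x).1))); last first.
  by apply/funext => x; rewrite kipE.
apply: measurable_funD; first apply: measurable_funB; first apply: measurable_funB.
all: by apply: measurable_funM => //; exact: measurable_funM.
Qed.

Lemma knorm2_iL4 K (A : T -> itv R) : spd_kernel K ->
  measurable_fun setT (fun x => (A x).1) -> measurable_fun setT (fun x => (A x).2) ->
  ('E_P[fun x => (knorm2 K (A x) ^+ 2)%R] < +oo)%E -> iL4 A.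
Proof.
move=> /knorm2_coercive[c c0 hc] m1 m2 fin.
have mk : measurable_fun setT (fun x => knorm2 K (A x) ^+ 2).
  by apply: measurable_funX; exact: measurable_kip.
have ik : itg P (fun x => knorm2 K (A x) ^+ 2) by apply: ge0_itg fin => // x; exact: sqr_ge0.
have h f : measurable_fun setT f -> (forall x, f x ^+ 2 <= c * knorm2 K (A x)) -> L4 f.
  move=> mf fc; split=> //; split; first exact: measurable_funX.
  apply: itg_dom (itgZ (c ^+ 2) ik) _ => [|x].
    by apply: measurable_funX; exact: measurable_funX.
  rewrite ger0_norm ?sqr_ge0// -exprMn lerXn2r ?nnegrE ?sqr_ge0//.
  by rewrite (le_trans _ (fc x)) ?sqr_ge0.
by split; apply: h => // x; case: (hc (A x)).
Qed.

Lemma iL4_isub A B : iL4 A -> iL4 B -> iL4 (fun x => isub (A x) (B x)).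
Proof. by move=> [A1 A2] [B1 B2]; split; exact: L4B. Qed.

Lemma iL4_ilincomb p (Z : T -> 'I_p -> itv R) th :
  (forall j, iL4 (fun x => Z x j)) -> iL4 (fun x => ilincomb (Z x) th).
Proof. by move=> hZ; split; apply: L4_sum => j _; apply: L4Z; case: (hZ j). Qed.

End fourth_moments.

Section measure_preserving_converse.
Context {R : realType} {d d' : measure_display} {T : measurableType d} {T' : measurableType d'}.
Variables (P : probability T R) (Q : probability T' R) (V : T -> T').
Hypothesis PQV : mpres P Q V.

Lemma mpres_itgV f : measurable_fun setT f -> itg P (f \o V) -> itg Q f.
Proof.
move=> mf /integrableP[_ fi]; apply/integrableP; split; first exact/measurable_EFinP.
rewrite -(mpres_ge0_integral PQV (g := fun y => `|(f y)%:E|%E))//.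
by apply/measurable_EFinP; exact: measurableT_comp.
Qed.

Lemma mpres_L2 f : L2 Q f -> L2 P (f \o V).
Proof.
move=> [mf fi]; split; first by apply: measurableT_comp => //; case: PQV.
exact: (mpres_itg PQV fi).
Qed.

Lemma mpres_L4V f : measurable_fun setT f -> L4 P (f \o V) -> L4 Q f.
Proof.
move=> mf [_ [_ fi]]; split => //; split; first exact: measurable_funX.
by apply: mpres_itgV => //; apply: measurable_funX; exact: measurable_funX.
Qed.

End measure_preserving_converse.

(* Entry [j] of [Zvec] is either a constant, a lag of [Y] or a current or lagged [X],
   the same one for all times and all data. *)
Definition regressor {R : realType} {J : nat} {T : Type} (Y : int -> T -> itv R)
    (X : 'I_J -> int -> T -> itv R) (t : int) (w : T)
    (k : (R * R) + (nat + 'I_J * nat)) : itv R :=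
  match k with
  | inl c => c
  | inr (inl i) => Y (t - i%:Z) w
  | inr (inr (j, l)) => X j (t - l%:Z) w
  end.

(** The entries known to the information set of time t: lags of [Y] start at 1, whereas the current
    [X] belongs to it. *)
Definition predetermined {R : realType} {J : nat} (k : (R * R) + (nat + 'I_J * nat)) : bool :=
  if k is inr (inl i) then (0 < i)%N else true.

Lemma Zvec_regressor {R : realType} (q J s : nat) (j : 'I_(pdim q J s)) :
  exists k : (R * R) + (nat + 'I_J * nat),
    predetermined k /\
    forall T (Y : int -> T -> itv R) (X : 'I_J -> int -> T -> itv R) t w,
      Zvec q J s Y X t w j = regressor Y X t w k.
Proof.
pose codes : seq ((R * R) + (nat + 'I_J * nat)) :=
  [:: inl (ipoint 1); inl I0] ++ [seq inr (inl i) | i <- iota 1 q] ++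
  flatten [seq [seq inr (inr (j, l)) | j <- enum 'I_J] | l <- iota 0 s.+1].
exists (nth (inl (ipoint 0)) codes j); split; last first.
  move=> T Y X t w; rewrite /Zvec.
  have fl (L : seq nat) : flatten [seq [seq X i (t - l%:Z) w | i <- enum 'I_J] | l <- L] =
      map (regressor Y X t w) (flatten [seq [seq inr (inr (i, l)) | i <- enum 'I_J] | l <- L]).
    by elim: L => //= l L IH; rewrite map_cat -map_comp IH.
  have yl (L : seq nat) : [seq Y (t - i%:Z) w | i <- L] =
      map (regressor Y X t w) [seq inr (inl i) | i <- L] by elim: L => //= l L ->.
  have -> : Zseq q J s Y X t w = map (regressor Y X t w) codes.
    by rewrite /Zseq fl yl -map_cat.
  have [jc|jc] := ltnP j (size codes); first by rewrite (nth_map (inl (ipoint 0))).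
  (* Beyond the end of the list both sides are the default interval [ipoint 0]. *)
  by rewrite !nth_default// size_map.
have [jc|jc] := ltnP j (size codes); last by rewrite nth_default.
suff /(all_nthP (inl (ipoint 0)))/(_ _ jc) : all predetermined codes by [].
have fl (L : seq nat) :
    all predetermined (flatten [seq [seq inr (inr (i, l)) | i <- enum 'I_J] | l <- L]).
  by elim: L => //= l L IH; rewrite all_cat IH andbT all_map; apply/allP.
rewrite /codes all_cat all_cat fl andbT /= all_map.
by apply/allP => i; rewrite mem_iota => /andP[].
Qed.

(** * Sequences obtained by shifting one function of the path *)

Section stationary_sequence.
Context {R : realType} {d d' : measure_display} {T : measurableType d} {T' : measurableType d'}.
Variables (P : probability T R) (Q : probability T' R) (V : T -> T') (tau : T' -> T').
Hypotheses (PQ : mpres P Q V) (QQ : mpres Q Q tau).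
Hypothesis tau_erg : forall A, measurable A -> A = tau @^-1` A -> Q A = 0%E \/ Q A = 1%E.

Definition along (f : T' -> R) (i : nat) (w : T) := f (iter i tau (V w)).

Lemma mpres_along i : mpres P Q (fun w => iter i tau (V w)).
Proof. exact: mpres_comp PQ (mpres_iter QQ i). Qed.

Lemma itg_along f i : itg Q f -> itg P (along f i).
Proof. by move=> fi; exact: (mpres_itg (mpres_along i) fi). Qed.

Lemma Ex_along f i : itg Q f -> Ex P (along f i) = Ex Q f.
Proof. by move=> fi; exact: (mpres_Ex (mpres_along i) fi). Qed.

Lemma L2_along f i : L2 Q f -> L2 P (along f i).
Proof. by move=> fi; exact: (mpres_L2 (mpres_along i) fi). Qed.

Lemma sum_along f t m w :
  \sum_(j < m) along f (t + j) w = bsum tau f m (iter t tau (V w)).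
Proof. by apply: eq_bigr => j _; rewrite /along addnC iterD. Qed.

Lemma along_ergodic f t m : itg Q f ->
  Ex P (fun w => `|m%:R^-1 * \sum_(j < m) along f (t + j) w - Ex Q f|) =
  Ex Q (fun x => `|m%:R^-1 * bsum tau f m x - Ex Q f|).
Proof.
move=> fi.
rewrite -(mpres_Ex (mpres_along t) (f := fun x => `|m%:R^-1 * bsum tau f m x - Ex Q f|)).
  by apply: eq_Ex => w; rewrite sum_along.
by apply/itg_abs/itgB; [exact/itgZ/itg_bsum|exact: itg_cst].
Qed.

Lemma along_mean_ergodic f : itg Q f ->
  (fun n => Ex P (fun w => `|n%:R^-1 * \sum_(j < n) along f j w - Ex Q f|)) @ \oo --> 0.
Proof.
move=> fi; under eq_cvg => n do rewrite (along_ergodic 0 n fi).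
exact: mean_ergodic.
Qed.

Lemma psum_along f n : psum (along f) n = fun w => bsum tau f n (V w).
Proof. by apply/funext => w; rewrite -(sum_along f 0). Qed.

Lemma psum_along_stationary f t m (g : R -> R) : L2 Q f ->
  measurable_fun setT g -> itg P (fun w => g (psum (along f) m w)) ->
  Ex P (fun w => g (psum (along f) (t + m) w - psum (along f) t w)) =
  Ex P (fun w => g (psum (along f) m w)).
Proof.
move=> [mf _] mg ig.
have mb : measurable_fun setT (bsum tau f m).
  apply: measurable_sum => i; apply: measurableT_comp => //.
  by case: (mpres_iter QQ i).
have gi : itg Q (fun x => g (bsum tau f m x)).
  apply: (mpres_itgV PQ); first exact: measurableT_comp.
  by apply: eq_itg ig => w; rewrite psum_along.
transitivity (Ex Q (fun x => g (bsum tau f m x))); last first.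
  by rewrite -(mpres_Ex PQ gi); apply: eq_Ex => w; rewrite psum_along.
rewrite -(mpres_Ex (mpres_along t) gi); apply: eq_Ex => w; congr g.
by rewrite /psum big_split_ord/= addrAC subrr add0r sum_along.
Qed.

Variable f : T' -> R.
Hypothesis f2 : L2 Q f.
Hypothesis orth1 : forall r t a phi, (r <= t)%N ->
  Ex P (fun w => along f t w * cos (a * psum (along f) r w + phi)) = 0.
Hypothesis orth2 : forall r s t a phi, (r <= s < t)%N ->
  Ex P (fun w => along f t w * (along f s w * cos (a * psum (along f) r w + phi))) = 0.

(** The error [eta m] of the martingale theorem is the mean ergodic error for f^2; by invariance it
    does not depend on where the block starts. *)
Lemma along_clt phi :
  (fun n => Ex P (fun w => cos ((Num.sqrt n%:R)^-1 * psum (along f) n w + phi))) @ \oo -->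
    expR (- (Ex Q (fun x => f x ^+ 2) / 2)) * cos phi.
Proof.
have [mf if2] := f2.
apply: (@martingale_clt _ _ _ P (along f) _
  (fun m => Ex Q (fun x => `|m%:R^-1 * bsum tau (fun x => f x ^+ 2) m x - Ex Q (fun x => f x ^+ 2)|))) => //.
- by move=> i; exact: L2_along.
- by move=> t m g mg ig; exact: psum_along_stationary.
- by apply: Ex_ge0 => x; exact: sqr_ge0.
- exact: mean_ergodic.
- by move=> t m _; rewrite -(along_ergodic t m if2).
Qed.

Lemma psum_along_L2 n : L2 P (psum (along f) n).
Proof. by apply: L2_sum => i _; exact: L2_along. Qed.

Lemma psum_along_sqr n : Ex P (fun w => psum (along f) n w ^+ 2) = n%:R * Ex Q (fun x => f x ^+ 2).
Proof.
have [mf if2] := f2.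
elim: n => [|n IH].
  rewrite mul0r -[RHS](Ex_cst P 0); apply: eq_Ex => w; by rewrite /psum big_ord0 expr2 mulr0.
have Lx i := L2_along i f2.
have Ln := psum_along_L2 n.
have cross : Ex P (fun w => along f n w * psum (along f) n w) = 0.
  transitivity (Ex P (fun w => \sum_(i < n) along f n w * along f i w)).
    by apply: eq_Ex => w; rewrite /psum mulr_sumr.
  rewrite Ex_sum => [|i _]; last exact: L2M.
  rewrite big1// => i _.
  (* With zero frequency and phase the cosine is 1, so [orth2] is plain orthogonality of the
     increments. *)
  have := @orth2 0 i n 0 0; rewrite ltn_ord => /(_ isT) <-.
  by apply: eq_Ex => w; rewrite mul0r add0r cos0 mulr1.
transitivity (Ex P (fun w => psum (along f) n w ^+ 2 + 2 * (along f n w * psum (along f) n w) + along f n w ^+ 2)).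
  by apply: eq_Ex => w; rewrite /psum big_ord_recr/=; ring.
rewrite ExD; [|by apply: itgD; [case: Ln|apply: itgZ; exact: L2M]|by case: (Lx n)].
rewrite ExD; [|by case: Ln|by apply: itgZ; exact: L2M].
rewrite ExZ; last exact: L2M.
rewrite cross mulr0 addr0 IH.
have -> : Ex P (fun w => along f n w ^+ 2) = Ex Q (fun x => f x ^+ 2) by exact: (Ex_along n if2).
by rewrite -natr1 mulrDl mul1r.
Qed.

End stationary_sequence.

(** * The criterion as an exact quadratic polynomial *)

Section score_and_gram.
Context {R : realType} {Omega : Type} (J q s : nat) (K : bool -> bool -> R).
Variables (Y : int -> Omega -> itv R) (X : 'I_J -> int -> Omega -> itv R).
Variable th0 : 'rV[R]_(pdim q J s).

(** The summation index is one less than the time, matching the times 1 to [n] of [dk_obj]. *)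
Definition score_sum (n : nat) (w : Omega) : 'rV[R]_(pdim q J s) :=
  \row_i \sum_(t < n) kip K (Zvec q J s Y X (t.+1)%:Z w i) (resid q J s Y X th0 (t.+1)%:Z w).

Definition gram_sum (n : nat) (w : Omega) : 'M[R]_(pdim q J s) :=
  \matrix_(i, j) \sum_(t < n) kip K (Zvec q J s Y X (t.+1)%:Z w i) (Zvec q J s Y X (t.+1)%:Z w j).

Hypothesis Kspd : spd_kernel K.

Lemma gram_sum_sym n w : (gram_sum n w)^T = gram_sum n w.
Proof. by apply/matrixP => i j; rewrite !mxE; apply: eq_bigr => t _; rewrite kipC. Qed.

Lemma resid_isub th t w : resid q J s Y X th t w =
  isub (resid q J s Y X th0 t w) (ilincomb (Zvec q J s Y X t w) (th - th0)).
Proof.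
rewrite /resid /isub /ilincomb /=; congr (_, _); rewrite -addrA -opprD -big_split/=;
  by congr (_ - _); apply: eq_bigr => j _; rewrite !mxE; ring.
Qed.

Lemma dk_obj_expand n w th : dk_obj K q J s Y X n w th = dk_obj K q J s Y X n w th0 -
  2 * dotp (score_sum n w) (th - th0) +
  ((th - th0) *m gram_sum n w *m (th - th0)^T) ord0 ord0.
Proof.
pose de := th - th0; rewrite -/de.
have step t : knorm2 K (resid q J s Y X th t w) = knorm2 K (resid q J s Y X th0 t w) -
    2 * (\sum_i de ord0 i * kip K (Zvec q J s Y X t w i) (resid q J s Y X th0 t w)) +
    \sum_i \sum_j de ord0 i * (de ord0 j * kip K (Zvec q J s Y X t w i) (Zvec q J s Y X t w j)).
  rewrite resid_isub knorm2_isub// kip_ilincombl; congr (_ + _).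
  rewrite /knorm2 kip_ilincombl; apply: eq_bigr => i _.
  rewrite kipC// kip_ilincombl mulr_sumr; apply: eq_bigr => j _.
  by rewrite (kipC Kspd (Zvec q J s Y X t w j)).
rewrite /dk_obj !big_add1 /= !big_mkord.
rewrite (eq_bigr _ (fun (t : 'I_n) _ => step (t.+1)%:Z)) big_split sumrB /=.
congr (_ - _ + _).
  rewrite -mulr_sumr dotpE; congr (2 * _); rewrite exchange_big/=.
  by apply: eq_bigr => i _; rewrite !mxE -mulr_sumr mulrC.
rewrite exchange_big /= mxE.
under [RHS]eq_bigr => j _ do rewrite !mxE mulr_suml.
rewrite [RHS]exchange_big/=; apply: eq_bigr => i _.
rewrite exchange_big/=; apply: eq_bigr => j _.
by rewrite !mxE -!mulr_sumr mulrA mulrAC.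
Qed.

End score_and_gram.

(** * Limits of the score and of the Gram matrix *)

Section interval_model.
Context {R : realType} {d : measure_display} {Omega : measurableType d}.
Variables (P : probability Omega R) (J q s : nat) (K : bool -> bool -> R).
Variables (Y : int -> Omega -> itv R) (X : 'I_J -> int -> Omega -> itv R).
Variable th0 : 'rV[R]_(pdim q J s).
Hypothesis Kspd : spd_kernel K.
Hypothesis mV : forall t c, measurable_fun setT (joint_coords Y X t c).
Hypothesis sV : strictly_stationary P (joint_coords Y X).
Hypothesis eV : ergodic P (joint_coords Y X).
Hypothesis Y4 : forall t, ('E_P[fun w => (knorm2 K (Y t w) ^+ 2)%R] < +oo)%E.
Hypothesis X4 : forall j t, ('E_P[fun w => (knorm2 K (X j t w) ^+ 2)%R] < +oo)%E.
Hypothesis cu : forall t,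
  cond_exp_const P (info_set Y X t) (fun w => (resid q J s Y X th0 t w).1) 0 /\
  cond_exp_const P (info_set Y X t) (fun w => (resid q J s Y X th0 t w).2) 0.

Local Notation p := (pdim q J s).
Local Notation paths := (@pathT R (option 'I_J * bool)).
Local Notation shift := (@path_shift R (option 'I_J * bool)).
Local Notation Z := (Zvec q J s Y X).
Local Notation u := (resid q J s Y X th0).

(** Canonical copies of the processes on path space: [Zp] and [up] at time 0, read on the path
    shifted n times, are the regressors and the innovation at time n. *)
Let Yp (t : int) (x : paths) : itv R := (x t (None, false), x t (None, true)).
Let Xp (j : 'I_J) (t : int) (x : paths) : itv R := (x t (Some j, false), x t (Some j, true)).
Let V (w : Omega) : paths := path_of (joint_coords Y X) w.
Let Zp := Zvec q J s Yp Xp.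
Let up := resid q J s Yp Xp th0.

Lemma Zvec_ext {T1 T2 : Type} (Y1 : int -> T1 -> itv R) (X1 : 'I_J -> int -> T1 -> itv R)
    (Y2 : int -> T2 -> itv R) (X2 : 'I_J -> int -> T2 -> itv R) (t1 t2 : int) w1 w2 :
  (forall i : nat, Y1 (t1 - i%:Z) w1 = Y2 (t2 - i%:Z) w2) ->
  (forall j (i : nat), X1 j (t1 - i%:Z) w1 = X2 j (t2 - i%:Z) w2) ->
  Zvec q J s Y1 X1 t1 w1 = Zvec q J s Y2 X2 t2 w2.
Proof.
move=> hY hX; apply/funext => j.
have [k [_ hk]] := @Zvec_regressor R q J s j; rewrite !hk.
by case: k {hk} => [//|[i|[j' l]]] /=.
Qed.

Lemma resid_ext {T1 T2 : Type} (Y1 : int -> T1 -> itv R) (X1 : 'I_J -> int -> T1 -> itv R)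
    (Y2 : int -> T2 -> itv R) (X2 : 'I_J -> int -> T2 -> itv R) (t1 t2 : int) w1 w2 :
  (forall i : nat, Y1 (t1 - i%:Z) w1 = Y2 (t2 - i%:Z) w2) ->
  (forall j (i : nat), X1 j (t1 - i%:Z) w1 = X2 j (t2 - i%:Z) w2) ->
  resid q J s Y1 X1 th0 t1 w1 = resid q J s Y2 X2 th0 t2 w2.
Proof.
move=> hY hX; rewrite /resid (Zvec_ext hY hX).
by have := hY 0%N; rewrite !subr0 => ->.
Qed.

Let Yp_shift n t w : Yp t (iter n shift (V w)) = Y (t + n%:Z) w.
Proof. by rewrite /Yp !iter_path_shift /V /path_of /joint_coords/= -surjective_pairing. Qed.

Let Xp_shift j n t w : Xp j t (iter n shift (V w)) = X j (t + n%:Z) w.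
Proof. by rewrite /Xp !iter_path_shift /V /path_of /joint_coords/= -surjective_pairing. Qed.

Let Zp_shift n w : Zp 0 (iter n shift (V w)) = Z n%:Z w.
Proof. by apply: Zvec_ext => [i|j i]; rewrite ?Yp_shift ?Xp_shift sub0r addrC. Qed.

Let up_shift n w : up 0 (iter n shift (V w)) = u n%:Z w.
Proof. by apply: resid_ext => [i|j i]; rewrite ?Yp_shift ?Xp_shift sub0r addrC. Qed.

Let b i (x : paths) := kip K (Zp 0 x i) (up 0 x).
Let a i j (x : paths) := kip K (Zp 0 x i) (Zp 0 x j).
(** One initial shift, because the sample starts at time 1. *)
Let Vs (w : Omega) : paths := shift (V w).

Let b_along i t w : along Vs shift (b i) t w = kip K (Z (t.+1)%:Z w i) (u (t.+1)%:Z w).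
Proof. by rewrite /along /b /Vs -iterSr Zp_shift up_shift. Qed.

Let a_along i j t w : along Vs shift (a i j) t w = kip K (Z (t.+1)%:Z w i) (Z (t.+1)%:Z w j).
Proof. by rewrite /along /a /Vs -iterSr Zp_shift. Qed.

Let mY t : measurable_fun setT (fun w => (Y t w).1) /\ measurable_fun setT (fun w => (Y t w).2).
Proof. by split; [exact: (mV t (None, false))|exact: (mV t (None, true))]. Qed.

Let mX j t : measurable_fun setT (fun w => (X j t w).1) /\ measurable_fun setT (fun w => (X j t w).2).
Proof. by split; [exact: (mV t (Some j, false))|exact: (mV t (Some j, true))]. Qed.

Let iL4Y t : iL4 P (Y t).
Proof. by have [? ?] := mY t; exact: knorm2_iL4 (Y4 t). Qed.

Let iL4X j t : iL4 P (X j t).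
Proof. by have [? ?] := mX j t; exact: knorm2_iL4 (X4 j t). Qed.

Let iL4Z t j : iL4 P (fun w => Z t w j).
Proof.
have [k [_ hk]] := @Zvec_regressor R q J s j.
rewrite (_ : (fun w => _) = fun w => regressor Y X t w k); last by apply/funext => w; rewrite hk.
case: k {hk} => [c|[i|[j' l]]] //=; split; exact: L4_cst.
Qed.

Let iL4u t : iL4 P (u t).
Proof. by apply: iL4_isub => //; exact: iL4_ilincomb. Qed.

(** The generators of [info_set], named so that its sigma-algebra becomes the measurable type
    [GT t]. *)
Let gen (t : int) := [set A : set Omega | exists (r : int) (c : option 'I_J * bool) (B : set R),
  measurable B /\ (if c.1 is None then r <= t - 1 else r <= t) /\
  A = (joint_coords Y X r c) @^-1` B].
Let GT t := g_sigma_algebraType (gen t).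

Let gen_measurable t : gen t `<=` measurable.
Proof.
by move=> _ [r [c [B [mB [_ ->]]]]]; rewrite -[X in measurable X]setTI; exact: mV.
Qed.

Let GT_coord t (r : int) c : (if c.1 is None then r <= t - 1 else r <= t) ->
  measurable_fun setT (joint_coords Y X r c : GT t -> R).
Proof.
move=> h _ B mB; rewrite setTI; apply: sub_sigma_algebra.
exists r, c, B; split; first exact: mB.
by split=> //; case: c h => [[j'|] b'].
Qed.

Let GT_Y (t r : int) : r <= t - 1 -> measurable_fun setT (fun w : GT t => (Y r w).1) /\
  measurable_fun setT (fun w : GT t => (Y r w).2).
Proof. by move=> h; split; [exact: (@GT_coord t r (None, false))|exact: (@GT_coord t r (None, true))]. Qed.

Let GT_X (t : int) j (r : int) : r <= t -> measurable_fun setT (fun w : GT t => (X j r w).1) /\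
  measurable_fun setT (fun w : GT t => (X j r w).2).
Proof. by move=> h; split; [exact: (@GT_coord t r (Some j, false))|exact: (@GT_coord t r (Some j, true))]. Qed.

Let GT_Z (t r : int) j : r <= t -> measurable_fun setT (fun w : GT t => (Z r w j).1) /\
  measurable_fun setT (fun w : GT t => (Z r w j).2).
Proof.
move=> rt; have [k [hp hk]] := @Zvec_regressor R q J s j.
rewrite (_ : (fun w => (Z r w j).1) = fun w => (regressor Y X r w k).1); last first.
  by apply/funext => w; rewrite hk.
rewrite (_ : (fun w => (Z r w j).2) = fun w => (regressor Y X r w k).2); last first.
  by apply/funext => w; rewrite hk.
case: k hp {hk} => [c _|[i|[j' l]]] //=.
- by move=> i0; apply: GT_Y; apply: lerB => //; rewrite lez_nat.
- by move=> _; apply: GT_X; rewrite lerBlDr (le_trans rt)// lerDl.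
Qed.

Let GT_u (t r : int) : r <= t - 1 -> measurable_fun setT (fun w : GT t => (u r w).1) /\
  measurable_fun setT (fun w : GT t => (u r w).2).
Proof.
move=> rt; have rt' : r <= t by rewrite (le_trans rt)// gerBl.
have [mY1 mY2] := GT_Y rt.
split; apply: measurable_funB => //; apply: measurable_sum => j; apply: measurable_funM => //;
  by have [] := GT_Z j rt'.
Qed.

Let GT_score (t r : int) i : r <= t - 1 -> measurable_fun setT (fun w : GT t => kip K (Z r w i) (u r w)).
Proof.
move=> rt; have rt' : r <= t by rewrite (le_trans rt)// gerBl.
have [? ?] := GT_Z i rt'; have [? ?] := GT_u rt.
exact: measurable_kip.
Qed.

(** The kernel product is linear in the two endpoints of the innovation, with coefficients [h1] and
    [h2] formed from predetermined regressors; each endpoint is orthogonal to the past. *)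
Let score_orth (t : int) i (H : Omega -> R) : measurable_fun setT (H : GT t -> R) -> L2 P H ->
  Ex P (fun w => kip K (Z t w i) (u t w) * H w) = 0.
Proof.
move=> mH H2; have [m1 m2] := GT_Z i (lexx t).
have [z1 z2] := iL4Z t i; have [u1 u2] := iL4u t; have [c1 c2] := cu t.
pose h1 w := K false false * (Z t w i).1 - K true false * (Z t w i).2.
pose h2 w := K true true * (Z t w i).2 - K false true * (Z t w i).1.
have h14 : L4 P h1 by apply: L4B; exact: L4Z.
have h24 : L4 P h2 by apply: L4B; exact: L4Z.
have mh1 : measurable_fun setT (h1 : GT t -> R).
  by apply: measurable_funB; exact: measurable_funM.
have mh2 : measurable_fun setT (h2 : GT t -> R).
  by apply: measurable_funB; exact: measurable_funM.
have i1 : itg P (fun w => (u t w).1 * (h1 w * H w)).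
  by apply: eq_itg (L2M (L4M u1 h14) H2) => w; rewrite mulrA.
have i2 : itg P (fun w => (u t w).2 * (h2 w * H w)).
  by apply: eq_itg (L2M (L4M u2 h24) H2) => w; rewrite mulrA.
transitivity (Ex P (fun w => (u t w).1 * (h1 w * H w) + (u t w).2 * (h2 w * H w))).
  by apply: eq_Ex => w; rewrite kipE /h1 /h2; ring.
rewrite ExD//.
rewrite (cond_exp0_orth (gen_measurable (t := t)) c1 (measurable_funM mh1 mH) i1).
by rewrite (cond_exp0_orth (gen_measurable (t := t)) c2 (measurable_funM mh2 mH) i2) addr0.
Qed.


Let C := \matrix_(i, j) Ex P (fun w => kip K (Z 0%:Z w i) (Z 0%:Z w j)).
Let M := \matrix_(i, j) Ex P (fun w => kip K (Z 0%:Z w i) (u 0%:Z w) * kip K (u 0%:Z w) (Z 0%:Z w j)).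

Section path_law.
Variable Q : probability paths R.
Hypothesis PQ : mpres P Q (path_of (joint_coords Y X) : Omega -> paths).

Let QQ : mpres Q Q (shift : paths -> paths).
Proof. exact: (stationary_shift PQ sV). Qed.

Let PVs : mpres P Q Vs.
Proof. exact: mpres_comp PQ QQ. Qed.

Let Q_erg (A : set paths) : measurable A -> A = shift @^-1` A -> Q A = 0%E \/ Q A = 1%E.
Proof. exact: (ergodic_shift PQ eV). Qed.

Let mYp t : measurable_fun setT (fun x => (Yp t x).1) /\ measurable_fun setT (fun x => (Yp t x).2).
Proof. by split; exact: measurable_coord. Qed.

Let mXp j t : measurable_fun setT (fun x => (Xp j t x).1) /\ measurable_fun setT (fun x => (Xp j t x).2).
Proof. by split; exact: measurable_coord. Qed.

Let mZp t j : measurable_fun setT (fun x => (Zp t x j).1) /\ measurable_fun setT (fun x => (Zp t x j).2).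
Proof.
have [k [_ hk]] := @Zvec_regressor R q J s j.
rewrite (_ : (fun x => (Zp t x j).1) = fun x => (regressor Yp Xp t x k).1); last first.
  by apply/funext => x; rewrite /Zp hk.
rewrite (_ : (fun x => (Zp t x j).2) = fun x => (regressor Yp Xp t x k).2); last first.
  by apply/funext => x; rewrite /Zp hk.
by case: k {hk} => [c|[i|[j' l]]] //=; [exact: mYp|exact: mXp].
Qed.

Let mup t : measurable_fun setT (fun x => (up t x).1) /\ measurable_fun setT (fun x => (up t x).2).
Proof.
have [mY1 mY2] := mYp t.
by split; apply: measurable_funB => //; apply: measurable_sum => j; apply: measurable_funM => //;
  have [] := mZp t j.
Qed.

Let path_iL4 (A : paths -> itv R) : measurable_fun setT (fun x => (A x).1) ->
  measurable_fun setT (fun x => (A x).2) -> iL4 P (A \o V) -> iL4 Q A.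
Proof. by move=> m1 m2 [h1 h2]; split; apply: (mpres_L4V PQ). Qed.

Let iL4Zp j : iL4 Q (fun x => Zp 0 x j).
Proof.
have [? ?] := mZp 0 j; apply: path_iL4 => //.
rewrite (_ : _ \o V = fun w => Z 0%:Z w j); first exact: iL4Z.
by apply/funext => w; rewrite /= -(Zp_shift 0).
Qed.

Let iL4up : iL4 Q (up 0).
Proof.
have [? ?] := mup 0; apply: path_iL4 => //.
rewrite (_ : _ \o V = u 0%:Z); first exact: iL4u.
by apply/funext => w; rewrite /= -(up_shift 0).
Qed.

Let b2 i : L2 Q (b i).
Proof. exact: kip_L2. Qed.

Let a2 i j : L2 Q (a i j).
Proof. exact: kip_L2. Qed.

Let score i (n : nat) w := kip K (Z (n.+1)%:Z w i) (u (n.+1)%:Z w).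

Let score_L2 i n : L2 P (score i n).
Proof. exact: kip_L2. Qed.

Let C_path i j : C i j = Ex Q (a i j).
Proof.
rewrite mxE -(mpres_Ex PQ (L2_itg (a2 i j))); apply: eq_Ex => w.
by rewrite /a /= -/(V w) (Zp_shift 0).
Qed.

Let M_path i j : M i j = Ex Q (fun x => b i x * b j x).
Proof.
rewrite mxE -(mpres_Ex PQ (L2M (b2 i) (b2 j))); apply: eq_Ex => w.
by rewrite /b /= -/(V w) (Zp_shift 0) (up_shift 0) (kipC Kspd (u 0%:Z w)).
Qed.

Let score_psum n w i : score_sum K Y X th0 n w ord0 i = psum (along Vs shift (b i)) n w.
Proof. by rewrite mxE; apply: eq_bigr => t _; rewrite b_along. Qed.

Let gram_psum n w i j : gram_sum q s K Y X n w i j = psum (along Vs shift (a i j)) n w.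
Proof. by rewrite mxE; apply: eq_bigr => t _; rewrite a_along. Qed.

Section linear_combination.
Variable al : 'rV[R]_p.
(** The Cramer-Wold reduction: for a fixed direction [al] the score becomes a scalar martingale
    difference. *)
Let f x := \sum_i al ord0 i * b i x.

Let f_along t w : along Vs shift f t w = \sum_i al ord0 i * score i t w.
Proof. by apply: eq_bigr => i _; rewrite -[b i _]/(along Vs shift (b i) t w) b_along. Qed.

Let f2 : L2 Q f.
Proof. by apply: L2_sum => i _; exact: L2Z. Qed.

Let past_measurable r t : (r < t)%N ->
  measurable_fun setT (along Vs shift f r : GT (t.+1)%:Z -> R).
Proof.
move=> rt; rewrite (_ : along Vs shift f r = fun w => \sum_i al ord0 i * score i r w).
  apply: measurable_sum => i; apply: measurable_funM => //; apply: GT_score.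
  (* Index [r] is time r + 1, which is at most t = (t + 1) - 1 as r < t. *)
  by rewrite [leRHS](_ : _ = t%:Z) ?lez_nat// intS addrC addKr.
by apply/funext => w; rewrite f_along.
Qed.

Let comb_orth t (H : Omega -> R) : measurable_fun setT (H : GT (t.+1)%:Z -> R) -> L2 P H ->
  Ex P (fun w => along Vs shift f t w * H w) = 0.
Proof.
move=> mH H2.
transitivity (Ex P (fun w => \sum_i al ord0 i * (score i t w * H w))).
  by apply: eq_Ex => w; rewrite f_along mulr_suml; apply: eq_bigr => i _; rewrite mulrA.
rewrite Ex_sum => [|i _]; last by apply: itgZ; exact: L2M.
rewrite big1// => i _; rewrite ExZ; last exact: L2M.
by rewrite score_orth// mulr0.
Qed.

Let cos_past r t c phi : (r <= t)%N ->
  measurable_fun setT ((fun w => cos (c * psum (along Vs shift f) r w + phi)) : GT (t.+1)%:Z -> R).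
Proof.
move=> rt; apply: measurable_cosD; apply: measurable_funM => //; apply: measurable_sum => i.
by apply: past_measurable; exact: leq_trans (ltn_ord i) rt.
Qed.

Let cos_L2 r c phi : L2 P (fun w => cos (c * psum (along Vs shift f) r w + phi)).
Proof.
apply: (@L2_bounded _ _ _ _ _ 1) => [|w]; last by rewrite ler_norml cos_geN1 cos_le1.
exact: (measurable_sub_sigma (@gen_measurable _) (cos_past c phi (leqnn r))).
Qed.

Let comb_orth1 r t c phi : (r <= t)%N ->
  Ex P (fun w => along Vs shift f t w * cos (c * psum (along Vs shift f) r w + phi)) = 0.
Proof. by move=> rt; apply: comb_orth => //; exact: cos_past. Qed.

Let comb_orth2 r t' t c phi : (r <= t' < t)%N ->
  Ex P (fun w => along Vs shift f t w * (along Vs shift f t' w * cos (c * psum (along Vs shift f) r w + phi))) = 0.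
Proof.
move=> /andP[rt tt]; have mc := cos_past c phi (leq_trans rt (ltnW tt)).
apply: comb_orth; first by apply: measurable_funM => //; exact: past_measurable.
have [mf if2] := L2_along PVs QQ t' f2.
have [mc' _] := cos_L2 r c phi.
split; first exact: measurable_funM.
have := itgMb if2 (measurable_funX 2 mc') (c := 1); move=> h.
apply: eq_itg (h _) => w; first by rewrite exprMn.
by rewrite ger0_norm ?sqr_ge0// -(expr1n _ 2) ler_sqr ?ler_norml ?cos_geN1 ?cos_le1.
Qed.

Let f_sqr : Ex Q (fun x => f x ^+ 2) = (al *m M *m al^T) ord0 ord0.
Proof.
rewrite mxE.
transitivity (Ex Q (fun x => \sum_j \sum_i (al ord0 i * al ord0 j) * (b i x * b j x))).
  apply: eq_Ex => x; rewrite expr2 mulr_sumr; apply: eq_bigr => j _.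
  by rewrite mulr_suml; apply: eq_bigr => i _; ring.
rewrite Ex_sum => [|j _]; last by apply: itg_sum => i _; apply: itgZ; exact: L2M.
apply: eq_bigr => j _; rewrite Ex_sum => [|i _]; last by apply: itgZ; exact: L2M.
rewrite !mxE mulr_suml; apply: eq_bigr => i _.
by rewrite ExZ; [rewrite M_path; ring|exact: L2M].
Qed.

Let psum_comb n w : psum (along Vs shift f) n w = dotp (score_sum K Y X th0 n w) al.
Proof.
rewrite dotpE /psum; under eq_bigr => t _ do rewrite f_along.
rewrite exchange_big/=; apply: eq_bigr => i _.
by rewrite !mxE mulr_suml; apply: eq_bigr => t _; rewrite mulrC.
Qed.

Lemma score_comb_clt phi :
  (fun n => Ex P (fun w => cos ((Num.sqrt n%:R)^-1 * dotp (score_sum K Y X th0 n w) al + phi)))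
    @ \oo --> expR (- ((al *m M *m al^T) ord0 ord0) / 2) * cos phi.
Proof.
have := along_clt PVs QQ Q_erg f2 comb_orth1 comb_orth2 (phi := phi).
rewrite f_sqr mulNr.
by under eq_cvg => n do under eq_Ex => w do rewrite psum_comb.
Qed.

Lemma score_comb_sqr n : Ex P (fun w => dotp (score_sum K Y X th0 n w) al ^+ 2) =
  n%:R * (al *m M *m al^T) ord0 ord0.
Proof.
rewrite -f_sqr -(psum_along_sqr PVs QQ f2 comb_orth2).
by apply: eq_Ex => w; rewrite psum_comb.
Qed.

End linear_combination.

Lemma path_limits :
  [/\ forall n i j, itg P (fun w => gram_sum q s K Y X n w i j),
      forall i j, (fun n => Ex P (fun w => `|n%:R^-1 * gram_sum q s K Y X n w i j - C i j|))
        @ \oo --> 0,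
      forall n i, L2 P (fun w => score_sum K Y X th0 n w ord0 i),
      forall n al, Ex P (fun w => dotp (score_sum K Y X th0 n w) al ^+ 2) =
        n%:R * (al *m M *m al^T) ord0 ord0 &
      forall al phi, (fun n => Ex P (fun w =>
          cos ((Num.sqrt n%:R)^-1 * dotp (score_sum K Y X th0 n w) al + phi)))
        @ \oo --> expR (- ((al *m M *m al^T) ord0 ord0) / 2) * cos phi].
Proof.
split.
- move=> n i j; rewrite (_ : (fun w => _) = psum (along Vs shift (a i j)) n).
    by apply: itg_sum => t _; exact: (itg_along PVs QQ t (L2_itg (a2 i j))).
  by apply/funext => w; exact: gram_psum.
- move=> i j; rewrite C_path.
  have := along_mean_ergodic PVs QQ Q_erg (L2_itg (a2 i j)).
  rewrite (_ : (fun n => _) = (fun n => Ex P (fun w => `|n%:R^-1 * gram_sum q s K Y X n w i j - Ex Q (a i j)|)))//.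
  by apply/funext => n; apply: eq_Ex => w; rewrite gram_psum.
- move=> n i; apply: eq_L2 (psum_along_L2 PVs QQ (b2 i) n) => w; by rewrite score_psum.
- by move=> n al; exact: score_comb_sqr.
- by move=> al phi; exact: score_comb_clt.
Qed.

End path_law.

Lemma model_limits :
  [/\ forall n i j, itg P (fun w => gram_sum q s K Y X n w i j),
      forall i j, (fun n => Ex P (fun w => `|n%:R^-1 * gram_sum q s K Y X n w i j - C i j|))
        @ \oo --> 0,
      forall n i, L2 P (fun w => score_sum K Y X th0 n w ord0 i),
      forall n al, Ex P (fun w => dotp (score_sum K Y X th0 n w) al ^+ 2) =
        n%:R * (al *m M *m al^T) ord0 ord0 &
      forall al phi, (fun n => Ex P (fun w =>
          cos ((Num.sqrt n%:R)^-1 * dotp (score_sum K Y X th0 n w) al + phi)))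
        @ \oo --> expR (- ((al *m M *m al^T) ord0 ord0) / 2) * cos phi].
Proof. by have [Q PQ] := path_law_exists P mV; exact: path_limits PQ. Qed.

End interval_model.

(** * Adaptive lasso for a quadratic criterion *)

Section quadratic_forms.
Context {R : realType}.

Definition qf {p} (B : 'M[R]_p) (z : 'rV[R]_p) : R := (z *m B *m z^T) ord0 ord0.
Definition nsq {p} (z : 'rV[R]_p) : R := dotp z z.

Lemma nsqE p (z : 'rV[R]_p) : nsq z = \sum_i z ord0 i ^+ 2.
Proof. by rewrite /nsq dotpE; apply: eq_bigr => i _; rewrite expr2. Qed.

Lemma nsq_ge0 p (z : 'rV[R]_p) : 0 <= nsq z.
Proof. by rewrite nsqE sumr_ge0// => i _; exact: sqr_ge0. Qed.

Lemma coord_nsq p (z : 'rV[R]_p) i : z ord0 i ^+ 2 <= nsq z.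
Proof. by rewrite nsqE (bigD1 i)//= lerDl sumr_ge0// => j _; exact: sqr_ge0. Qed.

Lemma qfE p (B : 'M[R]_p) z : qf B z = \sum_i \sum_j z ord0 i * z ord0 j * B i j.
Proof.
rewrite /qf mxE; under eq_bigr => j _ do rewrite !mxE mulr_suml.
by rewrite exchange_big/=; apply: eq_bigr => i _; apply: eq_bigr => j _; rewrite mulrAC.
Qed.

Lemma dotpC p (x z : 'rV[R]_p) : dotp x z = dotp z x.
Proof. by rewrite !dotpE; apply: eq_bigr => i _; rewrite mulrC. Qed.

Lemma dotpZr p (x z : 'rV[R]_p) r : dotp x (r *: z) = r * dotp x z.
Proof. by rewrite !dotpE mulr_sumr; apply: eq_bigr => i _; rewrite mxE; ring. Qed.

Lemma dotpZl p (x z : 'rV[R]_p) r : dotp (r *: x) z = r * dotp x z.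
Proof. by rewrite dotpC dotpZr dotpC. Qed.

Lemma qf_scaler p (B : 'M[R]_p) r z : qf B (r *: z) = r ^+ 2 * qf B z.
Proof.
rewrite !qfE mulr_sumr; apply: eq_bigr => i _; rewrite mulr_sumr; apply: eq_bigr => j _.
by rewrite !mxE; ring.
Qed.

Lemma qf_scalel p (B : 'M[R]_p) r z : qf (r *: B) z = r * qf B z.
Proof.
rewrite !qfE mulr_sumr; apply: eq_bigr => i _; rewrite mulr_sumr; apply: eq_bigr => j _.
by rewrite !mxE; ring.
Qed.

Lemma dotpBl p (x z u : 'rV[R]_p) : dotp (x - z) u = dotp x u - dotp z u.
Proof. by rewrite dotpC dotpBr !(dotpC u). Qed.

Lemma dotp_young p (x z : 'rV[R]_p) c : 0 < c -> 2 * dotp x z <= c * nsq z + c^-1 * nsq x.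
Proof.
move=> c0; rewrite dotpE !nsqE !mulr_sumr -big_split/=; apply: ler_sum => i _.
have := sqr_ge0 (c * z ord0 i - x ord0 i); rewrite sqrrB => h.
rewrite -(ler_pM2l c0) mulrDr !mulrA divff ?gt_eqF// mul1r.
by rewrite !expr2 in h *; nra.
Qed.

Lemma qf_small p (D : 'M[R]_p) eta z : (forall i j, `|D i j| <= eta) ->
  `|qf D z| <= eta * p%:R * nsq z.
Proof.
move=> hD; rewrite qfE (le_trans (ler_norm_sum _ _ _))//.
apply: (@le_trans _ _ (\sum_i \sum_j eta * ((z ord0 i ^+ 2 + z ord0 j ^+ 2) / 2))).
  apply: ler_sum => i _; rewrite (le_trans (ler_norm_sum _ _ _))//.
  apply: ler_sum => j _; rewrite normrM mulrC; apply: ler_pM => //.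
  have := sqr_ge0 (`|z ord0 i| - `|z ord0 j|).
  by rewrite sqrrB !real_normK ?num_real// normrM; lra.
under eq_bigr => i _ do rewrite -mulr_sumr -mulr_suml big_split/= sumr_const card_ord -nsqE.
rewrite -mulr_sumr -mulr_suml big_split/= sumr_const card_ord sumrMnl -nsqE.
by rewrite -mulrA mulr_natl; lra.
Qed.

Lemma qfD p (B D : 'M[R]_p) z : qf (B + D) z = qf B z + qf D z.
Proof. by rewrite /qf mulmxDr mulmxDl mxE. Qed.

Lemma posdef_unitmx p (C : 'M[R]_p) : posdef C -> C \in unitmx.
Proof.
move=> [_ Cp]; rewrite -row_free_unit -kermx_eq0; apply/eqP/row_matrixP => i; rewrite row0.
apply/eqP/negPn/negP => /Cp.
by rewrite (_ : _ *m C = 0) ?mul0mx ?mxE ?ltxx// -row_mul mulmx_ker row0.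
Qed.

Lemma entry_le p k (D : 'M[R]_(p, k)) : exists2 K, 0 <= K & forall i j, `|D i j| <= K.
Proof.
exists (\sum_i \sum_j `|D i j|) => [|i j]; first by apply: sumr_ge0 => i _; exact: sumr_ge0.
rewrite (bigD1 i)//= (bigD1 j)//= -addrA lerDl addr_ge0//; first exact: sumr_ge0.
by apply: sumr_ge0 => i' _; exact: sumr_ge0.
Qed.

Lemma nsq_mulmx_le p k (B : 'M[R]_(p, k)) : exists2 c, 0 <= c & forall y, nsq (y *m B) <= c * nsq y.
Proof.
pose D := B *m B^T; have [eta eta0 hD] := entry_le D.
exists (eta * p%:R) => [|y]; first by rewrite mulr_ge0.
have -> : nsq (y *m B) = qf D y by rewrite /nsq /dotp trmx_mul mulmxA /qf /D !mulmxA.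
exact: le_trans (ler_norm _) (qf_small _ hD).
Qed.

(** By the factorization of [C] the form is |z A^T|^2, and [z] is recovered by the bounded map
    [invmx A^T]; adding 1 to its bound makes the constant invertible. *)
Lemma posdef_coercive p (C : 'M[R]_p) : posdef C ->
  exists2 c, 0 < c & forall z, c * nsq z <= qf C z.
Proof.
move=> Cp; have [A AC] := posdef_cholesky Cp.
have Au : A^T \in unitmx.
  by have := posdef_unitmx Cp; rewrite -AC unitmx_mul => /andP[].
have [c c0 hc] := nsq_mulmx_le (invmx A^T).
exists (c + 1)^-1 => [|z]; first by rewrite invr_gt0 ltr_wpDl.
rewrite ler_pdivrMl ?ltr_wpDl// mulrDl mul1r.
have -> : qf C z = nsq (z *m A^T) by rewrite /qf /nsq /dotp trmx_mul trmxK -AC !mulmxA.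
have := hc (z *m A^T); rewrite mulmxK// => h; apply: le_trans h _.
by rewrite lerDl nsq_ge0.
Qed.

Lemma qfB p (B : 'M[R]_p) z h : B^T = B ->
  qf B (z - h) = qf B z - 2 * dotp (z *m B) h + qf B h.
Proof.
move=> Bs; have e : (h *m B *m z^T) ord0 ord0 = dotp (z *m B) h.
  rewrite /dotp -[in LHS](trmxK (h *m B *m z^T)) [in LHS]mxE; congr (fun_of_matrix _ _ _).
  by rewrite !trmx_mul trmxK Bs mulmxA.
have ent (F G : 'M[R]_1) : (F - G) ord0 ord0 = F ord0 ord0 - G ord0 ord0 by rewrite !mxE.
by rewrite /qf linearB /= mulmxBr !mulmxBl !ent e -/(dotp (z *m B) h); lra.
Qed.

Lemma dotp_delta p (y : 'rV[R]_p) t j : dotp y (t *: delta_mx 0 j) = t * y ord0 j.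
Proof.
rewrite dotpE (bigD1 j)//= !mxE !eqxx mulr1 big1 ?addr0 1?mulrC// => i ij.
by rewrite !mxE (negbTE ij) andbF !mulr0.
Qed.

Lemma qf_delta p (B : 'M[R]_p) t j : qf B (t *: delta_mx 0 j) = t ^+ 2 * B j j.
Proof.
rewrite /qf -/(dotp _ _) dotp_delta mxE (bigD1 j)//= !mxE !eqxx mulr1 big1 ?addr0 => [|i ij].
  by rewrite mulrA expr2.
by rewrite !mxE (negbTE ij) andbF mulr0 mul0r.
Qed.

(* Completing the square around the minimizer [v] of [z |-> - 2 x.z + z C z']. *)
Lemma qf_minimizer_distance p (C a : 'M[R]_p) x z v eta eps : C^T = C ->
  dotp x z = (v *m C *m z^T) ord0 ord0 -> dotp x v = qf C v ->
  (forall i j, `|(a - C) i j| <= eta) ->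
  - 2 * dotp x z + qf a z <= - 2 * dotp x v + qf a v + eps ->
  qf C (v - z) <= eta * p%:R * (nsq z + nsq v) + eps.
Proof.
move=> Cs xz xv hD h.
have sq : qf C (v - z) = qf C v - 2 * (v *m C *m z^T) ord0 ord0 + qf C z by exact: qfB.
have split_a y : qf a y = qf C y + qf (a - C) y by rewrite -qfD addrC subrK.
have hz := qf_small z hD; have hv := qf_small v hD.
move: h hz hv; rewrite !split_a sq xz xv !ler_norml => h /andP[? ?] /andP[? ?]; lra.
Qed.

(** Of the curvature [c], half pays for a - C, a quarter for the linear term by Young's inequality
    and an eighth for the allowed excess, which leaves room for a penalty; the last eighth bounds
    [z]. *)
Lemma rate_bound p (C a : 'M[R]_p) x z c eta : 0 < c -> (forall y, c * nsq y <= qf C y) ->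
  (forall i j, `|(a - C) i j| <= eta) -> eta * p%:R <= c / 2 ->
  - 2 * dotp x z + qf a z <= c / 8 * (p%:R + nsq z) ->
  nsq z <= 32 / c ^+ 2 * nsq x + p%:R.
Proof.
move=> c0 hc hD he h; have hz := qf_small z hD; have z0 := nsq_ge0 z.
have e1 : eta * p%:R * nsq z <= c / 2 * nsq z by rewrite ler_wpM2r.
have c4 : 0 < c / 4 by rewrite divr_gt0.
have yg := dotp_young x z c4.
have ca := hc z.
have sp : qf a z = qf C z + qf (a - C) z by rewrite -qfD addrC subrK.
move: h hz; rewrite sp ler_norml => h /andP[h1 _].
have key : c / 8 * nsq z <= (c / 4)^-1 * nsq x + c / 8 * p%:R by lra.
have c8 : 0 < c / 8 by rewrite divr_gt0.
rewrite -(ler_pM2l c8) mulrDr; apply: le_trans key _.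
rewrite lerD2r mulrA (_ : c / 8 * (32 / c ^+ 2) = (c / 4)^-1)//.
by field; rewrite gt_eqF.
Qed.

Lemma nsqD_le p (x z : 'rV[R]_p) : nsq (x + z) <= 2 * nsq x + 2 * nsq z.
Proof.
rewrite !nsqE !mulr_sumr -big_split/=; apply: ler_sum => i _; rewrite mxE.
have := sqr_ge0 (x ord0 i - z ord0 i); rewrite sqrrB sqrrD; lra.
Qed.

End quadratic_forms.

Section selection_matrix.
Context {R : realType} {p : nat}.
Variable S : {set 'I_p}.

(** Its rows are the unit vectors indexed by [S]: right multiplication by [sel^T] restricts a row to
    [S], by [sel] extends it by zero. *)
Definition sel : 'M[R]_(#|S|, p) := \matrix_(i, j) (enum_val i == j)%:R.

Lemma mul_trsel (z : 'rV[R]_p) i : (z *m sel^T) ord0 i = z ord0 (enum_val i).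
Proof.
rewrite mxE (bigD1 (enum_val i))//= !mxE eqxx mulr1 big1 ?addr0// => j ji.
by rewrite !mxE eq_sym (negbTE ji) mulr0.
Qed.

Lemma sel_mulT : sel *m sel^T = 1%:M.
Proof.
apply/row_matrixP => i; rewrite row_mul; apply/rowP => j.
by rewrite mul_trsel !mxE (inj_eq enum_val_inj).
Qed.

Lemma submx_on_sel (B : 'M[R]_p) : submx_on S B = sel *m B *m sel^T.
Proof.
apply/row_matrixP => i; apply/rowP => j.
rewrite !row_mul mul_trsel !mxE (bigD1 (enum_val i))//= !mxE eqxx mul1r big1 ?addr0// => j' ji.
by rewrite !mxE eq_sym (negbTE ji) mul0r.
Qed.

Lemma mul_sel_notin (y : 'rV[R]_#|S|) j : j \notin S -> (y *m sel) ord0 j = 0.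
Proof.
move=> jS; rewrite mxE big1// => i _; rewrite mxE.
by case: eqP => [e|]; rewrite ?mulr0//; move: jS; rewrite -e enum_valP.
Qed.

Lemma sel_support (z : 'rV[R]_p) : (forall j, j \notin S -> z ord0 j = 0) ->
  z *m sel^T *m sel = z.
Proof.
move=> hz; apply/rowP => j; have [jS|jS] := boolP (j \in S); last first.
  by rewrite mul_sel_notin// hz.
have [i <-] : exists i : 'I_#|S|, enum_val i = j.
  by exists (enum_rank_in jS j); rewrite enum_rankK_in.
rewrite mxE (bigD1 i)//= mul_trsel mxE eqxx mulr1 big1 ?addr0// => k ki.
by rewrite [sel k _]mxE (inj_eq enum_val_inj) (negbTE ki) mulr0.
Qed.

End selection_matrix.

(** * Minimizing a quadratic criterion over a subspace *)

Section restricted_minimizer.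
Context {R : realType} {p k : nat}.
Variables (C : 'M[R]_p) (E : 'M[R]_(k, p)).
Hypotheses (Cp : posdef C) (EE : E *m E^T = 1%:M).

Lemma posdef_restrict : posdef (E *m C *m E^T).
Proof.
have [Cs C0] := Cp; split; first by rewrite !trmx_mul trmxK Cs mulmxA.
move=> v v0; have := C0 (v *m E); rewrite trmx_mul !mulmxA; apply.
apply: contra_neq v0 => vE; by rewrite -(mulmx1 v) -EE mulmxA vE mul0mx.
Qed.

Let Ci := invmx (E *m C *m E^T).

Let Ci_sym : Ci^T = Ci.
Proof. by rewrite /Ci trmx_inv; have [-> _] := posdef_restrict. Qed.

(* Minimizer of [z |-> - 2 x.z + z C z'] over the row space of [E]. *)
Definition rmin (x : 'rV[R]_p) := x *m E^T *m Ci *m E.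

Lemma rmin_support x : rmin x *m E^T *m E = rmin x.
Proof. by rewrite /rmin -(mulmxA _ E) EE mulmx1. Qed.

(** The normal equations: x - rmin x C is orthogonal to the row space of [E]. *)
Lemma rmin_ortho x z : z *m E^T *m E = z ->
  dotp x z = (rmin x *m C *m z^T) ord0 ord0.
Proof.
move=> zE; rewrite /dotp /rmin -zE !trmx_mul trmxK; congr (fun_of_matrix _ _ _).
rewrite -[RHS]mulmxA; rewrite !mulmxA.
rewrite -(mulmxA (x *m E^T *m Ci)) -(mulmxA (x *m E^T *m Ci)).
by rewrite -(mulmxA (x *m E^T)) mulVmx ?mulmx1// posdef_unitmx//; exact: posdef_restrict.
Qed.

Lemma rmin_qf x : dotp x (rmin x) = qf C (rmin x).
Proof. by rewrite (rmin_ortho x (rmin_support x)). Qed.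

Lemma rmin_bound : exists2 c, 0 <= c & forall x, nsq (rmin x) <= c * nsq x.
Proof.
have [c c0 hc] := nsq_mulmx_le (E^T *m Ci *m E).
by exists c => // x; have := hc x; rewrite !mulmxA.
Qed.

(** Moves the minimizer to the direction, so that the limit law of the score applies to it. *)
Lemma dotp_rmin x u : dotp (rmin x *m E^T) u = dotp x (u *m Ci *m E).
Proof. by rewrite /dotp /rmin -(mulmxA _ E) EE mulmx1 !trmx_mul Ci_sym !mulmxA. Qed.

Lemma qf_sandwich (M : 'M[R]_p) u :
  qf M (u *m Ci *m E) = qf (Ci *m (E *m M *m E^T) *m Ci) u.
Proof. by rewrite /qf !trmx_mul Ci_sym !mulmxA. Qed.

Lemma posdef_sandwich (M : 'M[R]_p) : posdef M -> posdef (Ci *m (E *m M *m E^T) *m Ci).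
Proof.
move=> [Ms M0]; split; first by rewrite !trmx_mul trmxK Ms Ci_sym !mulmxA.
move=> u u0; have := M0 (u *m Ci *m E); rewrite -/(qf M _) qf_sandwich; apply.
have Cu : Ci \in unitmx by rewrite unitmx_inv posdef_unitmx//; exact: posdef_restrict.
apply: contra_neq u0 => uE.
by rewrite -(mulmxK Cu u) -[u *m Ci]mulmx1 -EE !mulmxA uE !mul0mx.
Qed.

End restricted_minimizer.

(** * Events of nearly full probability *)

Section high_probability.
Context {R : realType} {d : measure_display} {T : measurableType d} (P : probability T R).

(* [E n] contains, for all large [n], an event of probability at least [1 - e]. *)
Definition hp (e : R) (E : nat -> T -> Prop) := \forall n \near \oo,
  exists2 B : set T, measurable B /\ Pr P (~` B) <= e & forall w, B w -> E n w.

Lemma hp_sub e (E F : nat -> T -> Prop) : hp e E ->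
  (\forall n \near \oo, forall w, E n w -> F n w) -> hp e F.
Proof.
by move=> hE hF; apply: filterS2 hE hF => n [B mB BE] EF; exists B => // w /BE/EF.
Qed.

Lemma hp_and e1 e2 E F : hp e1 E -> hp e2 F -> hp (e1 + e2) (fun n w => E n w /\ F n w).
Proof.
apply: filterS2 => n [B [mB B1] BE] [C [mC C1] CF].
exists (B `&` C) => [|w [/BE ? /CF ?]//]; split; first exact: measurableI.
rewrite setCI (le_trans (PrU _ _ _)) ?lerD//; exact: measurableC.
Qed.

Lemma hp_forall (I : finType) (E : I -> nat -> T -> Prop) :
  (forall i e, 0 < e -> hp e (E i)) ->
  forall e, 0 < e -> hp e (fun n w => forall i, E i n w).
Proof.
move=> hE e e0.
have h (r : seq I) c : 0 < c -> hp ((size r)%:R * c) (fun n w => forall i, i \in r -> E i n w).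
  move=> c0; elim: r => [|i r IH].
    near=> n; exists setT => //; split => //.
    by rewrite mul0r setCT /Pr measure0.
  rewrite /= -natr1 mulrDl mul1r addrC; apply: hp_sub (hp_and (hE i c c0) IH) _.
  by apply: nearW => n w [h1 h2] j; rewrite inE => /orP[/eqP->|/h2].
have k0 : 0 < (size (enum I)).+1%:R :> R by [].
apply: filterS (h (enum I) _ (divr_gt0 e0 k0)) => n [B [mB PB] hB].
exists B => [|w Bw i]; last by apply: hB => //; rewrite mem_enum.
split => //; apply: le_trans PB _.
by rewrite mulrCA ler_piMr ?(ltW e0)// ler_pdivrMr// mul1r ler_nat.
Unshelve. all: by end_near. Qed.

Lemma hp_markov (f : nat -> T -> R) c e : 0 < c ->
  (forall n, itg P (f n)) -> (forall n w, 0 <= f n w) ->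
  (\forall n \near \oo, Ex P (f n) <= c * e) -> hp e (fun n w => f n w < c).
Proof.
move=> c0 fi f0; apply: filterS => n hn; exists [set w | f n w < c] => //; split.
  by apply: (measurable_set_lt (g := fun=> c)) => //; exact: itg_meas.
rewrite (_ : ~` _ = [set w | c <= f n w]).
  by rewrite (le_trans (markov_Pr (fi n) (f0 n) c0))// ler_pdivrMl.
by apply/seteqP; split => w /=; [move/negP; rewrite -leNgt|rewrite leNgt => /negP].
Qed.

(** Slutsky's lemma for characteristic functions: the cosine is 1-Lipschitz on the good event, and
    two cosines differ by at most 2 outside it. *)
Lemma cvg_cos_perturbation (y v : nat -> T -> R) (phi l : R) :
  (forall n, measurable_fun setT (y n)) -> (forall n, measurable_fun setT (v n)) ->
  (forall kappa e, 0 < kappa -> 0 < e -> hp e (fun n w => `|y n w - v n w| <= kappa)) ->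
  (fun n => Ex P (fun w => cos (v n w + phi))) @ \oo --> l ->
  (fun n => Ex P (fun w => cos (y n w + phi))) @ \oo --> l.
Proof.
move=> my mv yv vl.
rewrite (_ : (fun n => _) = (fun n => Ex P (fun w => cos (v n w + phi)) +
   (Ex P (fun w => cos (y n w + phi)) - Ex P (fun w => cos (v n w + phi))))); last first.
  by apply/funext => n; rewrite addrC subrK.
rewrite -[l]addr0; apply: cvgD => //; apply/cvgrPdist_le => /= e e0.
have e4 : 0 < e / 4 by rewrite divr_gt0.
apply: filterS (yv _ _ e4 e4) => n [B [mB PB] hB].
have iy := itg_cosD P phi (my n); have iv := itg_cosD P phi (mv n).
rewrite sub0r normrN -ExB//.
have mBc : measurable (~` B) by exact: measurableC.
apply: (@le_trans _ _ (Ex P (fun w => e / 4 + 2 * \1_(~` B) w))).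
  apply: Ex_abs_le; first exact: itgB.
    by apply: itgD; [exact: itg_cst|apply: itgZ; exact: itg_indic].
  move=> w; rewrite indicE; have [Bw|Bw] := pselect (B w).
    rewrite (memNset (A := ~` B)); last by move=> /(_ Bw).
    rewrite mulr0 addr0 (le_trans _ (hB w Bw))//.
    rewrite (_ : y n w + phi = v n w + phi + (y n w - v n w)); last by ring.
    exact: abs_cos_sub.
  rewrite mem_set//.
  rewrite mulr1 (le_trans (ler_normB _ _))//.
  have c1 z : `|cos z| <= 1 :> R by rewrite ler_norml cos_geN1 cos_le1.
  by have := c1 (y n w + phi); have := c1 (v n w + phi); lra.
rewrite ExD; [|exact: itg_cst|by apply: itgZ; exact: itg_indic].
rewrite (ExZ _ (itg_indic P mBc)) Ex_cst -Pr_Ex//; lra.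
Qed.

(* The Fejer kernel [|sum_k exp(i k r y)|^2] is [N^2] at [y = 0] and has a small Gaussian mean. *)
Lemma hp_nonzero (y : nat -> T -> R) (V : R) : 0 < V ->
  (forall n, measurable_fun setT (y n)) ->
  (forall r phi, (fun n => Ex P (fun w => cos (r * y n w + phi))) @ \oo -->
     expR (- (r ^+ 2 * V) / 2) * cos phi) ->
  forall e, 0 < e -> hp e (fun n w => y n w != 0).
Proof.
move=> V0 my cy e e0.
have e4 : 0 < e / 4 by rewrite divr_gt0.
(* Then exp(- r^2 V / 2) = exp(- 4 / e) is at most e / 4 and bounds each off-diagonal term. With 1 /
   N at most e / 4 for the diagonal, and e / 4 for the convergence, Markov's inequality leaves 3 e /
   4. *)
pose r := Num.sqrt (8 / (e * V)).
have r2 : r ^+ 2 * V / 2 = 4 / e.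
  by rewrite sqr_sqrtr; [field; rewrite !gt_eqF|rewrite divr_ge0// mulr_ge0// ltW].
pose qq := expR (- (r ^+ 2 * V) / 2).
have q4 : qq <= e / 4.
  rewrite /qq mulNr r2 expRN; rewrite invf_ple ?posrE ?expR_gt0//.
  rewrite invf_div (le_trans _ (expR_ge1Dx _))//; lra.
have [N' _ hN'] := near_infty_natSinv_lt (PosNum e4).
pose N := N'.+1.
have NN : N%:R^-1 <= e / 4 by apply: ltW; exact: (hN' N' (leqnn N')).
have N0 : 0 < N%:R :> R by [].
pose D n w := \sum_(k < N) \sum_(l < N) cos ((k%:R - l%:R) * r * y n w + 0).
have ic n c : itg P (fun w => cos (c * y n w + 0)).
  by apply: itg_cosD; exact: measurable_funM.
have iD n : itg P (D n) by apply: itg_sum => k _; apply: itg_sum => l _; exact: ic.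
have DE n w : D n w = (\sum_(k < N) cos (k%:R * r * y n w)) ^+ 2 +
    (\sum_(k < N) sin (k%:R * r * y n w)) ^+ 2.
  rewrite !expr2 !mulr_suml -big_split/=; apply: eq_bigr => k _.
  rewrite !mulr_sumr -big_split/=; apply: eq_bigr => l _.
  by rewrite addr0 !mulrBl cosB.
have D0 n w : 0 <= D n w by rewrite DE addr_ge0// sqr_ge0.
have cD : (fun n => Ex P (D n)) @ \oo -->
    \sum_(k < N) \sum_(l < N) expR (- (((k%:R - l%:R) * r) ^+ 2 * V) / 2) * cos 0.
  rewrite (_ : (fun n => _) = (fun n => \sum_(k < N) \sum_(l < N)
     Ex P (fun w => cos ((k%:R - l%:R) * r * y n w + 0)))).
    by apply: cvg_seq_sum => k; apply: cvg_seq_sum => l; exact: cy.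
  apply/funext => n; rewrite Ex_sum => [|k _]; last by apply: itg_sum => l _; exact: ic.
  by apply: eq_bigr => k _; rewrite Ex_sum.
have Dle : \sum_(k < N) \sum_(l < N) expR (- (((k%:R - l%:R) * r) ^+ 2 * V) / 2) * cos 0 <=
    N%:R + N%:R ^+ 2 * qq.
  apply: (@le_trans _ _ (\sum_(k < N) \sum_(l < N) ((k == l)%:R + qq))).
    apply: ler_sum => k _; apply: ler_sum => l _; rewrite cos0 mulr1.
    have [->|kl] := eqVneq k l.
      by rewrite subrr mul0r expr2 mul0r mul0r oppr0 mul0r expR0 lerDl expR_ge0.
    rewrite add0r ler_expR ler_pM2r ?invr_gt0// lerN2 ler_pM2r// exprMn ler_peMl ?sqr_ge0//.
    have [lt|gt|e'] := ltngtP k l; last by rewrite (val_inj e') eqxx in kl.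
      have : k%:R + 1 <= l%:R :> R by rewrite natr1 ler_nat.
      rewrite expr2; nra.
    have : l%:R + 1 <= k%:R :> R by rewrite natr1 ler_nat.
    rewrite expr2; nra.
  have row (k : 'I_N) : \sum_(l < N) ((k == l)%:R + qq) = 1 + N%:R * qq.
    rewrite big_split/= sumr_const card_ord (bigD1 k)//= eqxx big1 ?addr0 ?mulr_natl// => l lk.
    by rewrite eq_sym (negbTE lk).
  rewrite (eq_bigr _ (fun k _ => row k)) sumr_const card_ord.
  by rewrite mulrnDl -[(_ * qq) *+ N]mulr_natl expr2 mulrA.
have /cvgrPdist_le/(_ (N%:R ^+ 2 * (e / 4))) := cD.
have N2 : 0 < N%:R ^+ 2 :> R by exact: exprn_gt0.
move=> /(_ (mulr_gt0 N2 e4)) hD.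
have hm : hp e (fun n w => D n w < N%:R ^+ 2).
  apply: hp_markov => //; apply: filterS hD => n; rewrite ler_norml => /andP[h _].
  have : N%:R <= N%:R ^+ 2 * (e / 4).
    rewrite expr2 -mulrA ler_peMr ?(ltW N0)// -ler_pdivrMl ?mulr1//.
  have : N%:R ^+ 2 * qq <= N%:R ^+ 2 * (e / 4) by rewrite ler_pM2l.
  move: h Dle; lra.
apply: hp_sub hm _.
apply: nearW => n w; apply: contraTneq => y0; rewrite -leNgt DE y0.
under eq_bigr => k _ do rewrite mulr0 cos0.
by rewrite sumr_const card_ord lerDl sqr_ge0.
Qed.

End high_probability.

(** * Rates, sparsity and limit law of the estimators *)

Section adaptive_lasso.
Context {R : realType} {d : measure_display} {T : measurableType d} (P : probability T R).
Context {p : nat}.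
Variables (C M : 'M[R]_p) (W : nat -> T -> 'rV[R]_p) (A : nat -> T -> 'M[R]_p).
Variables (obj : nat -> T -> 'rV[R]_p -> R) (th0 : 'rV[R]_p) (Theta : set 'rV[R]_p).
Variables (lam : nat -> R) (gam : R) (thtil thhat : nat -> T -> 'rV[R]_p).

Hypothesis obj_expand : forall n w th, obj n w th =
  obj n w th0 - 2 * dotp (W n w) (th - th0) + qf (A n w) (th - th0).
Hypothesis A_sym : forall n w, (A n w)^T = A n w.
Hypothesis A_itg : forall n i j, itg P (fun w => A n w i j).
Hypothesis A_lim : forall i j,
  (fun n => Ex P (fun w => `|n%:R^-1 * A n w i j - C i j|)) @ \oo --> 0.
Hypothesis W_L2 : forall n i, L2 P (fun w => W n w ord0 i).
Hypothesis W_sqr : forall n al, Ex P (fun w => dotp (W n w) al ^+ 2) = n%:R * qf M al.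
Hypothesis W_clt : forall al phi, (fun n => Ex P (fun w =>
    cos ((Num.sqrt n%:R)^-1 * dotp (W n w) al + phi))) @ \oo --> expR (- qf M al / 2) * cos phi.
Hypothesis C_posdef : posdef C.
Hypothesis M_posdef : posdef M.
Hypothesis Theta_int : interior Theta th0.
Hypothesis gam_gt0 : 0 < gam.
Hypothesis lam_gt0 : forall n, 0 < lam n.
Hypothesis lam_small : (fun n => lam n / Num.sqrt n%:R) @ \oo --> 0.
Hypothesis lam_large : (fun n => lam n * (n%:R `^ ((gam - 1) / 2))) @ \oo --> +oo.
Hypothesis thtil_meas : forall n j, measurable_fun setT (fun w => thtil n w ord0 j).
Hypothesis thhat_meas : forall n j, measurable_fun setT (fun w => thhat n w ord0 j).
Hypothesis thtil_min : forall n w, Theta (thtil n w) /\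
  forall th, Theta th -> obj n w (thtil n w) <= obj n w th.
Hypothesis thhat_min : forall n w, Theta (thhat n w) /\
  forall th, Theta th ->
    obj n w (thhat n w) + alasso_pen (lam n) gam (thtil n w) (thhat n w)
    <= obj n w th + alasso_pen (lam n) gam (thtil n w) th.

Let S := finset (fun j : 'I_p => th0 ord0 j != 0).

Let x n w : 'rV[R]_p := (Num.sqrt n%:R)^-1 *: W n w.
Let a n w : 'M[R]_p := n%:R^-1 *: A n w.
Let zt n w : 'rV[R]_p := Num.sqrt n%:R *: (thtil n w - th0).
Let zh n w : 'rV[R]_p := Num.sqrt n%:R *: (thhat n w - th0).
(** Inverse of the change of variable z = sqrt n (th - th0), valid for n > 0. *)
Let at_ (n : nat) (z : 'rV[R]_p) : 'rV[R]_p := th0 + (Num.sqrt n%:R)^-1 *: z.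

Let sqrtn_gt0 n : (0 < n)%N -> 0 < Num.sqrt n%:R :> R.
Proof. by move=> n0; rewrite sqrtr_gt0 ltr0n. Qed.

Let at_rescale n th : (0 < n)%N -> at_ n (Num.sqrt n%:R *: (th - th0)) = th.
Proof.
by move=> n0; rewrite /at_ scalerA mulVf ?gt_eqF ?sqrtn_gt0// scale1r addrC subrK.
Qed.

Let obj_at n w z : (0 < n)%N ->
  obj n w (at_ n z) = obj n w th0 + (- 2 * dotp (x n w) z + qf (a n w) z).
Proof.
move=> n0; have s0 := sqrtn_gt0 n0; pose r : R := (Num.sqrt n%:R)^-1.
have r2 : n%:R^-1 = r ^+ 2 by rewrite /r exprVn sqr_sqrtr.
rewrite obj_expand /at_ (addrC th0) addrK -/r -addrA.
by rewrite /x /a dotpZr dotpZl qf_scaler qf_scalel -/r r2; ring.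
Qed.

Let small_at (rho : 'I_p -> R) L : (forall i, 0 < rho i) -> \forall n \near \oo,
  forall z : 'rV[R]_p, nsq z <= L -> forall i, `|(Num.sqrt n%:R)^-1 * z ord0 i| < rho i.
Proof.
move=> rho0.
have h i : \forall n \near \oo, forall z : 'rV[R]_p, nsq z <= L -> `|(Num.sqrt n%:R)^-1 * z ord0 i| < rho i.
  near=> n => z zL.
  have n0 : (0 < n)%N by near: n; exact: nbhs_infty_gt.
  have s0 := sqrtn_gt0 n0.
  rewrite normrM normfV (gtr0_norm s0) mulrC ltr_pdivrMr// -ltr_sqr ?nnegrE//; last by rewrite mulr_ge0// ltW.
  rewrite exprMn sqr_sqrtr// real_normK ?num_real// (le_lt_trans (coord_nsq z i))//.
  rewrite (le_lt_trans zL)// mulrC -ltr_pdivrMr ?exprn_gt0//.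
  near: n; exact: nbhs_infty_gtr.
have hh : \forall n \near \oo, forall i, forall z : 'rV[R]_p, nsq z <= L ->
    `|(Num.sqrt n%:R)^-1 * z ord0 i| < rho i by apply: filter_forall.
by apply: filterS hh => n hn z zL i; exact: hn.
Unshelve. all: by end_near. Qed.

(** Makes bounded local variables admissible competitors, uniformly, so that [z] may be random. *)
Let Theta_at L : \forall n \near \oo, forall z, nsq z <= L -> Theta (at_ n z).
Proof.
have /nbhs_rowP[rho rho0 hT] := Theta_int.
have := @small_at (fun=> rho) L (fun=> rho0).
apply: filterS => n hn z zL; apply: hT => i.
by rewrite !mxE opprD addrA subrr add0r normrN hn.
Qed.

Let at0 n : at_ n 0 = th0.
Proof. by rewrite /at_ scaler0 addr0. Qed.

Let quad0 n w : - 2 * dotp (x n w) 0 + qf (a n w) 0 = 0.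
Proof. by rewrite /dotp /qf trmx0 !mulmx0 !mxE mulr0 addr0. Qed.

Let Theta_th0 : Theta th0.
Proof. exact: nbhs_singleton. Qed.

Let half_hp e E F : hp P (e / 2) E -> hp P (e / 2) F -> hp P e (fun n w => E n w /\ F n w).
Proof. by move=> hE hF; have := hp_and hE hF; rewrite -splitr. Qed.

(** For n > 0 the mean of |x_n|^2 is exactly the trace of [M]; Markov's inequality does the rest. *)
Let score_tight e : 0 < e -> exists2 L, 0 < L & hp P e (fun n w => nsq (x n w) <= L).
Proof.
move=> e0; pose m := \sum_i M i i.
have xE n w : nsq (x n w) = n%:R^-1 * \sum_i W n w ord0 i ^+ 2.
  rewrite nsqE mulr_sumr; apply: eq_bigr => i _; rewrite !mxE exprMn.
  by rewrite exprVn sqr_sqrtr.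
have iW n i : itg P (fun w => W n w ord0 i ^+ 2) by case: (W_L2 n i).
have EW n i : Ex P (fun w => W n w ord0 i ^+ 2) = n%:R * M i i.
  have := W_sqr n (1 *: delta_mx 0 i); rewrite qf_delta expr1n mul1r => <-.
  by apply: eq_Ex => w; rewrite dotp_delta mul1r.
have M0 i : 0 <= M i i.
  have := EW 1%N i; rewrite mul1r => <-; apply: Ex_ge0 => w; exact: sqr_ge0.
have m0 : 0 <= m by exact: sumr_ge0.
have L0 : 0 < (m + 1) / e by rewrite divr_gt0// ltr_wpDl.
have ix n : itg P (fun w => nsq (x n w)).
  apply: (@eq_itg _ _ _ _ (fun w => n%:R^-1 * \sum_i W n w ord0 i ^+ 2)) => [w|].
    by rewrite xE.
  by apply: itgZ; apply: itg_sum.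
exists ((m + 1) / e) => //.
have h : hp P e (fun n w => nsq (x n w) < (m + 1) / e).
  apply: hp_markov => // [n w|]; first exact: nsq_ge0.
  near=> n; have n0 : (0 < n)%N by near: n; exact: nbhs_infty_gt.
  rewrite divfK ?gt_eqF// (_ : Ex P _ = m) ?lerDl//.
  transitivity (Ex P (fun w => n%:R^-1 * \sum_i W n w ord0 i ^+ 2)).
    by apply: eq_Ex => w; rewrite xE.
  rewrite ExZ ?Ex_sum//; last exact: itg_sum.
  rewrite mulr_sumr; apply: eq_bigr => i _; rewrite EW mulKf// pnatr_eq0 -lt0n//.
by apply: hp_sub h _; apply: nearW => n w /ltW.
Unshelve. all: by end_near. Qed.

Let gram_near eta e : 0 < eta -> 0 < e ->
  hp P e (fun n w => forall i j, `|(a n w - C) i j| <= eta).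
Proof.
move=> eta0 e0; have h (ij : 'I_p * 'I_p) e' : 0 < e' ->
    hp P e' (fun n w => `|n%:R^-1 * A n w ij.1 ij.2 - C ij.1 ij.2| < eta).
  move=> e'0; apply: hp_markov => // [n|].
    by apply/itg_abs/itgB; [exact: itgZ|exact: itg_cst].
  apply: filterS (cvg0_near (A_lim ij.1 ij.2) (mulr_gt0 eta0 e'0)) => n.
  by move=> h; rewrite (le_trans (ler_norm _)).
apply: hp_sub (hp_forall h e0) _; apply: nearW => n w hw i j.
by have := hw (i, j); rewrite !mxE => /ltW.
Qed.

Let c0E : exists c, 0 < c /\ forall z, c * nsq z <= qf C z.
Proof. by have [c c0 hc] := posdef_coercive C_posdef; exists c. Qed.

Let eta_bound (c : R) : 0 < c -> exists2 eta : R, 0 < eta & eta * p%:R <= c.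
Proof.
move=> c0; exists (c / (p%:R + 1)); first by rewrite divr_gt0// ltr_wpDl.
by rewrite mulrAC ler_pdivrMr ?ltr_wpDl// ler_pM2l// lerDl.
Qed.

Let til_opt n w z : (0 < n)%N -> Theta (at_ n z) ->
  - 2 * dotp (x n w) (zt n w) + qf (a n w) (zt n w) <= - 2 * dotp (x n w) z + qf (a n w) z.
Proof.
move=> n0 hz; have [_ /(_ _ hz)] := thtil_min n w.
by rewrite -[in X in X <= _](at_rescale (thtil n w) n0) !obj_at// lerD2l.
Qed.

(** Comparison with [th0] itself, the point z = 0, where the local criterion vanishes. *)
Let rate_til e : 0 < e -> exists2 L, 0 < L & hp P e (fun n w => nsq (zt n w) <= L).
Proof.
move=> e0; have e2 : 0 < e / 2 by rewrite divr_gt0.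
have [c [c0 hc]] := c0E.
have [L L0 hL] := score_tight e2.
have c2 : 0 < c / 2 by rewrite divr_gt0.
have [eta eta0 heta] := eta_bound c2.
exists (32 / c ^+ 2 * L + p%:R + 1).
  by rewrite ltr_wpDl// addr_ge0// mulr_ge0 ?(ltW L0)// divr_ge0// exprn_ge0// ltW.
apply: hp_sub (half_hp hL (gram_near eta0 e2)) _.
near=> n => w [xL aC].
have n0 : (0 < n)%N by near: n; exact: nbhs_infty_gt.
have T0 : Theta (at_ n 0) by rewrite at0.
have := til_opt w n0 T0; rewrite quad0.
move=> h.
have h' : - 2 * dotp (x n w) (zt n w) + qf (a n w) (zt n w) <= c / 8 * (p%:R + nsq (zt n w)).
  by apply: le_trans h _; rewrite mulr_ge0 ?addr_ge0 ?nsq_ge0// divr_ge0// ltW.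
have := rate_bound c0 hc aC heta h' => hz.
rewrite (le_trans hz)// -addrA lerD//; last by rewrite lerDl.
by rewrite ler_wpM2l// divr_ge0// exprn_ge0// ltW.
Unshelve. all: by end_near. Qed.

(** Nearly optimal points of the row space lie near the minimizer of the limiting criterion. The
    slack [eps] accommodates the penalty of the lasso; it and the Gram error each take half of c
    kappa. *)
Let close_bound k (E : 'M[R]_(k, p)) (kappa L : R) : E *m E^T = 1%:M -> 0 < kappa -> 0 < L ->
  exists eta eps, [/\ 0 < eta, 0 < eps & forall n w z,
    nsq z <= L -> nsq (x n w) <= L -> z *m E^T *m E = z ->
    (forall i j, `|(a n w - C) i j| <= eta) ->
    - 2 * dotp (x n w) z + qf (a n w) z <=
      - 2 * dotp (x n w) (rmin C E (x n w)) + qf (a n w) (rmin C E (x n w)) + eps ->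
    nsq (rmin C E (x n w) - z) <= kappa].
Proof.
move=> EE k0 L0; have [c [c0 hc]] := c0E; have [b b0 hb] := rmin_bound C E.
have D0 : 0 < L + b * L by rewrite ltr_wpDr// mulr_ge0// ltW.
have eta'0 : 0 < c * kappa / 2 / (L + b * L) by rewrite !divr_gt0// mulr_gt0.
have [eta eta0 heta] := eta_bound eta'0.
exists eta, (c * kappa / 2); split => //; first by rewrite divr_gt0// mulr_gt0.
move=> n w z zL xL zE aC h.
have [Cs _] := C_posdef.
have := qf_minimizer_distance Cs (rmin_ortho C_posdef EE (x n w) zE)
  (rmin_qf C_posdef EE (x n w)) aC h => q.
have vL : nsq (rmin C E (x n w)) <= b * L by rewrite (le_trans (hb _))// ler_wpM2l.
rewrite -(ler_pM2l c0) (le_trans (hc _))// (le_trans q)//.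
rewrite [leRHS]splitr lerD2r.
rewrite -(divfK (lt0r_neq0 D0) (c * kappa / 2)); apply: ler_pM => //; last exact: lerD.
  by rewrite mulr_ge0// ltW.
by rewrite addr_ge0// nsq_ge0.
Qed.

Let til_close kappa e : 0 < kappa -> 0 < e ->
  hp P e (fun n w => nsq (rmin C 1%:M (x n w) - zt n w) <= kappa).
Proof.
move=> k0 e0; have e2 : 0 < e / 2 by rewrite divr_gt0.
have e4 : 0 < e / 2 / 2 by rewrite divr_gt0.
have [L1 L10 h1] := score_tight e4; have [L2 L20 h2] := rate_til e4.
have EE : (1%:M : 'M[R]_p) *m 1%:M^T = 1%:M by rewrite trmx1 mulmx1.
have L0 : 0 < L1 + L2 by rewrite addr_gt0.
have [eta [eps [eta0 eps0 hc]]] := close_bound EE k0 L0.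
have [b b0 hb] := rmin_bound C (1%:M : 'M[R]_p).
apply: hp_sub (half_hp (half_hp h1 h2) (gram_near eta0 e2)) _.
near=> n => w [[xL zL] aC].
have n0 : (0 < n)%N by near: n; exact: nbhs_infty_gt.
apply: hc => //.
- by rewrite (le_trans zL)// lerDr ltW.
- by rewrite (le_trans xL)// lerDl ltW.
- by rewrite trmx1 !mulmx1.
rewrite ler_wpDr ?(ltW eps0)//; apply: til_opt => //.
have : nsq (rmin C 1%:M (x n w)) <= b * L1 by rewrite (le_trans (hb _))// ler_wpM2l.
by move: (rmin C 1%:M (x n w)); near: n; exact: Theta_at.
Unshelve. all: by end_near. Qed.

Let dotp_x n w al : dotp (x n w) al = (Num.sqrt n%:R)^-1 * dotp (W n w) al.
Proof. by rewrite /x dotpZl. Qed.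

Let mx n al : measurable_fun setT (fun w => dotp (x n w) al).
Proof.
rewrite (_ : (fun w => _) = fun w => (Num.sqrt n%:R)^-1 * dotp (W n w) al).
  by apply: measurable_funM => //; apply: measurable_dotp => i; case: (W_L2 n i).
by apply/funext => w; rewrite dotp_x.
Qed.

Let rmin_clt k (E : 'M[R]_(k, p)) u phi : E *m E^T = 1%:M ->
  (fun n => Ex P (fun w => cos (dotp (rmin C E (x n w) *m E^T) u + phi))) @ \oo -->
  expR (- qf (invmx (E *m C *m E^T) *m (E *m M *m E^T) *m invmx (E *m C *m E^T)) u / 2) * cos phi.
Proof.
move=> EE; rewrite -qf_sandwich//.
have := @W_clt (u *m invmx (E *m C *m E^T) *m E) phi.
rewrite (_ : (fun n => Ex P (fun w => cos (dotp _ u + phi))) = (fun n => Ex P (fun w =>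
   cos ((Num.sqrt n%:R)^-1 * dotp (W n w) (u *m invmx (E *m C *m E^T) *m E) + phi))))//.
by apply/funext => n; apply: eq_Ex => w; rewrite dotp_rmin// dotp_x.
Qed.

(** Off [S] the event is that a coordinate of [zt] is nonzero, and its limiting variance [V j j] is
    positive since [C] and [M] are positive definite. *)
Let til_nonzero e : 0 < e -> hp P e (fun n w => forall j, j \notin S -> thtil n w ord0 j != 0).
Proof.
move=> e0; pose E : 'M[R]_p := 1%:M.
have EE : E *m E^T = 1%:M by rewrite trmx1 mulmx1.
pose V := invmx (E *m C *m E^T) *m (E *m M *m E^T) *m invmx (E *m C *m E^T).
have [_ Vp] : posdef V by exact: posdef_sandwich.
have V0 j : 0 < V j j.
  have := Vp (1 *: delta_mx 0 j); rewrite -/(qf V _) qf_delta expr1n mul1r; apply.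
  apply/eqP => /rowP/(_ j); rewrite !mxE !eqxx mulr1 => /eqP; by rewrite oner_eq0.
have mz n j : measurable_fun setT (fun w => zt n w ord0 j).
  rewrite (_ : (fun w => _) = fun w => Num.sqrt n%:R * (thtil n w ord0 j - th0 ord0 j)).
    by apply: measurable_funM => //; exact: measurable_funB.
  by apply/funext => w; rewrite !mxE.
have nz j e' : 0 < e' -> hp P e' (fun n w => zt n w ord0 j != 0).
  apply: (hp_nonzero (V0 j) (fun n => mz n j)) => r phi.
  rewrite (_ : r ^+ 2 * V j j = qf V (r *: delta_mx 0 j)); last by rewrite qf_delta.
  apply: (@cvg_cos_perturbation _ _ _ _ _ (fun n w => dotp (rmin C E (x n w) *m E^T) (r *: delta_mx 0 j))).
  - by move=> n; exact: measurable_funM.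
  - move=> n; rewrite (_ : (fun w => _) = fun w => dotp (x n w) ((r *: delta_mx 0 j) *m invmx (E *m C *m E^T) *m E)).
      exact: mx.
    by apply/funext => w; rewrite dotp_rmin.
  - move=> kappa e1 kappa0 e10.
    have r1 : 0 < (kappa / (`|r| + 1)) ^+ 2 by rewrite exprn_gt0// divr_gt0// ltr_wpDl.
    apply: hp_sub (til_close r1 e10) _; apply: nearW => n w h.
    rewrite dotp_delta trmx1 mulmx1 -mulrBr normrM distrC.
    have {}h := le_trans (coord_nsq _ j) h.
    have : `|(rmin C E (x n w) - zt n w) ord0 j| <= kappa / (`|r| + 1).
      rewrite -ler_sqr ?nnegrE// ?real_normK ?num_real//.
      by rewrite divr_ge0 ?(ltW kappa0)// addr_ge0.
    rewrite !mxE => h1; apply: (@le_trans _ _ ((`|r| + 1) * (kappa / (`|r| + 1)))).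
      by apply: ler_pM => //; rewrite lerDl.
    by rewrite mulrC divfK// gt_eqF// ltr_wpDl.
  - exact: rmin_clt.
apply: hp_sub (hp_forall nz e0) _; apply: nearW => n w h j jS; apply: contra_neq (h j) => t0.
move: jS; rewrite inE negbK => /eqP j0.
by rewrite !mxE t0 j0 subrr mulr0.
Qed.

Let wt (tt : 'rV[R]_p) j := (`|tt ord0 j| `^ gam)^-1.

Let wt_ge0 tt j : 0 <= wt tt j.
Proof. by rewrite invr_ge0 powR_ge0. Qed.

Let penE n tt th : alasso_pen (lam n) gam tt th = lam n * \sum_j `|th ord0 j| * wt tt j.
Proof. by []. Qed.

Let hat_opt n w z : (0 < n)%N -> Theta (at_ n z) ->
  - 2 * dotp (x n w) (zh n w) + qf (a n w) (zh n w) <=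
  - 2 * dotp (x n w) z + qf (a n w) z +
    (alasso_pen (lam n) gam (thtil n w) (at_ n z) - alasso_pen (lam n) gam (thtil n w) (thhat n w)).
Proof.
move=> n0 hz; have [_ /(_ _ hz)] := thhat_min n w.
rewrite -[in X in obj _ _ X](at_rescale (thhat n w) n0) !obj_at//; lra.
Qed.

(** On [S] the first estimate is eventually at least half the true coefficient, so the weights at
    [th0 / 2] bound it from above. *)
Let weight_bound : exists2 B, 0 <= B & forall L, \forall n \near \oo, forall w,
  nsq (zt n w) <= L -> forall j, j \in S -> wt (thtil n w) j <= B.
Proof.
pose B := \sum_j wt (2^-1 *: th0) j.
exists B => [|L]; first by apply: sumr_ge0 => j _; exact: wt_ge0.
pose rho j := if j \in S then `|th0 ord0 j| / 2 else 1.
have rho0 j : 0 < rho j.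
  by rewrite /rho; case: ifPn => //; rewrite inE => j0; rewrite divr_gt0// normr_gt0.
near=> n => w zL j jS.
have n0 : (0 < n)%N by near: n; exact: nbhs_infty_gt.
have : forall i, `|(Num.sqrt n%:R)^-1 * zt n w ord0 i| < rho i.
  by move: (zt n w) zL; near: n; exact: small_at.
move=> /(_ j); rewrite /rho jS.
have -> : (Num.sqrt n%:R)^-1 * zt n w ord0 j = thtil n w ord0 j - th0 ord0 j.
  by rewrite !mxE mulrA mulVf ?mul1r// gt_eqF// sqrtn_gt0.
move=> close; have j0 : 0 < `|th0 ord0 j| by rewrite normr_gt0; rewrite inE in jS.
have half : `|(2^-1 *: th0) ord0 j| <= `|thtil n w ord0 j|.
  rewrite mxE normrM gtr0_norm ?invr_gt0//.
  have := ler_normB (thtil n w ord0 j) (thtil n w ord0 j - th0 ord0 j).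
  by rewrite opprB addrC subrK; lra.
have h0 : 0 < `|(2^-1 *: th0) ord0 j|.
  by rewrite mxE normrM mulr_gt0// normr_gt0 invr_eq0.
apply: (@le_trans _ _ (wt (2^-1 *: th0) j)).
  rewrite lef_pV2 ?posrE ?powR_gt0//; last exact: lt_le_trans half.
  by apply: ge0_ler_powR => //; exact: ltW.
by rewrite /B (bigD1 j)//= lerDl sumr_ge0// => i _; exact: wt_ge0.
Unshelve. all: by end_near. Qed.

(** Off [S] the first point pays nothing, so the possibly huge weights there only help; on [S] the
    penalty is Lipschitz with bounded weights. *)
Let pen_diff n tt (z1 z2 : 'rV[R]_p) B : (0 < n)%N -> 0 <= B ->
  (forall j, j \in S -> wt tt j <= B) -> (forall j, j \notin S -> z1 ord0 j = 0) ->
  alasso_pen (lam n) gam tt (at_ n z1) - alasso_pen (lam n) gam tt (at_ n z2) <=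
  lam n / Num.sqrt n%:R * (B * \sum_j `|z1 ord0 j - z2 ord0 j|).
Proof.
move=> n0 B0 hB hz; have s0 := sqrtn_gt0 n0.
rewrite !penE -mulrBr -sumrB -mulrA ler_pM2l// !mulr_sumr; apply: ler_sum => j _.
rewrite -mulrBl; have [jS|jS] := boolP (j \in S); last first.
  have j0 : th0 ord0 j = 0 by move: jS; rewrite inE negbK => /eqP.
  rewrite !mxE (hz j jS) j0 mulr0 addr0 normr0 sub0r mulNr.
  apply: (@le_trans _ _ 0); first by rewrite oppr_le0 mulr_ge0.
  by rewrite mulr_ge0 ?mulr_ge0// invr_ge0 ltW.
apply: (@le_trans _ _ (`|at_ n z1 ord0 j - at_ n z2 ord0 j| * wt tt j)).
  by rewrite ler_wpM2r ?wt_ge0// lerB_dist.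
rewrite [leRHS]mulrCA [leRHS]mulrC; apply: ler_pM; rewrite ?normr_ge0 ?wt_ge0 ?hB//.
rewrite !mxE opprD addrACA subrr add0r -mulrBr normrM gtr0_norm ?invr_gt0//.
Qed.

Let norm_sum_le (z : 'rV[R]_p) : \sum_j `|z ord0 j| <= p%:R + nsq z.
Proof.
rewrite nsqE -[X in X%:R]card_ord -sumr_const -big_split/=; apply: ler_sum => j _.
have := sqr_ge0 (`|z ord0 j| - 1); rewrite sqrrB real_normK ?num_real// mulr1 expr1n.
have := normr_ge0 (z ord0 j); lra.
Qed.

(** Again a comparison with z = 0; the penalty is eventually below the excess that [rate_bound]
    tolerates because lam / sqrt n tends to 0. *)
Let rate_hat e : 0 < e -> exists2 L, 0 < L & hp P e (fun n w => nsq (zh n w) <= L).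
Proof.
move=> e0; have e2 : 0 < e / 2 by rewrite divr_gt0.
have e4 : 0 < e / 2 / 2 by rewrite divr_gt0.
have [c [c0 hc]] := c0E.
have [L L0 hL] := score_tight e4.
have [Lt Lt0 hLt] := rate_til e4.
have [B B0 hB] := weight_bound.
have c2 : 0 < c / 2 by rewrite divr_gt0.
have [eta eta0 heta] := eta_bound c2.
exists (32 / c ^+ 2 * L + p%:R + 1).
  by rewrite ltr_wpDl// addr_ge0// mulr_ge0 ?(ltW L0)// divr_ge0// exprn_ge0// ltW.
apply: hp_sub (half_hp (half_hp hL hLt) (gram_near eta0 e2)) _.
have lB : (fun n => lam n / Num.sqrt n%:R * B) @ \oo --> 0 by exact: cvg0Mr.
near=> n => w [[xL ztL] aC].
have n0 : (0 < n)%N by near: n; exact: nbhs_infty_gt.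
have s0 := sqrtn_gt0 n0.
have T0 : Theta (at_ n 0) by rewrite at0.
have wB : forall j, j \in S -> wt (thtil n w) j <= B.
  by move: (w) ztL; near: n; exact: hB.
have lBc : lam n / Num.sqrt n%:R * B <= c / 8.
  rewrite (le_trans (ler_norm _))//; near: n.
  by apply: cvg0_near => //; rewrite divr_gt0.
have := hat_opt w n0 T0; rewrite quad0 add0r -[in X in _ - alasso_pen _ _ _ X](at_rescale (thhat n w) n0) -/(zh n w) => h.
have hpen := @pen_diff n (thtil n w) 0 (zh n w) B n0 B0 wB (fun j _ => mxE _ _ _ _).
have h' : - 2 * dotp (x n w) (zh n w) + qf (a n w) (zh n w) <= c / 8 * (p%:R + nsq (zh n w)).
  apply: le_trans h (le_trans hpen _); rewrite mulrA.
  apply: ler_pM => //.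
  - by rewrite mulr_ge0// divr_ge0// ltW.
  - exact: sumr_ge0.
  - rewrite (le_trans _ (norm_sum_le _))// ler_sum// => j _.
    by rewrite [in X in X - _]mxE sub0r normrN.
have := rate_bound c0 hc aC heta h' => hz.
rewrite (le_trans hz)// -addrA lerD//; last by rewrite lerDl.
by rewrite ler_wpM2l// divr_ge0// exprn_ge0// ltW.
Unshelve. all: by end_near. Qed.

Let zh_support n w : (forall j, j \notin S -> thhat n w ord0 j = 0) ->
  forall j, j \notin S -> zh n w ord0 j = 0.
Proof.
move=> h j jS; have j0 : th0 ord0 j = 0 by move: jS; rewrite inE negbK => /eqP.
by rewrite !mxE (h j jS) j0 subrr mulr0.
Qed.

Let coord_le (z : 'rV[R]_p) L j : nsq z <= L -> `|z ord0 j| <= 1 + L.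
Proof.
move=> zL; have := le_trans (coord_nsq z j) zL.
have := sqr_ge0 (`|z ord0 j| - 1); rewrite sqrrB real_normK ?num_real// mulr1 expr1n.
have := normr_ge0 (z ord0 j); lra.
Qed.

(* Setting a nonzero coordinate outside the support to zero saves a penalty that
   the quadratic part cannot compensate. *)
Let drop_coord n w j L K : (0 < n)%N -> j \notin S -> nsq (x n w) <= L -> nsq (zh n w) <= L ->
  (forall i k, `|a n w i k| <= K) -> 0 <= L -> 0 <= K ->
  Theta (at_ n (zh n w - zh n w ord0 j *: delta_mx 0 j)) -> thhat n w ord0 j != 0 ->
  lam n / Num.sqrt n%:R * wt (thtil n w) j <= (2 + 2 * p%:R * K + K) * (1 + L).
Proof.
move=> n0 jS xL zL aK L0 K0 hT hj; have s0 := sqrtn_gt0 n0.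
have j0 : th0 ord0 j = 0 by move: jS; rewrite inE negbK => /eqP.
set t := zh n w ord0 j in hT *; set h := t *: delta_mx 0 j in hT *.
have t0 : 0 < `|t| by rewrite normr_gt0 /t !mxE j0 subr0 mulf_neq0// gt_eqF.
have as_ : (a n w)^T = a n w by rewrite /a linearZ /= A_sym.
have := hat_opt w n0 hT.
rewrite dotpBr (qfB (zh n w) h as_) qf_delta -/h !dotp_delta -/h.
have penD : alasso_pen (lam n) gam (thtil n w) (at_ n (zh n w - h)) -
    alasso_pen (lam n) gam (thtil n w) (thhat n w) = - (`|t| * (lam n / Num.sqrt n%:R * wt (thtil n w) j)).
  rewrite -[in X in _ - alasso_pen _ _ _ X](at_rescale (thhat n w) n0) -/(zh n w) !penE -mulrBr -sumrB.
  have atE z i : at_ n z ord0 i = th0 ord0 i + (Num.sqrt n%:R)^-1 * z ord0 i by rewrite !mxE.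
  have hE i : (zh n w - h) ord0 i = if i == j then 0 else zh n w ord0 i.
    have hi : h ord0 i = t * (i == j)%:R by rewrite /h !mxE eqxx.
    have -> : (zh n w - h) ord0 i = zh n w ord0 i - h ord0 i by rewrite !mxE.
    by rewrite hi; have [->|_] := eqVneq i j; rewrite ?mulr1 ?subrr// mulr0 subr0.
  rewrite (bigD1 j)//= big1 => [|i ij]; last by rewrite !atE hE (negbTE ij) subrr.
  rewrite addr0 !atE hE eqxx j0 mulr0 !add0r normr0 mul0r sub0r -/t normrM normfV (gtr0_norm s0).
  ring.
rewrite penD.
have xj := coord_le j xL; have zk k := coord_le k zL.
have hza : `|(zh n w *m a n w) ord0 j| <= p%:R * K * (1 + L).
  rewrite mxE (le_trans (ler_norm_sum _ _ _))//.
  apply: (@le_trans _ _ (\sum_(k < p) K * (1 + L))).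
    by apply: ler_sum => k _; rewrite normrM mulrC; apply: ler_pM.
  by rewrite sumr_const card_ord -mulrA mulr_natl.
have ajj := aK j j; have tL := zk j; rewrite -/t in tL.
move=> h1; pose X := lam n / Num.sqrt n%:R * wt (thtil n w) j; rewrite -/X in h1 *.
have h2 : `|t| * X <= `|t| * (2 * `|x n w ord0 j| + 2 * `|(zh n w *m a n w) ord0 j| + `|t| * `|a n w j j|).
  have e1 : t * x n w ord0 j <= `|t| * `|x n w ord0 j| by rewrite -normrM ler_norm.
  have e2 : - (t * (zh n w *m a n w) ord0 j) <= `|t| * `|(zh n w *m a n w) ord0 j|.
    by rewrite -normrM -normrN ler_norm.
  have e3 : t ^+ 2 * a n w j j <= `|t| * (`|t| * `|a n w j j|).
    by rewrite mulrA -expr2 real_normK ?num_real// ler_wpM2l ?sqr_ge0// ler_norm.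
  move: h1 e1 e2 e3; lra.
rewrite ler_pM2l// in h2; apply: le_trans h2 _.
have : `|t| * `|a n w j j| <= (1 + L) * K by apply: ler_pM.
move: hza xj; lra.
Qed.


(** The origin of the exponent in [lam_large]: a weight of order n^(gam / 2) against the factor lam
    / sqrt n of the local penalty. *)
Let sqrt_powR n : (0 < n)%N -> lam n / Num.sqrt n%:R * (Num.sqrt n%:R `^ gam) =
  lam n * (n%:R `^ ((gam - 1) / 2)).
Proof.
move=> n0; have nR : n%:R != 0 :> R by rewrite pnatr_eq0 -lt0n.
rewrite (_ : (gam - 1) / 2 = 2^-1 * gam - 2^-1); last by field.
rewrite powRD ?nR ?implybT// powRN powRrM !powR12_sqrt//; ring.
Qed.

(** A coordinate kept off [S] would bound lam / sqrt n times its weight by [D]. But |thtil_j| is at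
    most (1 + L2) / sqrt n, so this product is at least a constant times the diverging sequence of
    [lam_large]. *)
Lemma sparsity e : 0 < e -> hp P e (fun n w => forall j, j \notin S -> thhat n w ord0 j = 0).
Proof.
move=> e0; have e2 : 0 < e / 2 by rewrite divr_gt0.
have e4 : 0 < e / 2 / 2 by rewrite divr_gt0.
have e8 : 0 < e / 2 / 2 / 2 by rewrite divr_gt0.
have [L0 L00 h0] := score_tight e8; have [L1 L10 h1] := rate_hat e8.
have [L2 L20 h2] := rate_til e8; have [KC KC0 hKC] := entry_le C.
have h3 := gram_near ltr01 e8.
pose L := L0 + L1; pose K := KC + 1.
have L_ge0 : 0 <= L by rewrite addr_ge0// ltW.
have K_ge0 : 0 <= K by rewrite addr_ge0.
pose D := (2 + 2 * p%:R * K + K) * (1 + L).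
apply: hp_sub (half_hp (half_hp (half_hp h0 h1) (half_hp h2 h3)) (til_nonzero e2)) _.
near=> n => w [[[xL zL] [ztL aC]] tnz] j jS.
have n0 : (0 < n)%N by near: n; exact: nbhs_infty_gt.
have s0 := sqrtn_gt0 n0.
have aK i k : `|a n w i k| <= K.
  rewrite (_ : a n w i k = C i k + (a n w - C) i k); last by rewrite !mxE; ring.
  by rewrite (le_trans (ler_normD _ _))// lerD.
have zL' : nsq (zh n w) <= L by rewrite (le_trans zL)// lerDr ltW.
have xL' : nsq (x n w) <= L by rewrite (le_trans xL)// lerDl ltW.
apply/eqP/negPn/negP => hj.
have hT : Theta (at_ n (zh n w - zh n w ord0 j *: delta_mx 0 j)).
  have : nsq (zh n w - zh n w ord0 j *: delta_mx 0 j) <= 2 * L + 2 * L.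
    rewrite -scaleNr (le_trans (nsqD_le _ _))// lerD// ler_pM2l//.
    rewrite /nsq dotp_delta !mxE !eqxx mulr1 -expr2 sqrrN.
    by apply: le_trans zL'; have := coord_nsq (zh n w) j; rewrite !mxE.
  move: (zh n w - _); near: n; exact: Theta_at.
have := drop_coord n0 jS xL' zL' aK L_ge0 K_ge0 hT hj; rewrite -/D.
have j0 : th0 ord0 j = 0 by move: jS; rewrite inE negbK => /eqP.
have tE : `|thtil n w ord0 j| = (Num.sqrt n%:R)^-1 * `|zt n w ord0 j|.
  rewrite !mxE j0 subr0 normrM (gtr0_norm s0) mulKf// gt_eqF//.
have tL : `|thtil n w ord0 j| <= (Num.sqrt n%:R)^-1 * (1 + L2).
  by rewrite tE ler_pM2l ?invr_gt0// coord_le.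
have L21 : 0 < 1 + L2 by rewrite addr_gt0.
have wL : Num.sqrt n%:R `^ gam * ((1 + L2) `^ gam)^-1 <= wt (thtil n w) j.
  have -> : Num.sqrt n%:R `^ gam * ((1 + L2) `^ gam)^-1 = (((Num.sqrt n%:R)^-1 * (1 + L2)) `^ gam)^-1.
    rewrite powRM ?invr_ge0 ?(ltW s0) ?(ltW L21)// invfM; congr (_ * _).
    by rewrite -(powR_inv1 (ltW s0)) -powRrM mulN1r powRN invrK.
  (* Inverting the inequality requires [thtil_j] to be nonzero, which [tnz] provides. *)
  rewrite lef_pV2 ?posrE ?powR_gt0 ?normr_gt0 ?tnz ?mulr_gt0 ?invr_gt0//.
  by apply: ge0_ler_powR => //; [exact: ltW|rewrite nnegrE mulr_ge0 ?invr_ge0 ?ltW].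
apply/negP; rewrite -ltNge.
apply: (@lt_le_trans _ _ (lam n / Num.sqrt n%:R * (Num.sqrt n%:R `^ gam * ((1 + L2) `^ gam)^-1))).
  rewrite mulrA sqrt_powR// ltr_pdivlMr ?powR_gt0//.
  by near: n; move/cvgryPgt : lam_large; exact.
by rewrite ler_wpM2l// divr_ge0// ltW.
Unshelve. all: by end_near. Qed.

Let rowBE (y z : 'rV[R]_p) j : (y - z) ord0 j = y ord0 j - z ord0 j.
Proof. by rewrite !mxE. Qed.

(** By [sparsity] the estimator lies in the row space of [sel S], where it competes with the
    restricted minimizer; their penalties differ by at most lam / sqrt n times B D, which falls
    below [eps]. *)
Let hat_close kappa e : 0 < kappa -> 0 < e ->
  hp P e (fun n w => nsq (rmin C (sel S) (x n w) - zh n w) <= kappa).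
Proof.
move=> k0 e0; have e2 : 0 < e / 2 by rewrite divr_gt0.
have e4 : 0 < e / 2 / 2 by rewrite divr_gt0.
have e8 : 0 < e / 2 / 2 / 2 by rewrite divr_gt0.
have [L1 L10 h1] := score_tight e8; have [L2 L20 h2] := rate_hat e8.
have [Lt Lt0 ht] := rate_til e8.
have EE := @sel_mulT R p S.
have L0 : 0 < L1 + L2 by rewrite addr_gt0.
have [eta [eps [eta0 eps0 hc]]] := close_bound EE k0 L0.
have [b b0 hb] := rmin_bound C (sel S).
have [B B0 hB] := weight_bound.
pose D := p%:R + (2 * (b * L1) + 2 * L2).
have D0 : 0 < D by rewrite ltr_wpDl// ltr_wpDl ?mulr_gt0// mulr_ge0// mulr_ge0// ltW.
apply: hp_sub (half_hp (half_hp (half_hp h1 h2) (half_hp ht (gram_near eta0 e8))) (sparsity e2)) _.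
have lB : (fun n => lam n / Num.sqrt n%:R * (B * D)) @ \oo --> 0 by exact: cvg0Mr.
near=> n => w [[[xL zL] [ztL aC]] sp].
have n0 : (0 < n)%N by near: n; exact: nbhs_infty_gt.
have s0 := sqrtn_gt0 n0.
have vL : nsq (rmin C (sel S) (x n w)) <= b * L1 by rewrite (le_trans (hb _))// ler_wpM2l.
apply: hc => //.
- by rewrite (le_trans zL)// lerDr ltW.
- by rewrite (le_trans xL)// lerDl ltW.
- by apply: sel_support; exact: zh_support.
have hT : Theta (at_ n (rmin C (sel S) (x n w))).
  by move: (rmin C (sel S) (x n w)) vL; near: n; exact: Theta_at.
have wB : forall j, j \in S -> wt (thtil n w) j <= B.
  by move: (w) ztL; near: n; exact: hB.
have := hat_opt w n0 hT.
rewrite -[in X in _ - alasso_pen _ _ _ X](at_rescale (thhat n w) n0) -/(zh n w) => h.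
have vS j : j \notin S -> rmin C (sel S) (x n w) ord0 j = 0 by exact: mul_sel_notin.
have := pen_diff (zh n w) n0 B0 wB vS => hpen.
apply: le_trans h _; rewrite lerD2l (le_trans hpen)//.
apply: (@le_trans _ _ (lam n / Num.sqrt n%:R * (B * D))); last first.
  rewrite (le_trans (ler_norm _))//; near: n; exact: cvg0_near.
rewrite ler_wpM2l ?divr_ge0 ?(ltW s0)// ?(ltW (lam_gt0 n))// ler_wpM2l//.
apply: le_trans (le_trans (norm_sum_le (rmin C (sel S) (x n w) - zh n w)) _).
  by rewrite ler_sum// => j _; rewrite rowBE.
rewrite lerD2l (le_trans (nsqD_le _ _))//.
have -> : nsq (- zh n w) = nsq (zh n w) by rewrite -scaleN1r /nsq dotpZl dotpZr; ring.
by rewrite lerD// ler_pM2l.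
Unshelve. all: by end_near. Qed.

Theorem selection_consistency :
  (fun n => P [set w | forall j, j \notin S -> thhat n w ord0 j = 0]) @ \oo --> 1%E.
Proof.
(* Writes the selection event as an inequality for a measurable function, so that it is
   measurable. *)
pose F n w := \sum_j (j \notin S)%:R * `|thhat n w ord0 j|.
have FE n : [set w | forall j, j \notin S -> thhat n w ord0 j = 0] = [set w | F n w <= 0].
  apply/seteqP; split => w /= h.
    rewrite /F big1// => j _; have [jS|jS] := boolP (j \in S); first by rewrite mul0r.
    by rewrite h// normr0 mulr0.
  move=> j jS; apply/eqP; rewrite -normr_le0 (le_trans _ h)// /F (bigD1 j)//= jS mul1r lerDl.
  by apply: sumr_ge0 => i _; rewrite mulr_ge0.
have mF n : measurable [set w | F n w <= 0].
  apply: (measurable_set_le (g := fun=> 0)) => //; apply: measurable_sum => j.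
  by apply: measurable_funM => //; exact: measurableT_comp.
rewrite (_ : (fun n => _) = (fun n => (Pr P [set w | F n w <= 0])%:E)); last first.
  by apply/funext => n; rewrite FE PrK.
apply: cvg_EFin; first exact: nearW.
apply/cvgrPdist_le => /= e e0.
apply: filterS (sparsity e0) => n [B [mB PB] hB].
rewrite -PrC// ger0_norm ?Pr_ge0// (le_trans _ PB)//.
apply: Pr_le; [exact: measurableC|exact: measurableC|].
by apply: subsetC => w /hB; rewrite -FE.
Qed.

Theorem asymptotic_normality : cvg_dist_normal P
  (fun n w => \row_(i < #|S|)
     (Num.sqrt n%:R * (thhat n w ord0 (enum_val i) - th0 ord0 (enum_val i))))
  (invmx (submx_on S C) *m submx_on S M *m invmx (submx_on S C)).
Proof.
pose E := @sel R p S; have EE : E *m E^T = 1%:M by exact: sel_mulT.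
have XE n w : \row_(i < #|S|)
     (Num.sqrt n%:R * (thhat n w ord0 (enum_val i) - th0 ord0 (enum_val i))) = zh n w *m E^T.
  by apply/rowP => i; rewrite mul_trsel !mxE.
rewrite (_ : (fun n => _) = (fun n w => zh n w *m E^T)); last first.
  by apply/funext => n; apply/funext => w; rewrite XE.
rewrite !submx_on_sel -/E.
have mX n i : measurable_fun setT (fun w => (zh n w *m E^T) ord0 i).
  rewrite (_ : (fun w => _) = fun w => Num.sqrt n%:R * (thhat n w ord0 (enum_val i) - th0 ord0 (enum_val i))).
    by apply: measurable_funM => //; exact: measurable_funB.
  by apply/funext => w; rewrite mul_trsel !mxE.
apply: cvg_dist_normal_charfun => //.
- exact: posdef_sandwich.
- move=> u phi; apply: (@cvg_cos_perturbation _ _ _ _ _ (fun n w => dotp (rmin C E (x n w) *m E^T) u)).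
  + by move=> n; exact: measurable_dotp.
  + move=> n; rewrite (_ : (fun w => _) = fun w => dotp (x n w) (u *m invmx (E *m C *m E^T) *m E)).
      exact: mx.
    by apply/funext => w; rewrite dotp_rmin.
  + move=> kappa e kappa0 e0.
    pose y := u *m E; have y1 : 0 < nsq y + 1 by rewrite ltr_wpDl ?nsq_ge0.
    (* With this squared distance, both terms of Young's inequality with weight kappa / (nsq y + 1)
       are at most [kappa]; adding 1 allows y = 0. *)
    have k1 : 0 < kappa ^+ 2 / (nsq y + 1) by rewrite divr_gt0// exprn_gt0.
    apply: hp_sub (hat_close k1 e0) _; apply: nearW => n w h.
    have dE z : dotp (z *m E^T) u = dotp z y by rewrite /dotp /y trmx_mul mulmxA.
    rewrite !dE -dotpBl.
    have c0 : 0 < kappa / (nsq y + 1) by rewrite divr_gt0.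
    have c1 : kappa / (nsq y + 1) * nsq y <= kappa.
      by rewrite mulrAC ler_pdivrMr// ler_pM2l// lerDl.
    have c2 (z : 'rV[R]_p) : nsq z <= kappa ^+ 2 / (nsq y + 1) -> (kappa / (nsq y + 1))^-1 * nsq z <= kappa.
      by move=> hz; rewrite ler_pdivrMl// mulrAC -expr2.
    have Y1 := dotp_young (rmin C E (x n w) - zh n w) y c0.
    have Y2 := dotp_young (zh n w - rmin C E (x n w)) y c0.
    have neg : nsq (zh n w - rmin C E (x n w)) = nsq (rmin C E (x n w) - zh n w).
      by rewrite -opprB -scaleN1r /nsq dotpZl dotpZr; ring.
    have neg2 : dotp (zh n w - rmin C E (x n w)) y = - dotp (rmin C E (x n w) - zh n w) y.
      by rewrite -opprB -scaleN1r dotpZl; ring.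
    have c3 := c2 _ h.
    by rewrite ler_norml; move: Y1 Y2 c1 c3; rewrite neg neg2 => *; apply/andP; split; lra.
  + exact: rmin_clt.
(* Tightness of each coordinate is the rate of [thhat]: |z_i| is at most 1 + |z|^2. *)
- move=> i e e0; have [L L0 hL] := rate_hat e0; exists (1 + L); first by rewrite addr_gt0.
  apply: filterS hL => n [B [mB PB] hB]; apply: le_trans PB; apply: Pr_le.
  + by apply: (measurable_set_lt (f := fun=> 1 + L)) => //; exact: measurableT_comp.
  + exact: measurableC.
  + by move=> w /= hw Bw; move: hw; rewrite mul_trsel ltNge coord_le// hB.
Qed.

End adaptive_lasso.

Unset Implicit Arguments.

Theorem theorem2 (R : realType) (d : measure_display) (Omega : measurableType d)
  (P : probability Omega R) (J q s : nat) (K : bool -> bool -> R)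
  (Y : int -> Omega -> itv R) (X : 'I_J -> int -> Omega -> itv R)
  (th0 : 'rV[R]_(pdim q J s)) (sigma2 : R) (Theta : set 'rV[R]_(pdim q J s))
  (lam : nat -> R) (gam : R) (thtil thhat : nat -> Omega -> 'rV[R]_(pdim q J s)) :
  let Z := fun (t : int) (w : Omega) => Zvec q J s Y X t w in
  let u := fun (th : 'rV[R]_(pdim q J s)) (t : int) (w : Omega) => resid q J s Y X th t w in
  (* E[<s_Z, s_Z'>_K] *)
  let C := \matrix_(i, j) fine ('E_P[fun w => kip K (Z 0%:Z w i) (Z 0%:Z w j)])%E in
  (* E[<s_Z, s_u(th)>_K <s_u(th), s_Z'>_K] *)
  let M := fun th : 'rV[R]_(pdim q J s) =>
    \matrix_(i, j) fine ('E_P[fun w => (kip K (Z 0%:Z w i) (u th 0%:Z w) * kip K (u th 0%:Z w) (Z 0%:Z w j))%R])%E in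
  let S := finset (fun j : 'I_(pdim q J s) => th0 ord0 j != 0) in
  spd_kernel K ->
  (* the processes are random (measurable) *)
  (forall t c, measurable_fun setT (joint_coords Y X t c)) ->
  (* (A1) *)
  strictly_stationary P (joint_coords Y X) ->
  ergodic P (joint_coords Y X) ->
  (forall t, ('E_P[fun w => (knorm2 K (Y t w) ^+ 2)%R] < +oo)%E) ->
  (forall j t, ('E_P[fun w => (knorm2 K (X j t w) ^+ 2)%R] < +oo)%E) ->
  (forall t, cond_exp_const P (info_set Y X t) (fun w => (u th0 t w).1) 0 /\
             cond_exp_const P (info_set Y X t) (fun w => (u th0 t w).2) 0) ->
  (forall t, cond_exp_const P (info_set Y X t) (fun w => knorm2 K (u th0 t w)) sigma2) ->
  (* (A2) *)
  compact Theta -> interior Theta th0 ->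
  (* (A3) *)
  posdef C -> (\forall th \near th0, posdef (M th)) ->
  (* (A4) *)
  0 < gam -> (forall n, 0 < lam n) ->
  (fun n => lam n / Num.sqrt n%:R) @ \oo --> 0 ->
  (fun n => lam n * (n%:R `^ ((gam - 1) / 2))) @ \oo --> +oo ->
  (* the estimators: measurable minimizers over Theta *)
  (forall n j, measurable_fun setT (fun w => thtil n w ord0 j)) ->
  (forall n j, measurable_fun setT (fun w => thhat n w ord0 j)) ->
  (forall n w, Theta (thtil n w) /\
     forall th, Theta th -> dk_obj K q J s Y X n w (thtil n w) <= dk_obj K q J s Y X n w th) ->
  (forall n w, Theta (thhat n w) /\
     forall th, Theta th ->
       dk_obj K q J s Y X n w (thhat n w) + alasso_pen (lam n) gam (thtil n w) (thhat n w)
       <= dk_obj K q J s Y X n w th + alasso_pen (lam n) gam (thtil n w) th) ->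
  (* (i) *)
  ((fun n => P [set w | forall j, j \notin S -> thhat n w ord0 j = 0]) @ \oo --> 1%E) /\
  (* (ii) *)
  cvg_dist_normal P
    (fun n w => \row_(i < #|S|)
        (Num.sqrt n%:R * (thhat n w ord0 (enum_val i) - th0 ord0 (enum_val i))))
    (invmx (submx_on S C) *m submx_on S (M th0) *m invmx (submx_on S C)).
Proof.
move=> Z u C M S Kspd mV sV eV Y4 X4 cu _ _ Tint Cp Mp gam0 lam0 lsmall llarge m1 m2 o1 o2.
have EE (f : Omega -> R) : fine ('E_P[f])%E = Ex P f by rewrite unlock.
have CE : C = \matrix_(i, j) Ex P (fun w =>
    kip K (Zvec q J s Y X 0%:Z w i) (Zvec q J s Y X 0%:Z w j)).
  by apply/matrixP => i j; rewrite /C [LHS]mxE [RHS]mxE; exact: EE.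
have ME : M th0 = \matrix_(i, j) Ex P (fun w =>
    kip K (Zvec q J s Y X 0%:Z w i) (resid q J s Y X th0 0%:Z w) *
    kip K (resid q J s Y X th0 0%:Z w) (Zvec q J s Y X 0%:Z w j)).
  by apply/matrixP => i j; rewrite /M [LHS]mxE [RHS]mxE; exact: EE.
have Mp0 : posdef (M th0) by exact: nbhs_singleton Mp.
have := model_limits Kspd mV sV eV Y4 X4 cu; rewrite -CE -ME => -[Gi Gl W2 Wsq Wclt].
have expand n w th := @dk_obj_expand _ _ _ _ _ _ Y X th0 Kspd n w th.
have Gs n w := @gram_sum_sym _ _ _ q s _ Y X Kspd n w.
split.
  exact: (selection_consistency expand Gs Gi Gl W2 Wsq Wclt Cp Mp0
    Tint gam0 lam0 lsmall llarge m1 m2 o1 o2).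
exact: (asymptotic_normality expand Gs Gi Gl W2 Wsq Wclt Cp Mp0
    Tint gam0 lam0 lsmall llarge m1 m2 o1 o2).
Qed.
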